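(* Consider the branching processes with immigration $\{X_k^{(n)},k\ge 0\}$, $n\in\mathbb N$, of the context, where $\{\varepsilon_k^{(n)}: n,k\in\mathbb N\}$ is an array of rowwise $\psi$-mixing random variables whose mixing coefficients $\psi_n(\cdot)$ satisfy $\sup_{n\ge 1}\sum_{k=1}^\infty \psi_n(k)<\infty$. Assume: (C1) there are sequences $\{\alpha(k),k\ge1\}\in R_\alpha$ and $\{\beta(k),k\ge1\}\in R_\beta$ with $\alpha,\beta\ge 0$ such that for each $s\in\mathbb R_+$, as $n\to\infty$, $$\max_{1\le k\le ns}|\alpha(n,k)-\alpha(k)|=o(\alpha(n)),\qquad \max_{1\le k\le ns}|\beta(n,k)-\beta(k)|=o(\beta(n));$$ (C2) $a_n=1+an^{-1}+o(n^{-1})$ as $n\to\infty$ for some $a\in\mathbb R$; (C3) $b_n=o(\alpha(n))$ as $n\to\infty$; (C4) $\alpha(n)\to\infty$ and $\beta(n)=o(n\alpha^2(n))$ as $n\to\infty$. For $t\in\mathbb R_+$ put $X_n(t)=X^{(n)}_{[nt]}/A(n)$, where $A(n)=\mathbb E X_n^{(n)}$. Then, as $n\to\infty$, the processes $X_n(\cdot)$ converge weakly in the Skorokhod space $D(\mathbb R_+,\mathbb R)$ to the deterministic function $$\pi_\alpha(t)=\frac{\mu_\alpha(t)}{\mu_\alpha(1)},\quad t\in\mathbb R_+,\qquad\text{where}\qquad \mu_\alpha(t)=\int_0^t u^\alpha e^{a(t-u)}\,du.$$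
   Context: Setting. For each $n\in\mathbb N$, $\{\xi_{k,j}^{(n)}:k,j\in\mathbb N\}$ is a family of i.i.d. nonnegative integer valued random variables, independent of the sequence $\{\varepsilon_k^{(n)}:k\in\mathbb N\}$ of nonnegative integer valued random variables (not assumed independent or identically distributed), all defined on one probability space. The process is defined by $$X_0^{(n)}=0,\qquad X_k^{(n)}=\sum_{j=1}^{X_{k-1}^{(n)}}\xi_{k,j}^{(n)}+\varepsilon_k^{(n)},\quad k\in\mathbb N.$$ The quantities $a_n=\mathbb E\xi_{1,1}^{(n)}$, $b_n=\mathrm{Var}(\xi_{1,1}^{(n)})$, $\alpha(n,k)=\mathbb E\varepsilon_k^{(n)}$, $\beta(n,k)=\mathrm{Var}(\varepsilon_k^{(n)})$ are all assumed finite. $X_n(\cdot)$ is considered for those $n$ with $A(n)>0$. $[x]$ denotes the integer part of $x\ge 0$, and $\mathbb R_+=[0,\infty)$. Regular variation. $\{f(n),n\ge1\}\in R_\rho$ means that the positive sequence is regularly varying with exponent $\rho$: $f(n)=n^\rho l(n)$ with $l$ slowly varying at infinity. $\psi$-mixing. For $\sigma$-algebras $\mathcal B,\mathcal R$ let $$\psi(\mathcal B,\mathcal R)=\sup\left\{\left|\frac{\mathbb P(A\cap B)}{\mathbb P(A)\mathbb P(B)}-1\right|: A\in\mathcal B,\ B\in\mathcal R,\ \mathbb P(A)\mathbb P(B)>0\right\}.$$ For a sequence $\{\xi_k\}$ let $\mathfrak F_p^q$ be the $\sigma$-algebra generated by $\xi_i$, $p\le i\le q$, and $\psi(r)=\sup_{k\ge1}\psi(\mathfrak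 F_1^k,\mathfrak F_{k+r}^\infty)$. The sequence is $\psi$-mixing if $\psi(r)\to0$ as $r\to\infty$. An array is rowwise $\psi$-mixing if for every $n\geq 1$ its $n$-th row is a $\psi$-mixing sequence; $\psi_n(\cdot)$ denotes the mixing coefficient of the $n$-th row. *)

(* Defs.v *)
From HB Require Import structures.
From mathcomp Require Import all_boot all_order all_algebra.
From mathcomp Require Import finmap.
From mathcomp Require Import all_classical all_reals all_analysis.
From mathcomp Require Import measurable_realfun.

Set Implicit Arguments.
Unset Strict Implicit.
Unset Printing Implicit Defensive.

Import Order.TTheory GRing.Theory Num.Theory.
Import numFieldNormedType.Exports.

Local Open Scope classical_set_scope.
Local Open Scope ring_scope.

Section regular_variation.
Context {R : realType}.

Definition slowly_varying (l : R -> R) : Prop :=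
  [/\ measurable_fun (`]0, +oo[ : set R) l,
      forall x, 0 < x -> 0 < l x &
      forall c, 0 < c -> l (c * x) / l x @[x --> +oo] --> (1 : R)].

(* Sequences are indexed by n >= 1; their value at 0 is irrelevant. *)
Definition regularly_varying (rho : R) (f : nat -> R) : Prop :=
  (forall n, (0 < n)%N -> 0 < f n) /\
  exists2 l : R -> R, slowly_varying l &
    forall n, (0 < n)%N -> f n = n%:R `^ rho * l n%:R.

End regular_variation.

Section independence_and_mixing.
Context {d d' : measure_display} {T : measurableType d}
        {S : measurableType d'} {R : realType}.
Variable P : probability T R.

Definition mutually_independent {I : choiceType} (D : set I)
    (X : I -> T -> S) : Prop :=
  forall (J : {fset I}) (B : I -> set S),
    [set` J] `<=` D -> (forall i, measurable (B i)) ->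
    P (\bigcap_(i in [set` J]) X i @^-1` B i) =
    (\prod_(i <- J) P (X i @^-1` B i))%E.

Definition identically_distributed {I : Type} (D : set I)
    (X : I -> T -> S) : Prop :=
  forall i j (B : set S), D i -> D j -> measurable B ->
    P (X i @^-1` B) = P (X j @^-1` B).

Definition sigma_generated {I : Type} (D : set I)
    (X : I -> T -> S) : set (set T) :=
  <<s \bigcup_(i in D) preimage_set_system setT (X i) measurable >>.

Definition independent_sigma (F G : set (set T)) : Prop :=
  forall A B, F A -> G B -> P (A `&` B) = (P A * P B)%E.

Definition psi_coef (F G : set (set T)) : \bar R :=
  ereal_sup [set z | exists A B, [/\ F A, G B, (0 < P A * P B)%E &
    z = `|fine (P (A `&` B)) / (fine (P A) * fine (P B)) - 1|%:E]].

Definition mixing_coef (X : nat -> T -> S) (r : nat) : \bar R :=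
  ereal_sup [set psi_coef (sigma_generated [set i | (1 <= i <= k)%N] X)
                          (sigma_generated [set i | (k + r <= i)%N] X)
            | k in [set k | (1 <= k)%N]].

Definition psi_mixing (X : nat -> T -> S) : Prop :=
  mixing_coef X r @[r --> \oo] --> 0%E.

End independence_and_mixing.

(* A càdlàg function on R_+ is encoded by its extension to R which is constant
   on the negative half-line; this representation is unique. *)
Definition cadlag {R : realType} (x : R -> R) : Prop :=
  [/\ forall t, 0 <= t -> x s @[s --> t^'+] --> x t,
      forall t, 0 < t -> cvg (x s @[s --> t^'-]) &
      forall t, t < 0 -> x t = x 0].

Record skorokhod (R : realType) := Skorokhod {
  path :> R -> R ;
  path_cadlag : cadlag path }.

HB.instance Definition _ (R : realType) := gen_eqMixin (skorokhod R).
HB.instance Definition _ (R : realType) := gen_choiceMixin (skorokhod R).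

Section skorokhod_topology.
Context {R : realType}.
Implicit Types (x y : skorokhod R) (lam : R -> R).

Definition time_change lam : Prop :=
  (forall s t, 0 <= s -> s < t -> lam s < lam t) /\
  lam @` [set t | 0 <= t] = [set t | 0 <= t].

Definition log_slope lam : \bar R :=
  ereal_sup [set z | exists s t, [/\ 0 <= t, t < s &
    z = `|ln ((lam s - lam t) / (s - t))|%:E]].

Definition stopped_dist x y lam (u : R) : R :=
  sup [set Num.min `|x (Num.min t u) - y (Num.min (lam t) u)| 1
      | t in [set t | 0 <= t]].

(* The metric of Ethier and Kurtz, Markov Processes, Ch. 3, (5.2). Time changes
   that are not bi-Lipschitz have log_slope +oo and do not affect the infimum. *)
Definition skorokhod_dist x y : \bar R :=
  ereal_inf [set maxe (log_slope lam)
    (\int[lebesgue_measure]_(u in `[0%R, +oo[)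
       (expR (- u) * stopped_dist x y lam u)%:E)%E
    | lam in time_change].

Definition skorokhod_open (U : set (skorokhod R)) : Prop :=
  forall x, U x -> exists2 e : R, 0 < e &
    forall y, (skorokhod_dist x y < e%:E)%E -> U y.

Lemma skorokhod_openT : skorokhod_open setT.
Proof. by move=> x _; exists 1. Qed.

Lemma skorokhod_openI : setI_closed skorokhod_open.
Proof.
move=> U V oU oV x [/oU[e e0 eU] /oV[f f0 fV]].
exists (Num.min e f); first by rewrite lt_min e0.
move=> y xy; split; [apply: eU|apply: fV]; apply: (lt_le_trans xy);
  by rewrite lee_fin ge_min lexx ?orbT.
Qed.

Lemma skorokhod_open_bigU (I : Type) (U : I -> set (skorokhod R)) :
  (forall i, skorokhod_open (U i)) -> skorokhod_open (\bigcup_i U i).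
Proof.
move=> oU x [i _ /oU[e e0 eU]].
by exists e => // y /eU Uy; exists i.
Qed.

HB.instance Definition _ := isOpenTopological.Build (skorokhod R)
  skorokhod_openT skorokhod_openI skorokhod_open_bigU.

End skorokhod_topology.

Section weak_convergence.
Context {d : measure_display} {T : measurableType d} {R : realType}.
Variable P : probability T R.

Definition random_element {E : topologicalType} (X : T -> E) : Prop :=
  forall B, <<s @open E >> B -> measurable (X @^-1` B).

Definition weakly_converges {E : topologicalType}
    (X : nat -> T -> E) (Y : T -> E) : Prop :=
  [/\ forall n, random_element (X n), random_element Y &
      forall f : E -> R, continuous f ->
        (exists M, forall x, `|f x| <= M) ->
        ('E_P[f \o X n] @[n --> \oo] --> 'E_P[f \o Y])%E].

End weak_convergence.

Section branching.
Context {d : measure_display} {T : measurableType d} {R : realType}.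
Variable P : probability T R.

Definition mean (Z : T -> nat) : \bar R := ('E_P[fun w => (Z w)%:R%R])%E.

Definition var (Z : T -> nat) : \bar R := ('V_P[fun w => (Z w)%:R%R])%E.

(* Generations, individuals and immigrations are numbered from 1, as in
   xi k j for k, j >= 1; the entries with a zero index are never used. *)
Fixpoint branching (xi : nat -> nat -> T -> nat) (eps : nat -> T -> nat)
    (k : nat) (w : T) : nat :=
  if k is k'.+1
  then (\sum_(1 <= j < (branching xi eps k' w).+1) xi k j w + eps k w)%N
  else 0%N.

End branching.

Section step_path.
Context {R : realType}.

(* Num.truncn is the integer part on R_+ and 0 on negative numbers. *)
Definition step_fun (x : nat -> R) (n : nat) (t : R) : R :=
  x (Num.truncn (n%:R * t)).

Lemma cadlag_step_fun (x : nat -> R) (n : nat) : cadlag (step_fun x n).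
Proof.
rewrite /step_fun; have [->|n0] := posnP n.
  split => [t _|t _|t _].
  - by under eq_fun do rewrite mul0r; rewrite mul0r; exact: cvg_cst.
  - by under eq_fun do rewrite mul0r; exact: is_cvg_cst.
  - by rewrite !mul0r.
have n0R : 0 < n%:R :> R by rewrite ltr0n.
split => [t t0|t t0|t t0].
- set m := Num.truncn _.
  have /andP[mt tm] : m%:R <= n%:R * t < m.+1%:R.
    by apply: truncn_itv; rewrite mulr_ge0.
  apply: cvg_near_cst; near=> s; apply: congr1; apply: truncn_def.
  have ts : t < s by near: s; exact: nbhs_right_gt.
  rewrite (le_trans mt) ?ler_pM2l ?ltW//= mulrC -ltr_pdivlMr//.
  by near: s; apply: nbhs_right_lt; rewrite ltr_pdivlMr// mulrC.
- pose m := (Num.truncn (n%:R * t)).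
  have nt0 : 0 < n%:R * t by rewrite mulr_gt0.
  have /andP[mt tm] : m%:R <= n%:R * t < m.+1%:R by exact/truncn_itv/ltW.
  have [mt'|mt'] := ltP m%:R (n%:R * t).
    apply/cvg_ex; exists (x m); apply: cvg_near_cst; near=> s; apply: congr1.
    apply: truncn_def; rewrite [_ * s]mulrC; apply/andP; split.
      rewrite -ler_pdivrMr// ltW//.
      by near: s; apply: nbhs_left_gt; rewrite ltr_pdivrMr// mulrC.
    apply: le_lt_trans tm; rewrite mulrC ler_pM2l//.
  have e : m%:R = n%:R * t by apply/eqP; rewrite eq_le mt mt'.
  have m0 : (0 < m)%N by rewrite -(ltr0n R) e.
  apply/cvg_ex; exists (x m.-1); apply: cvg_near_cst; near=> s.
  apply: congr1; apply: truncn_def; rewrite prednK// e ltr_pM2l//.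
  apply/andP; split; last by near: s; exact: nbhs_left_lt.
  rewrite mulrC -ler_pdivrMr// ltW//.
  near: s; apply: nbhs_left_gt; rewrite ltr_pdivrMr// mulrC -e ltr_nat.
  by rewrite prednK.
- apply: congr1; rewrite mulr0 truncn0.
  apply: truncn0Pn; rewrite -ltNge (lt_le_trans _ ler01)//.
  by rewrite pmulr_rlt0.
Unshelve. all: by end_near. Qed.

Definition step_path (x : nat -> R) (n : nat) : skorokhod R :=
  Skorokhod (cadlag_step_fun x n).

End step_path.

Section limit_function.
Context {R : realType}.
Variables (al a : R).
Hypothesis al0 : 0 <= al.

(* mu_fun vanishes for t < 0, where `[0, t] is empty. *)
Definition mu_fun (t : R) : R :=
  (\int[lebesgue_measure]_(u in `[0, t]) (u `^ al * expR (a * (t - u))))%R.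

Definition pi_fun (t : R) : R := mu_fun t / mu_fun 1.

Let g (u : R) : R := u `^ al * expR (- (a * u)).

Let integrable_g (t : R) :
  lebesgue_measure.-integrable `[0, t] (EFin \o g).
Proof.
apply: measurable_bounded_integrable => //.
- by rewrite /= lebesgue_measure_itv/=; case: ifP => _; rewrite -?EFinB ltry.
- apply: measurable_funTS; apply: measurable_funM.
    exact: measurable_powR.
  apply: (measurableT_comp (@measurable_expR R)).
  by under eq_fun do rewrite -mulNr; exact: mulrl_measurable.
- exists (t `^ al * expR (`|a| * t)); split; first exact: num_real.
  move=> M /ltW hM u /=; rewrite in_itv/= => /andP[u0 ut].
  apply: (le_trans _ hM).
  rewrite ger0_norm; last by rewrite mulr_ge0 ?powR_ge0 ?expR_ge0.
  rewrite ler_pM ?powR_ge0 ?expR_ge0//.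
    by rewrite ge0_ler_powR ?nnegrE// (le_trans u0).
  rewrite ler_expR -mulNr (@le_trans _ _ (`|a| * u))//.
    by rewrite ler_wpM2r// -normrN ler_norm.
  by rewrite ler_wpM2l.
Qed.

Let mu_funE (t : R) : mu_fun t =
  expR (a * t) * parameterized_integral lebesgue_measure 0 t g.
Proof.
rewrite /parameterized_integral -RintegralZl//.
apply: eq_Rintegral => u _.
by rewrite /g mulrCA -expRD mulrBr.
Qed.

Let continuous_expRa (t : R) : expR (a * s) @[s --> t] --> expR (a * t).
Proof.
apply: continuous_comp; last exact: continuous_expR.
by apply: continuousM; [exact: cvg_cst|exact: cvg_id].
Qed.

Lemma cadlag_pi_fun : cadlag pi_fun.
Proof.
have cpi (t : R) : 0 <= t -> pi_fun s @[s --> t^'+] --> pi_fun t /\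
    (0 < t -> pi_fun s @[s --> t^'-] --> pi_fun t).
  move=> t0; have t1 : 0 < t + 1 by rewrite ltr_wpDl.
  have [cin c0 _] := (continuous_within_itvP _ t1).1
    (parameterized_integral_continuous (ltW t1) (integrable_g _)).
  have E : pi_fun = (fun s => expR (a * s) *
      parameterized_integral lebesgue_measure 0 s g / mu_fun 1).
    by apply/funext => s; rewrite /pi_fun mu_funE.
  rewrite E; split=> [|{}t0]; (apply: cvgMl; apply: cvgM;
      first by [apply/cvg_at_right_filter; exact: continuous_expRa
               |apply/cvg_at_left_filter; exact: continuous_expRa]).
    move: t0; rewrite le_eqVlt => /predU1P[<-//|t0].
    by apply/cvg_at_right_filter; apply: cin; rewrite in_itv/= t0 ltrDl ltr01.
  by apply/cvg_at_left_filter; apply: cin; rewrite in_itv/= t0 ltrDl ltr01.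
split => [t t0|t t0|t t0].
- by have [] := cpi _ t0.
- by apply/cvg_ex; exists (pi_fun t); have [_] := cpi _ (ltW t0); apply.
- rewrite /pi_fun; congr (_ / _); rewrite !mu_funE /parameterized_integral.
  rewrite set_itv1 Rintegral_set1 set_itv_ge ?bnd_simp -?ltNge//.
  by rewrite Rintegral_set0 !mulr0.
Qed.

Definition pi_path : skorokhod R := Skorokhod cadlag_pi_fun.

End limit_function.

(* Main.v *)
(* Put s_n = n alpha(n), q_k = a_n^(-k) and let eps_k be the immigration of the
   n-th process X. Then q_k X_k = N_k + Z_k, where N is a martingale driven by
   the centred offspring sums and Z_k = sum_(i <= k) q_i eps_i is nondecreasing
   in k. As b_n = o(alpha(n)), Kolmogorov's inequality makes N negligible with
   respect to s_n, uniformly for k <= nS. For Z a variance bound at single times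
   is enough, and it follows from psi-mixing: a monotone process that converges
   in probability on a finite grid to a continuous function converges uniformly,
   so that no maximal inequality for mixing sequences is needed. The means
   E Z_[nt] / s_n are weighted Riemann sums of u^alpha e^(-au), by the uniform
   convergence theorem for slowly varying functions. Hence X_[nt] / s_n converges
   to mu_alpha locally uniformly in probability; as the limit is deterministic,
   this gives weak convergence, with the identity as time change in the Skorokhod
   metric. *)
Require Import Defs.
From HB Require Import structures.
From mathcomp Require Import all_boot all_order all_algebra.
From mathcomp Require Import finmap.
From mathcomp Require Import all_classical all_reals all_analysis.
From mathcomp Require Import measurable_realfun.
From mathcomp Require Import ring lra zify.

Set Implicit Arguments.
Unset Strict Implicit.
Unset Printing Implicit Defensive.

Import Order.TTheory GRing.Theory Num.Theory.
Import numFieldNormedType.Exports.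

Local Open Scope classical_set_scope.
Local Open Scope ring_scope.

(** * Skorokhod space *)

(** The offspring sums have a random number of terms, and no conditional expectation is formed.
    Instead, integrals of nonnegative functions are split over the countably many level sets of the
    history of the process. On each level set the generation size is a constant, and the next
    generation is independent of the level set. Regular variation compares f(k) with f(n) only for k
    >= delta n, whereas the sums start at k = 1. Their heads are controlled by a bound sum_(k <= m)
    f(k) = O(n f(n)) for m <= S n, whose dependence on S is kept explicit: with S = delta the head
    has order delta n f(n), which vanishes with delta after division by n f(n). The weights q_k =
    a_n^(-k) stay between positive constants for k <= nS, so they never change an order of
    magnitude. They serve to make N a martingale and Z monotone at the same time. *)

Section skorokhod_uniform.
Context {R : realType}.
Implicit Types (x y : skorokhod R).

Lemma time_change_id : time_change (@idfun R).
Proof.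
split => // ; rewrite eqEsubset; split => [_ [t t0 <-]//|t t0]; by exists t.
Qed.

Lemma log_slope_id_le0 : (log_slope (@idfun R) <= 0)%E.
Proof.
apply: ge_ereal_sup => _ [s [t [t0 ts ->]]].
by rewrite /= divff ?ln1 ?normr0// subr_eq0 gt_eqF.
Qed.

Definition stopped_gap x y (u t : R) : R :=
  Num.min `|x (Num.min t u) - y (Num.min t u)| 1.

Lemma stopped_gap_ub x y u :
  has_ubound [set stopped_gap x y u t | t in [set t | 0 <= t]].
Proof. by exists 1 => _ [t _ <-]; rewrite ge_min lexx orbT. Qed.

Lemma stopped_dist_id x y u : stopped_dist x y idfun u =
  sup [set stopped_gap x y u t | t in [set t | 0 <= t]].
Proof. by []. Qed.

Lemma stopped_dist_id_ge0 x y u : 0 <= stopped_dist x y idfun u.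
Proof.
rewrite stopped_dist_id; apply: (@le_trans _ _ (stopped_gap x y u 0)).
  by rewrite le_min normr_ge0 ler01.
by apply: ub_le_sup; [exact: stopped_gap_ub|exists 0 => //=].
Qed.

Lemma stopped_dist_id_le x y u c :
  (forall t, 0 <= t -> stopped_gap x y u t <= c) -> stopped_dist x y idfun u <= c.
Proof.
move=> h; apply: ge_sup; first by exists (stopped_gap x y u 0), 0 => /=.
by move=> _ [t t0 <-]; exact: h.
Qed.

Lemma skorokhod_neg x t : t <= 0 -> x t = x 0.
Proof.
by rewrite le_eqVlt => /predU1P[->//|]; case: (path_cadlag x) => _ _; exact.
Qed.

(** Monotonicity in [u] is what makes the integrand of [skorokhod_dist] measurable. If [Num.min t u]
    is negative, both paths take their value at 0 there; the witness [Num.max 0 (Num.min 0 v)] is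
    just 0. *)
Lemma stopped_dist_id_nondecreasing x y :
  nondecreasing_fun (stopped_dist x y idfun).
Proof.
move=> u v uv; apply: stopped_dist_id_le => t t0.
have [tu0|tu0] := leP 0 (Num.min t u).
  apply: ub_le_sup; first exact: stopped_gap_ub.
  exists (Num.min t u) => //=.
  rewrite /stopped_gap; congr (Num.min `|x _ - y _| _).
    by rewrite min_l// ge_min uv orbT.
  by rewrite min_l// ge_min uv orbT.
apply: (@le_trans _ _ (stopped_gap x y v (Num.max 0 (Num.min 0 v)))); last first.
  apply: ub_le_sup; first exact: stopped_gap_ub.
  by exists (Num.max 0 (Num.min 0 v)) => //=; rewrite le_max lexx.
rewrite /stopped_gap !(skorokhod_neg _ (ltW tu0)).
have E0 : Num.min (Num.max 0 (Num.min 0 v)) v <= 0.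
  rewrite (@max_l _ _ 0 (Num.min 0 v)); first by rewrite ge_min lexx.
  by rewrite ge_min lexx.
by rewrite !(skorokhod_neg _ E0).
Qed.

Lemma integral_expRN (S : R) :
  (\int[lebesgue_measure]_(u in `[S, +oo[) (expR (- u))%:E = (expR (- S))%:E)%E.
Proof.
have dN (u : R) : is_derive u (1 : R) (fun u => - expR (- u)) (expR (- u)).
  have h : is_derive u (1 : R) (fun u : R => expR (- u)) (expR (- u) * - 1).
    by apply: is_derive1_comp; apply: is_deriveN.
  by apply: is_derive_eq; rewrite mulrN1 opprK.
have cN : continuous (fun u : R => expR (- u)).
  by move=> u; apply: continuous_comp; [exact: opp_continuous|exact: continuous_expR].
rewrite (@ge0_continuous_FTC2y _ _ (fun u => - expR (- u)) _ 0).
- by rewrite sub0e -EFinN opprK.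
- by move=> u _; exact: expR_ge0.
- by apply: continuous_subspaceT.
- rewrite -oppr0; apply: cvgN.
  exact: cvgr_expR.
- by move=> u _; exact: ex_derive.
- apply: cvg_at_right_filter; apply: cvgN; exact: cN.
- by move=> u _; rewrite derive1E; exact: derive_val.
Qed.

(** The identity has log-slope at most 0, so only the integral counts. Stopping at [u <= S] sees the
    paths on [[0, S]] only; for larger [u] the cap by 1 leaves the tail mass [expR (- S)] of the
    exponential weight. *)
Lemma skorokhod_dist_le x y (S e : R) : 0 <= S -> 0 <= e ->
  (forall t, 0 <= t <= S -> `|x t - y t| <= e) ->
  (skorokhod_dist x y <= (e + expR (- S))%:E)%E.
Proof.
move=> S0 e0 xy; apply: ereal_inf_le; eexists; first by exists idfun; [exact: time_change_id|].
rewrite ge_max; apply/andP; split.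
  by apply: (le_trans log_slope_id_le0); rewrite lee_fin addr_ge0// expR_ge0.
(* The bound [e + 1] for [u > S] is wasteful, but it splits the integral into two explicit ones. *)
pose F (u : R) := (expR (- u) * e + expR (- u) * (S < u)%R%:R)%R.
have mexpN (D : set R) : measurable_fun D (fun u : R => expR (- u)).
  by apply: measurableT_comp => //.
have mlt (D : set R) : measurable_fun D (fun u : R => ((S < u)%R%:R : R)).
  apply: measurable_funTS; apply: nondecreasing_measurable => // u v uv.
  by rewrite ler_nat; case: (ltP S u) => // Su; rewrite (lt_le_trans Su uv).
apply: (@le_trans _ _ (\int[lebesgue_measure]_(u in `[0%R, +oo[) (F u)%:E)%E).
  apply: ge0_le_integral => //=.
  - by move=> u _; rewrite lee_fin mulr_ge0 ?expR_ge0// stopped_dist_id_ge0.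
  - apply/measurable_EFinP; apply: measurable_funM; first exact: mexpN.
    apply: measurable_funTS; apply: nondecreasing_measurable => //.
    exact: stopped_dist_id_nondecreasing.
  - apply/measurable_EFinP; apply: measurable_funD.
      by apply: measurable_funM; [exact: mexpN|].
    by apply: measurable_funM; [exact: mexpN|exact: mlt].
  - move=> u; rewrite in_itv/= andbT => u0.
    rewrite lee_fin /F -mulrDr ler_wpM2l ?expR_ge0//.
    apply: stopped_dist_id_le => t t0; rewrite /stopped_gap.
    have [Su|uS] := ltP S u; first by rewrite ge_min; apply/orP; right; rewrite lerDr.
    rewrite addr0 ge_min xy//; rewrite le_min t0 u0/= ge_min.
    by rewrite uS orbT.
rewrite /F; under eq_integral do rewrite EFinD.
rewrite ge0_integralD//=; try by [move=> u _; rewrite lee_fin mulr_ge0 ?expR_ge0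
  |apply/measurable_EFinP; apply: measurable_funM; [exact: mexpN|exact: mlt || by []]].
rewrite EFinD; apply: leeD.
  under eq_integral do rewrite EFinM.
  rewrite ge0_integralZr//=; try by [move=> u _; rewrite lee_fin expR_ge0
    |apply/measurable_EFinP; exact: mexpN].
  by rewrite integral_expRN oppr0 expR0 mul1e.
have -> : (\int[lebesgue_measure]_(u in `[0%R, +oo[) (expR (- u) * (S < u)%R%:R)%:E =
  \int[lebesgue_measure]_(u in `[0%R, +oo[) (((fun v => (expR (- v))%:E) \_ `]S, +oo[) u))%E.
  apply: eq_integral => u _; rewrite patchE mem_setE in_itv/= andbT.
  by case: ifP => _; rewrite ?mulr1 ?mulr0.
rewrite -integral_mkcondr -(integral_expRN S).
apply: ge0_subset_integral => //=; first exact: measurableI.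
- by apply/measurable_EFinP; exact: mexpN.
- by move=> u [_]; rewrite /= !in_itv/= !andbT => /ltW.
Qed.

End skorokhod_uniform.

(** * Convergence in probability to a constant implies weak convergence *)

Section weak_limit_constant.
Context {d : measure_display} {T : measurableType d} {R : realType}.
Variable P : probability T R.

Lemma random_element_cst {E : topologicalType} (x : E) :
  @random_element _ T _ (fun=> x).
Proof. by move=> B _; rewrite preimage_cst; case: ifP. Qed.

Lemma random_element_comp {E : topologicalType} (X : T -> E) (f : E -> R) :
  random_element X -> continuous f -> measurable_fun setT (f \o X).
Proof.
move=> rX cf; apply: (measurability (@RGenOpens.G R)).
  exact: RGenOpens.measurableE.
move=> _ [B [a [b ->]] <-]; rewrite setTI comp_preimage.
apply: rX; apply: sub_sigma_algebra.
by apply: open_comp; [move=> ? _; exact: cf|exact: interval_open].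
Qed.

(** Openness is by definition the existence of a ball around each point, so no triangle inequality
    for [skorokhod_dist] is involved. *)
Lemma skorokhod_ball_nbhs (f : skorokhod R -> R) x (e : R) :
  continuous f -> 0 < e ->
  exists2 r : R, 0 < r &
    forall y, (skorokhod_dist x y < r%:E)%E -> `|f x - f y| < e.
Proof.
move=> cf e0.
have oU : open (f @^-1` ball (f x) e).
  by apply: open_comp; [move=> ? _; exact: cf|exact: ball_open].
have : skorokhod_open (f @^-1` ball (f x) e) by exact: oU.
by move=> /(_ x (ballxx _ e0))[r r0 h]; exists r => // y /h.
Qed.

(** The integral of [|f x - f (X n w)|] is at most [2 * M * P E] over the exceptional set and at
    most [e / 2] off it. Handing over a measurable [E] avoids the question whether the event of a
    small distance is measurable. *)
Lemma weakly_converges_cst (X : nat -> T -> skorokhod R) x :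
  (forall n, random_element (X n)) ->
  (forall e h : R, 0 < e -> 0 < h -> \forall n \near \oo,
     exists E, [/\ measurable E, (P E <= h%:E)%E &
       forall w, ~ E w -> (skorokhod_dist x (X n w) < e%:E)%E]) ->
  weakly_converges P X (fun=> x).
Proof.
move=> rX Xx; split => //; first exact: random_element_cst.
move=> f cf [M fM].
have M0 : 0 <= M by rewrite (le_trans _ (fM x)).
have mfX n : measurable_fun setT (f \o X n) by exact: random_element_comp.
have ifX n : P.-integrable setT (EFin \o (f \o X n)).
  apply: measurable_bounded_integrable => //.
    by apply: (le_lt_trans (probability_le1 P _)); rewrite ?ltry.
  exists M; split; first exact: num_real.
  by move=> y /ltW My w _; apply: le_trans My; exact: fM.
have EfX n : ('E_P[f \o X n] = (\int[P]_w (f (X n w)))%R%:E)%E.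
  by rewrite unlock /Rintegral fineK//; exact: (integrable_fin_num _ (ifX n)).
under eq_fun do rewrite EfX.
have -> : ('E_P[f \o (fun=> x)] = (f x)%:E)%E.
  by rewrite (_ : f \o _ = cst (f x))// expectation_cst.
apply: cvg_EFin; first by near=> n.
apply/cvgrPdist_le => e e0.
have e20 : 0 < e / 2 by rewrite divr_gt0.
have [r r0 fr] := skorokhod_ball_nbhs x cf e20.
(* This bound on [P E] makes [2 * M * P E] at most [e / 2]; the [+ 1] covers [M = 0]. *)
have h0 : 0 < e / 2 / (2 * M + 1) by rewrite divr_gt0// ltr_wpDl// mulr_ge0.
have PT : fine (P setT) = 1 by rewrite (congr1 fine (probability_setT P)).
near=> n.
have [E [mE PE Exn]] : exists E, [/\ measurable E,
    (P E <= (e / 2 / (2 * M + 1))%:E)%E &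
    forall w, ~ E w -> (skorokhod_dist x (X n w) < r%:E)%E].
  by near: n; exact: Xx.
have icst c : P.-integrable setT (EFin \o (cst c : T -> R)).
  by apply: finite_measure_integrable_cst.
have -> : f x = \int[P]_w (cst (f x) w).
  by rewrite Rintegral_cst// PT mulr1.
rewrite /= -(RintegralB measurableT (icst (f x)) (ifX n)).
have iB : P.-integrable setT (EFin \o (fun w => f x - f (X n w))).
  exact: (@integrableB _ _ _ P setT measurableT _ _ (icst (f x)) (ifX n)).
apply: (le_trans (le_normr_Rintegral _ iB)) => //.
have iE : P.-integrable setT (EFin \o (\1_E : T -> R)) by exact: integrable_indic.
have iME : P.-integrable setT (EFin \o (fun w => 2 * M * \1_E w)).
  exact: (@integrableZl _ _ _ P _ measurableT (2 * M) _ iE).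
have iI : P.-integrable setT (EFin \o (fun w => e / 2 + 2 * M * \1_E w)).
  exact: (@integrableD _ _ _ P setT measurableT _ _ (icst (e / 2)) iME).
apply: (@le_trans _ _ (\int[P]_w (e / 2 + 2 * M * \1_E w))).
  apply: le_Rintegral => //; first exact: (integrable_abse iB).
  move=> w _; have [Ew|/Exn/fr] := pselect (E w).
    rewrite indicE mem_set// mulr1 (le_trans (ler_normB _ _))// mulrDl mul1r.
    by rewrite ler_wpDl ?(ltW e20)// lerD.
  by move=> /ltW /le_trans; apply; rewrite lerDl mulr_ge0// mulr_ge0.
rewrite (RintegralD measurableT (icst (e / 2)) iME).
rewrite Rintegral_cst// PT mulr1 (RintegralZl _ measurableT iE)//.
rewrite [X in _ + _ * X](_ : _ = fine (P E)); last by rewrite /Rintegral integral_indic// setIT.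
have : fine (P E) <= e / 2 / (2 * M + 1).
  by rewrite -lee_fin fineK// fin_num_measure.
rewrite ler_pdivlMr; last by rewrite ltr_wpDl// mulr_ge0.
have : 0 <= fine (P E) by exact: fine_ge0.
nra.
Unshelve. all: by end_near. Qed.

End weak_limit_constant.

(** * Measurability of random step paths *)

Section random_step_path.
Context {d : measure_display} {T : measurableType d} {R : realType}.

Lemma measurable_history {S : Type} (X : nat -> T -> S) (m : nat) (v : seq S) :
  (forall k s, measurable [set w | X k w = s]) ->
  measurable [set w | [seq X k w | k <- iota 0 m] = v].
Proof.
move=> mX; elim: m v => [|m IH] v.
  case: v => [|s v].
    by rewrite (_ : [set _ | _] = setT)//; apply/seteqP; split.
  by rewrite (_ : [set _ | _] = set0)//; apply/seteqP; split.
have E w : [seq X k w | k <- iota 0 m.+1] =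
    rcons [seq X k w | k <- iota 0 m] (X m w).
  by rewrite -addn1 iotaD map_cat cats1.
under eq_set do rewrite E.
case: (lastP v) => [|{}v s].
  by rewrite (_ : [set _ | _] = set0)//; apply/seteqP; split => // w /= /(congr1 size);
    rewrite size_rcons.
rewrite (_ : [set _ | _] = [set w | [seq X k w | k <- iota 0 m] = v] `&`
   [set w | X m w = s]); first exact: measurableI.
apply/seteqP; split => w /=; first by move=> /rcons_inj[-> ->].
by move=> [-> ->].
Qed.

(* Finitely many values determine the path up to a small Skorokhod distance, so
   the preimage of an open set is a countable union of cylinders. *)
Lemma random_element_step_path (X : nat -> T -> nat) (A : R) (n : nat) :
  (forall k x, measurable [set w | X k w = x]) ->
  random_element (fun w => step_path (fun k => (X k w)%:R / A) n).
Proof.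
move=> mX; set Y := (fun w => _).
pose h m w := [seq X k w | k <- iota 0 m].
suff H U : open U -> measurable (Y @^-1` U).
  move=> B; apply: (@smallest_sub _ (sigma_algebra setT) (@open _) [set B | measurable (Y @^-1` B)]).
    split.
    - by rewrite /= preimage_set0.
    - by move=> V /= mV; rewrite setTD preimage_setC; exact: measurableC.
    - by move=> F mF /=; rewrite preimage_bigcup; exact: bigcupT_measurable.
  by move=> U oU; exact: H.
move=> oU.
(* The histories of length [m] that force the path into [U], whatever comes later. *)
pose V m : set (seq nat) := [set v | forall w, h m w = v -> U (Y w)].
rewrite (_ : _ @^-1` _ = \bigcup_m \bigcup_(v in V m) [set w | h m w = v]).
  apply: bigcupT_measurable => m; rewrite bigcup_mkcond.
  apply: countable_bigcupT_measurable => // v; case: ifP => // _.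
  exact: measurable_history.
apply/seteqP; split => w /=; last by move=> [m _ [v Vv /Vv]].
move=> /oU[e e0 Ue].
have [S [S0 Se]] : exists S : R, 0 <= S /\ expR (- S) < e.
  exists (Num.max 0 (- ln e + 1)); rewrite le_max lexx; split => //.
  rewrite -[ltRHS](lnK e0) ltr_expR ltrNl lt_max; apply/orP; right.
  by rewrite ltrDl.
exists (Num.truncn (n%:R * S)).+1 => //; exists (h (Num.truncn (n%:R * S)).+1 w) => //.
move=> w' ww'; apply: Ue; apply: (@le_lt_trans _ _ (0 + expR (- S))%:E); last first.
  by rewrite add0r lte_fin.
apply: skorokhod_dist_le => // t /andP[t0 tS].
rewrite /Y/= /step_fun.
suff -> : X (Num.truncn (n%:R * t)) w = X (Num.truncn (n%:R * t)) w'.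
  by rewrite subrr normr0.
have tn : (Num.truncn (n%:R * t) < (Num.truncn (n%:R * S)).+1)%N.
  by rewrite ltnS; apply: le_truncn; rewrite ler_wpM2l.
have := congr1 (fun s => nth 0%N s (Num.truncn (n%:R * t))) ww'.
by rewrite !(nth_map 0%N) ?size_iota// nth_iota// add0n => ->.
Qed.

End random_step_path.

(** * Regular variation *)

Section uniform_convergence_theorem.
Context {R : realType}.
Notation mu := lebesgue_measure.

Lemma lebesgue_measure_shift (c : R) (A : set R) : measurable A ->
  mu ((fun x => x + c) @^-1` A) = mu A.
Proof.
move=> mA.
have ms : measurable_fun setT ((fun x : R => x + c) : _ -> measurableTypeR R).
  exact: measurable_funD.
rewrite -[LHS]/(pushforward mu ((fun x : R => x + c) : _ -> measurableTypeR R) A).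
apply/esym/lebesgue_measure_unique => //= _ [[a b]] _ <-.
rewrite /pushforward.
have -> : [set` `]a, b] ] = `]a, b]%classic :> set R by [].
rewrite (_ : _ @^-1` _ = `](a - c), (b - c)]%classic); last first.
  by apply/seteqP; split => x /=; rewrite !in_itv/= ltrBlDr lerBrDr.
rewrite !lebesgue_measure_itv/= !lte_fin ltrD2r -!EFinB.
by rewrite (_ : b - c - (a - c) = b - a)//; ring.
Qed.

Definition slow_window (h : R -> R) (M e z : R) : set R :=
  `[0, M]%classic `&` [set v | `|h (z + v) - h z| < e].

Lemma measurable_slow_window (h : R -> R) (M e z : R) : measurable_fun setT h ->
  measurable (slow_window h M e z).
Proof.
move=> mh; apply: measurableI => //.
have : measurable_fun setT (fun v => `|h (z + v) - h z|).
  apply: measurableT_comp => //; apply: measurable_funB => //.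
  by apply: measurableT_comp => //; exact: measurable_funD.
move=> /(_ measurableT _ (measurable_itv `]-oo, e[)).
by rewrite setTI; congr measurable; apply/seteqP; split => v /=; rewrite in_itv.
Qed.

(** By pointwise convergence the sets [W n] of offsets that are good for all indices from [n] on
    increase to [[0, M]], so their measures increase to [M]. Working along a sequence [z] makes this
    continuity of the measure applicable. *)
Lemma slow_window_measure (h : R -> R) (M e eta : R) (z : nat -> R) :
  measurable_fun setT h ->
  (forall v, h (y + v) - h y @[y --> +oo] --> 0) -> z n @[n --> \oo] --> +oo ->
  0 < M -> 0 < e -> 0 < eta ->
  \forall n \near \oo, ((M - eta)%:E <= mu (slow_window h M e (z n)))%E.
Proof.
move=> mh hslow zoo M0 e0 eta0.
pose W n := \bigcap_(m in [set m | (n <= m)%N]) slow_window h M e (z m).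
have mW n : measurable (W n).
  apply: bigcap_measurable; first by exists n => /=.
  by move=> k _; exact: measurable_slow_window.
have ndW : nondecreasing_seq W.
  move=> n m nm; apply/subsetPset => v Wv k /= mk; apply: Wv => /=.
  exact: leq_trans mk.
have UW : \bigcup_n W n = `[0, M]%classic.
  apply/seteqP; split => v; first by move=> [n _ /(_ n (leqnn n))[]].
  move=> vM; have : \forall n \near \oo, `|h (z n + v) - h (z n)| < e.
    have := hslow v => /cvgrPdist_lt /(_ _ e0) H.
    have {}H := zoo _ H; near=> n.
    rewrite (_ : `|_| = `|0 - (h (z n + v) - h (z n))|); last by rewrite sub0r normrN.
    by near: n.
  by move=> [N _ NH]; exists N => // m /= Nm; split => //; exact: NH.
have ndmu : nondecreasing_seq (mu \o W).
  move=> n m nm /=; apply: le_measure; rewrite ?inE; [exact: mW|exact: mW|].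
  exact/subsetPset/ndW.
have cvW := nondecreasing_cvg_mu (mu := mu) mW (bigcup_measurable (fun k _ => mW k)) ndW.
have : ((M - eta)%:E < limn (mu \o W))%E.
  have muI : mu `[0, M]%classic = M%:E.
    by rewrite lebesgue_measure_itv/= lte_fin M0 sube0.
  have -> : limn (mu \o W) = M%:E by rewrite (cvg_lim _ cvW)// UW; exact: muI.
  by rewrite lte_fin ltrBlDr ltrDl.
move=> /(lte_lim ndmu (cvgP _ cvW)); apply: filterS => n /le_trans; apply.
apply: le_measure; rewrite ?inE; [exact: mW|exact: measurable_slow_window|].
by move=> v /(_ n (leqnn n)).
Unshelve. all: by end_near. Qed.

(* For a bad pair (y, u), the slow window of y on [0, 2L] and the slow window of
   y + u on [0, L], shifted by u, are disjoint in [0, 2L]; but their measures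
   tend to 2L and L. *)
Lemma slow_variation_uniform (h : R -> R) (L e : R) :
  measurable_fun setT h -> (forall v, h (y + v) - h y @[y --> +oo] --> 0) ->
  0 < L -> 0 < e ->
  exists Y, forall y u, Y <= y -> 0 <= u <= L -> `|h (y + u) - h y| < e.
Proof.
move=> mh hslow L0 e0; apply: contrapT => /forallNP noY.
have {noY} bad (n : nat) : exists p : R * R,
    [/\ n%:R <= p.1, 0 <= p.2 <= L & e <= `|h (p.1 + p.2) - h p.1|].
  apply: contrapT => nobad; apply: (noY n%:R) => y u ny uL.
  by rewrite ltNge; apply/negP => hyu; apply: nobad; exists (y, u).
have [p hp] := choice bad.
have yoo : (p n).1 @[n --> \oo] --> +oo.
  by apply: (ger_cvgy _ (@cvgr_idn R)); near=> n; have [] := hp n.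
have yuoo : (p n).1 + (p n).2 @[n --> \oo] --> +oo.
  apply: (ger_cvgy _ yoo); near=> n; have [_ /andP[p0 _] _] := hp n.
  by rewrite lerDl.
(* With a loss of [L / 4] in each window the two measures still add up to 5L/2, more than the 2L
   available. *)
have L4 : 0 < L / 4 by rewrite divr_gt0.
have e2 : 0 < e / 2 by rewrite divr_gt0.
have L2 : 0 < 2 * L by rewrite mulr_gt0.
near \oo => n.
have mU : ((2 * L - L / 4)%:E <= mu (slow_window h (2 * L) (e / 2) (p n).1))%E.
  by near: n; apply: slow_window_measure.
have mV : ((L - L / 4)%:E <=
    mu (slow_window h L (e / 2) ((p n).1 + (p n).2)))%E.
  by near: n; apply: slow_window_measure.
have [_ /andP[u0 uL] hu] := hp n.
set y := (p n).1 in mU mV u0 uL hu; set u := (p n).2 in mV u0 uL hu.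
set U := slow_window _ _ _ _ in mU; set V := slow_window _ _ _ _ in mV.
pose V' := (fun x => x + (- u)) @^-1` V.
have mesU : measurable U by exact: measurable_slow_window.
have mesV : measurable V by exact: measurable_slow_window.
have mesV' : measurable V'.
  have : measurable_fun setT (fun x : R => x + - u) by exact: measurable_funD.
  by move=> /(_ measurableT _ mesV); rewrite setTI.
(* From a common point, [h] would differ by less than [e / 2] from both [h y] and [h (y + u)],
   against the choice of the bad pair. *)
have UV0 : U `&` V' = set0.
  apply/seteqP; split => // v [[_ /= vU] [_ /=]].
  rewrite (_ : y + u + (v - u) = y + v); last by ring.
  move=> vV; move: hu; apply/negP; rewrite -ltNge.
  rewrite (_ : h (y + u) - h y = (h (y + v) - h y) - (h (y + v) - h (y + u))); last by ring.
  by rewrite (le_lt_trans (ler_normB _ _))// (splitr e) ltrD.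
have UVsub : U `|` V' `<=` `[0, 2 * L]%classic.
  move=> v [[]//|[]]; rewrite /= !in_itv/= => /andP[v0 vL] _.
  by apply/andP; split; lra.
have muI : mu `[0, 2 * L]%classic = (2 * L)%:E.
  by rewrite lebesgue_measure_itv/= lte_fin L2 sube0.
have UVle : (mu U + mu V' <= (2 * L)%:E)%E.
  rewrite -muI; apply: (@le_trans _ _ (mu (U `|` V'))).
    by rewrite measureU.
  by apply: le_measure; rewrite ?inE//; exact: measurableU.
have muV' : mu V' = mu V by exact: lebesgue_measure_shift.
have : ((2 * L - L / 4)%:E + (L - L / 4)%:E <= (2 * L)%:E)%E.
  by apply: le_trans UVle; rewrite muV'; exact: leeD.
by rewrite -EFinD lee_fin; lra.
Unshelve. all: by end_near. Qed.

(** In the coordinates [h y = ln (l (expR y))] dilations become translations, and [x <= y <= C * x]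
    becomes a shift in [[0, ln C]]. The shift range is taken as [ln C + 1], positive also for
    [C = 1]. *)
Lemma slowly_varying_uniform (l : R -> R) (C e : R) : slowly_varying l ->
  1 <= C -> 0 < e ->
  exists2 X, 0 < X & forall x y, X <= x -> x <= y <= C * x ->
    `|ln (l y) - ln (l x)| < e.
Proof.
move=> [ml l0 lslow] C1 e0.
pose h y := ln (l (expR y)).
have mh : measurable_fun setT h.
  apply: measurableT_comp => //.
  apply: (measurable_comp _ _ ml) => //.
  by move=> _ [y _ <-]; rewrite /= in_itv/= expR_gt0.
have hslow v : h (y + v) - h y @[y --> +oo] --> 0.
  have -> : (fun y => h (y + v) - h y) =
      @ln R \o (fun y => l (expR v * expR y) / l (expR y)).
    apply/funext => y; rewrite /h /= expRD [expR y * _]mulrC.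
    by rewrite ln_div// posrE l0// ?mulr_gt0// expR_gt0.
  have expoo : expR y @[y --> +oo] --> (+oo : set_system R).
    apply: (ger_cvgy _ (@cvg_id _ _)); near=> y.
    by rewrite (le_trans _ (expR_ge1Dx _))// lerDr.
  have E1 : l (expR v * expR y) / l (expR y) @[y --> +oo] --> (1 : R).
    exact: (cvg_comp (@expR R) _ expoo (lslow _ (expR_gt0 v))).
  rewrite -[X in _ --> X](@ln1 R); apply: (cvg_comp _ (@ln R) E1).
  exact: (continuous_ln ltr01).
have L0 : 0 < ln C + 1 by rewrite ltr_wpDl// ln_ge0.
have [Y hY] := slow_variation_uniform mh hslow L0 e0.
exists (expR Y) => [|x y Xx /andP[xy yC]]; first exact: expR_gt0.
have x0 : 0 < x by rewrite (lt_le_trans _ Xx)// expR_gt0.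
have y0 : 0 < y by rewrite (lt_le_trans x0).
have C0 : 0 < C by rewrite (lt_le_trans ltr01).
have := hY (ln x) (ln y - ln x); rewrite /h [ln x + _]addrC subrK !lnK ?posrE//; apply.
  by rewrite -[Y]expRK ler_ln ?posrE ?expR_gt0.
rewrite subr_ge0 ler_ln ?posrE// xy/= lerBlDr.
have : ln y <= ln (C * x) by rewrite ler_ln ?posrE// mulr_gt0.
by rewrite lnM ?posrE//; lra.
Unshelve. all: by end_near. Qed.

End uniform_convergence_theorem.

(** * Ratios and partial sums of regularly varying sequences *)

Section regular_sequences.
Context {R : realType}.

(** Turns an error in an exponent into a relative error; the lower side holds because 1/(1 + y) >= 1
    - y. *)
Lemma abs_expRB1 (x y : R) : 0 <= y -> `|x| <= ln (1 + y) -> `|expR x - 1| <= y.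
Proof.
move=> y0; rewrite ler_norml => /andP[xl xu]; have y1 : 0 < 1 + y by lra.
have xu' : expR x <= 1 + y by rewrite -[leRHS]lnK ?posrE// ler_expR.
have xl' : (1 + y)^-1 <= expR x.
  by rewrite -[leLHS]lnK ?posrE ?invr_gt0// ler_expR lnV ?posrE.
have : 1 - y <= (1 + y)^-1 by rewrite -[leRHS]mul1r ler_pdivlMr//; nra.
by rewrite ler_norml; move=> h; apply/andP; split; lra.
Qed.

(** The form in which regular variation enters all estimates: uniformity in [k] away from 0, without
    mention of the slowly varying factor. It passes to squares directly. *)
Definition ratio_regular (rho : R) (f : nat -> R) : Prop :=
  (forall n, (0 < n)%N -> 0 < f n) /\
  forall delta S e : R, 0 < delta -> 0 < e -> \forall n \near \oo, forall k : nat,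
    delta * n%:R <= k%:R <= S * n%:R ->
    `|f k / f n - (k%:R / n%:R) `^ rho| <= e.

Lemma regularly_varying_ratio rho f : 0 <= rho ->
  regularly_varying rho f -> ratio_regular rho f.
Proof.
move=> rho0 [f0 [l lslow fl]]; split => // delta S e delta0 e0.
have [_ l0 _] := lslow.
(* With this [C] the larger of [k] and [n] is at most [C] times the smaller, whichever is larger. *)
pose C := Num.max 1 (Num.max S delta^-1).
have C1 : 1 <= C by rewrite le_max lexx.
have SC : S <= C by rewrite !le_max lexx orbT.
have dC : delta^-1 <= C by rewrite !le_max lexx !orbT.
have C0 : 0 < C by rewrite (lt_le_trans ltr01).
have CR0 : 0 < C `^ rho by exact: powR_gt0.
have eta0 : 0 < e / C `^ rho by exact: divr_gt0.
have lneta0 : 0 < ln (1 + e / C `^ rho) by rewrite ln_gt0// ltrDl.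
have [X X0 HX] := slowly_varying_uniform lslow C1 lneta0.
near=> n => k /andP[dk kS].
have n0 : 0 < n%:R :> R by near: n; exact: nbhs_infty_gtr.
have Xdn : X <= delta * n%:R.
  rewrite mulrC -ler_pdivrMr//; near: n; exact: nbhs_infty_ger.
have Xn : X <= n%:R by near: n; exact: nbhs_infty_ger.
have Xk : X <= k%:R by rewrite (le_trans Xdn).
have k0 : 0 < k%:R :> R by rewrite (lt_le_trans X0).
have ln_kn : `|ln (l k%:R) - ln (l n%:R)| <= ln (1 + e / C `^ rho).
  have [nk|kn] := leP (n%:R : R) k%:R.
    apply/ltW/HX => //; rewrite nk/= (le_trans kS)// ler_wpM2r// ltW.
  rewrite distrC; apply/ltW/HX => //; rewrite (ltW kn)/=.
  rewrite -ler_pdivrMl// (le_trans _ dk)// ler_wpM2r//.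
  by rewrite -[leRHS]invrK lef_pV2 ?posrE ?invr_gt0.
have -> : f k / f n = (k%:R / n%:R) `^ rho * expR (ln (l k%:R) - ln (l n%:R)).
  rewrite !fl -?(ltr0n R)// expRB !lnK ?posrE ?l0//.
  have -> : k%:R `^ rho = (k%:R / n%:R) `^ rho * n%:R `^ rho :> R.
    by rewrite -powRM ?divr_ge0 ?ltW// divfK ?gt_eqF.
  have := powR_gt0 rho n0; have := l0 _ n0 => h1 h2.
  by field; rewrite !gt_eqF.
rewrite -{2}[_ `^ rho]mulr1 -mulrBr normrM ger0_norm ?powR_ge0//.
apply: (@le_trans _ _ (C `^ rho * (e / C `^ rho))); last first.
  by rewrite mulrC divfK ?gt_eqF.
apply: ler_pM; rewrite ?powR_ge0//.
  apply: ge0_ler_powR; rewrite ?nnegrE ?divr_ge0 ?(ltW C0)//.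
  by rewrite ler_pdivrMr// (le_trans kS)// ler_wpM2r.
by apply: abs_expRB1 => //; exact: ltW.
Unshelve. all: by end_near. Qed.

Lemma ratio_regular_sqr rho f : 0 <= rho ->
  ratio_regular rho f -> ratio_regular (rho * 2) (fun n => f n ^+ 2).
Proof.
move=> rho0 [f0 fr]; split=> [n n0|delta S e delta0 e0].
  by rewrite exprn_gt0// f0.
pose B := (Num.max S 0) `^ rho.
have B0 : 0 <= B by exact: powR_ge0.
(* In r^2 - s^2 = (r - s)(r + s) the second factor is at most 2B + 1 once |r - s| <= 1. *)
pose e1 := Num.min 1 (e / (2 * B + 1)).
have B1 : 0 < 2 * B + 1 by lra.
have e10 : 0 < e1 by rewrite lt_min ltr01 divr_gt0.
near=> n => k dk; have n0 : 0 < n%:R :> R by near: n; exact: nbhs_infty_gtr.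
have : `|f k / f n - (k%:R / n%:R) `^ rho| <= e1.
  by move: k dk; near: n; exact: fr.
rewrite powRrM (powR_mulrn 2) ?powR_ge0// -expr_div_n.
have : (k%:R / n%:R) `^ rho <= B.
  rewrite ge0_ler_powR// ?nnegrE ?divr_ge0 ?le_max ?lexx ?orbT//.
  by rewrite ler_pdivrMr// (andP dk).2.
have := powR_ge0 (k%:R / n%:R) rho.
set s := _ `^ _; set r := _ / _ => s0 sB rs.
have e11 : e1 <= 1 by rewrite ge_min lexx.
have e1e : e1 * (2 * B + 1) <= e by rewrite -ler_pdivlMr// ge_min lexx orbT.
rewrite subr_sqr normrM; apply: (le_trans _ e1e); apply: ler_pM => //.
rewrite (_ : r + s = (r - s) + 2 * s); last by ring.
rewrite (le_trans (ler_normD _ _))// [ `|2 * s|]ger0_norm ?mulr_ge0//.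
lra.
Unshelve. all: by end_near. Qed.

(* Strong induction by halving: for large n, f(n/2) <= 7/5 f(n), hence
   (n/2) f(n/2) <= 7/10 n f(n). *)
Lemma ratio_regular_sum rho f : 0 <= rho -> ratio_regular rho f ->
  exists2 C, 0 < C & forall n, \sum_(1 <= k < n.+1) f k <= C * (n%:R * f n).
Proof.
move=> rho0 [f0 fr].
(* [n./2] is at least n/3 for n >= 2, so [k] ranges over n/3 <= k <= n; the tolerance 2/5 gives f(k)
   <= (1 + 2/5) f(n) there. *)
have t0 : 0 < 3^-1 :> R by rewrite invr_gt0.
have e0 : 0 < 2 / 5 :> R by rewrite divr_gt0.
have [N _ HN] := fr _ 1 _ t0 e0.
have S0 n : 0 <= \sum_(1 <= k < n.+1) f k.
  by rewrite big_seq sumr_ge0// => k; rewrite mem_index_iota => /andP[k0 _]; rewrite ltW// f0.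
have nf0 n : 0 <= n%:R * f n.
  by case: n => [|n]; rewrite ?mul0r// mulr_ge0// ltW// f0.
pose c i := (\sum_(1 <= k < i.+1) f k) / (i%:R * f i).
have c0 i : 0 <= c i by rewrite divr_ge0.
(* The induction closes when 7/10 C + 7/5 <= C, that is C >= 14/3, so 10 is ample. The sum of the
   ratios [c i] settles all [n < N.+2] at once. *)
pose C := 10 + \sum_(0 <= i < N.+2) c i.
have C10 : 10 <= C by rewrite lerDl sumr_ge0.
exists C; first lra.
elim/ltn_ind => n IH; have [->|n0] := posnP n.
  by rewrite big_nil mul0r mulr0.
have fn0 : 0 < f n by exact: f0.
have n0R : 0 < n%:R :> R by rewrite ltr0n.
have [nN|Nn] := ltnP n N.+2.
  rewrite -ler_pdivrMr ?mulr_gt0//.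
  rewrite -/(c n) /C (bigD1_seq n) ?mem_index_iota ?iota_uniq//=.
  by rewrite addrCA lerDl addr_ge0// sumr_ge0.
have rN k : (n%:R / 3 <= k%:R :> R) -> (k <= n)%N -> f k <= 7 / 5 * f n.
  move=> nk kn; rewrite -ler_pdivrMr//.
  have Nn' : (N <= n)%N by lia.
  have HNn := HN n Nn'.
  have := HNn k; rewrite mulrC nk mul1r ler_nat kn => /(_ isT).
  have : (k%:R / n%:R) `^ rho <= 1 :> R.
    apply: (@le_trans _ _ (1 `^ rho)); last by rewrite powR1.
    apply: ge0_ler_powR; rewrite ?nnegrE ?divr_ge0//.
    by rewrite ler_pdivrMr// mul1r ler_nat.
  by rewrite ler_norml => h /andP[_]; lra.
pose m := n./2.
have mn : (m < n)%N by rewrite /m; lia.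
have m3 : n%:R / 3 <= m%:R :> R.
  by rewrite ler_pdivrMr// -natrM ler_nat /m; lia.
have m2 : m%:R * 2 <= n%:R :> R by rewrite -natrM ler_nat /m; lia.
rewrite (@big_cat_nat _ _ _ m.+1)//=; last exact: ltnW.
have h1 := IH m mn.
have h2 : f m <= 7 / 5 * f n by exact: rN (ltnW mn).
have h3 : \sum_(m.+1 <= k < n.+1) f k <= n%:R * (7 / 5 * f n).
  apply: (@le_trans _ _ (\sum_(m.+1 <= k < n.+1) (7 / 5 * f n))).
    rewrite big_seq [leRHS]big_seq; apply: ler_sum => k.
    rewrite mem_index_iota => /andP[mk kn].
    by apply: rN => //; rewrite (le_trans m3)// ler_nat ltnW.
  rewrite sumr_const_nat -[leLHS]mulr_natl ler_wpM2r ?mulr_ge0 ?(ltW fn0)//.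
  by rewrite ler_nat subSS leq_subr.
have h4 : m%:R * f m <= 7 / 10 * (n%:R * f n).
  apply: (@le_trans _ _ (m%:R * (7 / 5 * f n))); first by rewrite ler_wpM2l.
  by rewrite (_ : m%:R * _ = (m%:R * 2) * (7 / 10 * f n)); [rewrite [leRHS]mulrCA ler_wpM2r// mulr_ge0// ltW|field].
have h5 : C * (m%:R * f m) <= C * (7 / 10 * (n%:R * f n)) by rewrite ler_wpM2l//; lra.
have h6 : 0 <= (C - 10) * (n%:R * f n) by rewrite mulr_ge0 ?subr_ge0.
rewrite [C * (7 / 10 * _)]mulrCA in h5; rewrite mulrBl in h6.
rewrite (_ : n%:R * (7 / 5 * f n) = 7 / 5 * (n%:R * f n)) in h3; last by ring.
have := nf0 n; lra.
Qed.

(** [C] is chosen before [S]. The bound therefore tends to 0 with [S], which is what controls the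
    head of a Riemann sum. *)
Lemma ratio_regular_sum_le rho f : 0 <= rho -> ratio_regular rho f ->
  exists2 C, 0 < C & forall S : R, 0 < S -> \forall n \near \oo,
    forall m : nat, m%:R <= S * n%:R ->
    \sum_(1 <= k < m.+1) f k <= C * (S * (S `^ rho + 1)) * (n%:R * f n).
Proof.
move=> rho0 rf; have [C C0 HC] := ratio_regular_sum rho0 rf.
exists C => // S S0; have [f0 fr] := rf.
have S20 : 0 < S / 2 by rewrite divr_gt0.
near=> n => m mS; have n0 : (0 < n)%N by near: n; exists 1%N.
have n0R : 0 < n%:R :> R by rewrite ltr0n.
have Sn1 : 1 <= S * n%:R.
  by rewrite mulrC -ler_pdivrMr//; near: n; exact: nbhs_infty_ger.
(* A small [m] is out of reach of the ratio estimate; the sum is extended to the last admissible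
   index [M], which is at least S n/2. *)
pose M := Num.truncn (S * n%:R).
have /andP[MS SM] : M%:R <= S * n%:R < M.+1%:R by rewrite truncn_itv// (le_trans _ Sn1).
have mM : (m <= M)%N by rewrite truncn_ge_nat// (le_trans _ Sn1).
have M1 : 1 <= M%:R :> R by rewrite ler1n truncn_gt0.
have fM : f M <= (S `^ rho + 1) * f n.
  rewrite -ler_pdivrMr ?f0//.
  have : `|f M / f n - (M%:R / n%:R) `^ rho| <= 1.
    have : S / 2 * n%:R <= M%:R <= S * n%:R.
      rewrite MS andbT; move: SM; rewrite -natr1; lra.
    by move: (M); near: n; exact: fr.
  have : (M%:R / n%:R) `^ rho <= S `^ rho.
    by rewrite ge0_ler_powR// ?nnegrE ?divr_ge0// ?(ltW S0)// ler_pdivrMr.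
  by rewrite ler_norml => h /andP[_]; lra.
apply: (@le_trans _ _ (\sum_(1 <= k < M.+1) f k)).
  rewrite (@big_cat_nat _ _ _ m.+1 1 M.+1)//= lerDl big_seq sumr_ge0// => k.
  by rewrite mem_index_iota => /andP[k0 _]; rewrite ltW// f0// (leq_trans _ k0).
apply: (le_trans (HC M)); rewrite -!mulrA ler_pM2l//.
have -> : S * ((S `^ rho + 1) * (n%:R * f n)) = (S * n%:R) * ((S `^ rho + 1) * f n) by ring.
by apply: ler_pM => //; apply/ltW/f0; rewrite -(ltr0n R); lra.
Unshelve. all: by end_near. Qed.

End regular_sequences.

(** * Riemann sums of arrays *)

Section riemann_sums.
Context {R : realType}.
Notation mu := lebesgue_measure.

Definition primitive (g : R -> R) (t : R) : R := (\int[mu]_(u in `[0%R, t]) g u)%R.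

Lemma primitive0 g : primitive g 0 = 0.
Proof. by rewrite /primitive set_itv1 Rintegral_set1. Qed.

(** Used with [c] a value of [g] for the error of one Riemann rectangle, with [c = 0] for a
    Lipschitz bound, and with [c] the midpoint of a range of values for a two-sided bound. *)
Lemma primitive_increment (g : R -> R) (s t c e : R) :
  mu.-integrable `[0, t] (EFin \o g) -> 0 <= s -> s <= t ->
  (forall u, s <= u <= t -> `|g u - c| <= e) ->
  `|primitive g t - primitive g s - c * (t - s)| <= e * (t - s).
Proof.
move=> ig s0; rewrite le_eqVlt => /predU1P[<- gc|st gc].
  by rewrite !subrr !mulr0 subr0 normr0.
have sub_st : `]s, t] `<=` `[0, t].
  by move=> u; rewrite /= !in_itv/= => /andP[su ->]; rewrite (le_trans s0 (ltW su)).
have igst : mu.-integrable `]s, t] (EFin \o g).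
  by apply: (@integrableS _ _ _ mu `[0, t]%classic).
have fin_st : (mu `]s, t]%classic < +oo)%E.
  by rewrite lebesgue_measure_itv/=; case: ifP => _; rewrite -?EFinB ltry.
have icst (x : R) : mu.-integrable `]s, t] (EFin \o cst x).
  apply: measurable_bounded_integrable => //.
  by exists `|x|; split; [exact: num_real|move=> y /ltW xy u _].
have mst : fine (mu `]s, t]%classic) = t - s.
  by rewrite lebesgue_measure_itv/= lte_fin st.
have -> : primitive g t - primitive g s = \int[mu]_(u in `]s, t]) g u.
  by rewrite /primitive; apply: Rintegral_itvB => //; rewrite ?bnd_simp// ltW.
have -> : c * (t - s) = \int[mu]_(u in `]s, t]) (cst c u).
  by rewrite Rintegral_cst// mst.
rewrite -(RintegralB _ igst (icst c))//.
have iB : mu.-integrable `]s, t] (EFin \o (fun u => g u - c)).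
  exact: (@integrableB _ _ _ mu _ (measurable_itv _) _ _ igst (icst c)).
apply: (le_trans (le_normr_Rintegral _ iB)) => //.
apply: (@le_trans _ _ (\int[mu]_(u in `]s, t]) (cst e u))); last first.
  by rewrite Rintegral_cst// mst.
apply: le_Rintegral => //; first exact: (integrable_abse iB).
by move=> u /=; rewrite in_itv/= => /andP[su ut]; apply: gc; rewrite ltW.
Qed.

Section riemann_limit.
Variables (g : R -> R) (r : nat -> nat -> R) (t B C : R).
Hypothesis ig : forall s, 0 <= s -> mu.-integrable `[0, s] (EFin \o g).
Hypothesis gB : forall u, 0 <= u <= t -> `|g u| <= B.
Hypothesis g_unif : forall delta e : R, 0 < delta -> 0 < e ->
  exists2 eta, 0 < eta & forall u v, delta <= u <= t -> delta <= v <= t ->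
    `|u - v| <= eta -> `|g u - g v| <= e.
Hypothesis r_near : forall delta e : R, 0 < delta -> 0 < e ->
  \forall n \near \oo, forall k : nat, delta * n%:R <= k%:R <= t * n%:R ->
    `|r n k - g (k%:R / n%:R)| <= e.
Hypothesis r_small : forall delta : R, 0 < delta <= 1 ->
  \forall n \near \oo, forall m : nat, m%:R <= delta * n%:R ->
    `|\sum_(1 <= k < m.+1) r n k| <= C * delta * n%:R.

(** Each cell of width 1/n contributes e/n for the oscillation of [g] and e/n for the distance of
    [r n k] to [g]; there are at most n t cells. *)
Lemma riemann_block (delta e : R) : 0 < delta -> 0 < e ->
  \forall n \near \oo, forall K M : nat, (K <= M)%N ->
    delta * n%:R <= K.+1%:R -> M%:R <= t * n%:R ->
    `|n%:R^-1 * (\sum_(K.+1 <= k < M.+1) r n k)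
      - (primitive g (M%:R / n%:R) - primitive g (K%:R / n%:R))| <= 2 * e * t.
Proof.
(* The left end (k - 1)/n of the first cell may fall below [delta], but not below [delta / 2] once
   delta n >= 2. *)
move=> delta0 e0; have delta20 : 0 < delta / 2 by rewrite divr_gt0.
have [eta eta0 Hg] := g_unif delta20 e0.
near=> n => K M KM dK MS; have n0 : 0 < n%:R :> R by near: n; exact: nbhs_infty_gtr.
have ninv : n%:R^-1 <= eta.
  rewrite -[leRHS]invrK lef_pV2 ?posrE ?invr_gt0//; near: n; exact: nbhs_infty_ger.
have dn2 : 2 <= delta * n%:R.
  by rewrite mulrC -ler_pdivrMr//; near: n; exact: nbhs_infty_ger.
have rn : forall k : nat, delta * n%:R <= k%:R <= t * n%:R ->
    `|r n k - g (k%:R / n%:R)| <= e by near: n; exact: r_near.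
have E : primitive g (M%:R / n%:R) - primitive g (K%:R / n%:R) =
    \sum_(K.+1 <= k < M.+1)
      (primitive g (k%:R / n%:R) - primitive g (k.-1%:R / n%:R)).
  rewrite big_add1/= (telescope_sumr (fun k => primitive g (k%:R / n%:R)))//.
rewrite E mulr_sumr -sumrB.
apply: (le_trans (ler_norm_sum _ _ _)).
apply: (@le_trans _ _ (\sum_(K.+1 <= k < M.+1) (2 * e / n%:R))); last first.
  rewrite sumr_const_nat subSS -[leLHS]mulr_natr -[2 * e / _ * _]mulrA.
  rewrite ler_wpM2l ?mulr_ge0 ?(ltW e0)//.
  by rewrite ler_pdivrMl// [n%:R * t]mulrC (le_trans _ MS)// ler_nat leq_subr.
rewrite big_seq [leRHS]big_seq; apply: ler_sum => k.
rewrite mem_index_iota => /andP[Kk kM].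
have k0 : (0 < k)%N by rewrite (leq_ltn_trans _ Kk).
have Kk' : K.+1%:R <= k%:R :> R by rewrite ler_nat.
have kt : k%:R <= t * n%:R by rewrite (le_trans _ MS)// ler_nat.
have k1 : k.-1%:R = k%:R - 1 :> R by rewrite -subn1 natrB.
have kk : k%:R / n%:R - k.-1%:R / n%:R = n%:R^-1 :> R.
  by rewrite k1 -mulrBl opprB addrCA subrr addr0 mul1r.
have := @primitive_increment g (k.-1%:R / n%:R) (k%:R / n%:R) (g (k%:R / n%:R)) e.
rewrite kk => /(_ _ _ _ _); move=> H.
have {}H : `|primitive g (k%:R / n%:R) - primitive g (k.-1%:R / n%:R) -
   g (k%:R / n%:R) / n%:R| <= e / n%:R.
  apply: H.
  - by apply: ig; rewrite divr_ge0.
  - by rewrite divr_ge0.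
  - by rewrite ler_wpM2r ?invr_ge0// ler_nat leq_pred.
  move=> u /andP[ku uk].
  have h1 : delta <= k%:R / n%:R by rewrite ler_pdivlMr// (le_trans dK).
  have h2 : k%:R / n%:R <= t by rewrite ler_pdivrMr.
  have h3 : n%:R^-1 <= delta / 2.
    by rewrite ler_pdivlMr// mulrC ler_pdivrMr.
  apply: Hg.
  - by apply/andP; split; lra.
  - by apply/andP; split; lra.
  - by rewrite ler_norml; apply/andP; split; lra.
have := rn k; rewrite kt andbT (le_trans dK)// => /(_ isT) h.
have {}h : `|n%:R^-1 * r n k - g (k%:R / n%:R) / n%:R| <= e / n%:R.
  rewrite [_^-1 * _]mulrC -mulrBl normrM [ `|n%:R^-1|]ger0_norm ?invr_ge0//.
  by rewrite ler_wpM2r ?invr_ge0.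
rewrite (_ : 2 * e / n%:R = e / n%:R + e / n%:R); last by ring.
by rewrite (le_trans (ler_distD (g (k%:R / n%:R) / n%:R) _ _))// lerD// distrC.
Unshelve. all: by end_near. Qed.

(** The sum is cut at the index [Num.truncn (delta * n%:R)]. The head is small by [r_small], its
    integral by the bound [B] of [g]; the rest is [riemann_block], up to the incomplete last
    cell. *)
Lemma riemann_limit : 0 <= t ->
  n%:R^-1 * (\sum_(1 <= k < (Num.truncn (n%:R * t)).+1) r n k)
    @[n --> \oo] --> primitive g t.
Proof.
rewrite le_eqVlt => /predU1P[<-|t0].
  rewrite primitive0; apply: cvg_near_cst; near=> n.
  by rewrite mulr0 truncn0 big_nil mulr0.
have B0 : 0 <= B.
  by apply: (le_trans (normr_ge0 (g 0))); apply: gB; rewrite lexx ltW.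
apply/cvgrPdist_le => e e0.
have e1 : 0 < e / (8 * t) by rewrite divr_gt0// mulr_gt0.
have Bt : forall s s', 0 <= s -> s <= s' -> s' <= t ->
    `|primitive g s' - primitive g s| <= B * (s' - s).
  move=> s s' s0 ss' s't.
  have := @primitive_increment g s s' 0 B.
  rewrite mul0r subr0; apply => //.
    by apply: ig; exact: le_trans ss'.
  move=> u /andP[su us']; rewrite subr0; apply: gB.
  by rewrite (le_trans s0)// (le_trans us').
(* [delta * D] dominates the head of the sum and the head of the integral together. *)
pose D := `|C| + B + 1.
have D0 : 0 < D by rewrite ltr_wpDl// addr_ge0.
pose delta := Num.min (Num.min 1 t) (e / (4 * D)).
have delta0 : 0 < delta by rewrite !lt_min ltr01 t0 divr_gt0// mulr_gt0.
have delta1 : delta <= 1 by rewrite !ge_min lexx.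
have deltat : delta <= t by rewrite !ge_min lexx orbT.
have deltaD : delta * D <= e / 4.
  rewrite -ler_pdivlMr// -mulrA -invfM ge_min; apply/orP; right.
  by [].
near=> n; have n0 : 0 < n%:R :> R by near: n; exact: nbhs_infty_gtr.
pose K := Num.truncn (delta * n%:R); pose M := Num.truncn (n%:R * t).
have /andP[K1 K2] : K%:R <= delta * n%:R < K.+1%:R.
  by rewrite truncn_itv// mulr_ge0// ltW.
have /andP[M1 M2] : M%:R <= n%:R * t < M.+1%:R.
  by rewrite truncn_itv// mulr_ge0// ltW.
have KM : (K <= M)%N by apply: le_truncn; rewrite mulrC ler_wpM2l.
have h1 : `|n%:R^-1 * (\sum_(K.+1 <= k < M.+1) r n k)
      - (primitive g (M%:R / n%:R) - primitive g (K%:R / n%:R))| <= e / 4.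
  rewrite (_ : e / 4 = 2 * (e / (8 * t)) * t); last by field; rewrite gt_eqF.
  have dK2 := ltW K2; have M1' : M%:R <= t * n%:R by rewrite mulrC.
  by move: (K) (M) KM dK2 M1'; near: n; exact: riemann_block.
have h2 : `|\sum_(1 <= k < K.+1) r n k| <= C * delta * n%:R.
  by move: (K) K1; near: n; apply: r_small; rewrite delta0.
have h3 : `|n%:R^-1 * (\sum_(1 <= k < K.+1) r n k)| <= `|C| * delta.
  rewrite normrM ger0_norm ?invr_ge0// mulrC ler_pdivrMr// (le_trans h2)//.
  by rewrite -!mulrA ler_wpM2r ?ler_norm// mulr_ge0// ltW.
have Kd : K%:R / n%:R <= delta by rewrite ler_pdivrMr.
have h4 : `|primitive g (K%:R / n%:R)| <= B * delta.
  have := Bt 0 (K%:R / n%:R); rewrite primitive0 !subr0 => /(_ _ _ _) h.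
  rewrite (le_trans (h _ _ _))// ?divr_ge0// ?(le_trans Kd)//.
  by rewrite ler_wpM2l.
have Mt : M%:R / n%:R <= t by rewrite ler_pdivrMr// mulrC.
have h5 : `|primitive g t - primitive g (M%:R / n%:R)| <= e / 4.
  apply: (le_trans (Bt _ _ _ _ _)); rewrite ?divr_ge0//.
  apply: (@le_trans _ _ (B / n%:R)).
    rewrite ler_wpM2l// lerBlDr.
    have -> : n%:R^-1 + M%:R / n%:R = M.+1%:R / n%:R :> R.
      by rewrite -natr1 mulrDl mul1r addrC.
    by rewrite ler_pdivlMr// mulrC ltW.
  rewrite ler_pdivrMr// mulrC -ler_pdivrMr ?divr_gt0//.
  near: n; exact: nbhs_infty_ger.
rewrite (@big_cat_nat _ _ _ K.+1)//= mulrDr.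
move: h1 h3 h4 h5; set x1 := n%:R^-1 * \sum_(1 <= k < K.+1) r n k.
set x2 := n%:R^-1 * _.
rewrite !ler_norml => /andP[? ?] /andP[? ?] /andP[? ?] /andP[? ?].
have : delta * D = `|C| * delta + B * delta + delta by rewrite /D; ring.
move=> ?; apply/andP; split; lra.
Unshelve. all: by end_near. Qed.

End riemann_limit.
End riemann_sums.

(** * Weighted sums of arrays close to a regularly varying sequence *)

Section array_sums.
Context {R : realType}.

(** Condition (C1) with the maximum over [k] unfolded. *)
Definition row_close (f : nat -> R) (m : nat -> nat -> R) : Prop :=
  forall S e : R, 0 < e -> \forall n \near \oo, forall k : nat, (0 < k)%N ->
    k%:R <= S * n%:R -> `|m n k - f k| <= e * f n.

Lemma array_sum_le rho f m (S : R) : 0 <= rho -> ratio_regular rho f ->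
  row_close f m -> 0 < S ->
  exists2 C, 0 < C & \forall n \near \oo, forall K : nat, K%:R <= S * n%:R ->
    \sum_(1 <= k < K.+1) m n k <= C * (n%:R * f n).
Proof.
move=> rho0 rf mf S0; have [C C0 HC] := ratio_regular_sum_le rho0 rf.
have C10 : 0 <= C * (S * (S `^ rho + 1)).
  by rewrite !mulr_ge0 ?addr_ge0 ?powR_ge0 ?ltW.
exists (C * (S * (S `^ rho + 1)) + S); first by rewrite ltr_wpDl.
near=> n => K KS.
have n0 : (0 < n)%N by near: n; exists 1%N.
have fn0 : 0 < f n by apply rf.1.
have mfn : forall k : nat, (0 < k)%N -> k%:R <= S * n%:R ->
    `|m n k - f k| <= 1 * f n by near: n; exact: mf.
have h : \sum_(1 <= k < K.+1) f k <= C * (S * (S `^ rho + 1)) * (n%:R * f n).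
  by move: (K) KS; near: n; exact: HC.
apply: (@le_trans _ _ (\sum_(1 <= k < K.+1) (f k + f n))).
  rewrite big_seq [leRHS]big_seq; apply: ler_sum => k.
  rewrite mem_index_iota ltnS => /andP[k0 kK].
  have := mfn k k0; rewrite mul1r => /(_ _).
  have kS : k%:R <= S * n%:R by rewrite (le_trans _ KS)// ler_nat.
  by move=> /(_ kS); rewrite ler_norml => /andP[_]; lra.
rewrite big_split/= mulrDl lerD// sumr_const_nat subn1/= -[leLHS]mulr_natl mulrA.
by rewrite ler_wpM2r// ltW.
Unshelve. all: by end_near. Qed.

Lemma array_sum_sqr_le rho f m (S : R) : 0 <= rho -> ratio_regular rho f ->
  row_close f m -> 0 < S ->
  exists2 C, 0 < C & \forall n \near \oo, forall K : nat, K%:R <= S * n%:R ->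
    \sum_(1 <= k < K.+1) m n k ^+ 2 <= C * (n%:R * f n ^+ 2).
Proof.
move=> rho0 rf mf S0.
have rf2 := ratio_regular_sqr rho0 rf.
have rho20 : 0 <= rho * 2 by rewrite mulr_ge0.
have [C C0 HC] := ratio_regular_sum_le rho20 rf2.
have C10 : 0 <= C * (S * (S `^ (rho * 2) + 1)).
  by rewrite !mulr_ge0 ?addr_ge0 ?powR_ge0 ?ltW.
exists (2 * (C * (S * (S `^ (rho * 2) + 1))) + 2 * S).
  have : 0 < 2 * S by rewrite mulr_gt0.
  lra.
near=> n => K KS.
have n0 : (0 < n)%N by near: n; exists 1%N.
have fn0 : 0 < f n by apply rf.1.
have mfn : forall k : nat, (0 < k)%N -> k%:R <= S * n%:R ->
    `|m n k - f k| <= 1 * f n by near: n; exact: mf.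
have h : \sum_(1 <= k < K.+1) f k ^+ 2 <=
    C * (S * (S `^ (rho * 2) + 1)) * (n%:R * f n ^+ 2).
  by move: (K) KS; near: n; exact: HC.
(* (x + y)^2 <= 2 x^2 + 2 y^2, with [f k] for x and the deviation [m n k - f k], of modulus at most
   [f n], for y. *)
apply: (@le_trans _ _ (\sum_(1 <= k < K.+1) (2 * f k ^+ 2 + 2 * f n ^+ 2))).
  rewrite big_seq [leRHS]big_seq; apply: ler_sum => k.
  rewrite mem_index_iota ltnS => /andP[k0 kK].
  have kS : k%:R <= S * n%:R by rewrite (le_trans _ KS)// ler_nat.
  have := mfn k k0 kS; rewrite mul1r ler_norml => /andP[h1 h2].
  have h3 : (m n k - f k) ^+ 2 <= f n ^+ 2.
    by rewrite -subr_ge0 subr_sqr mulr_ge0//; lra.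
  have : 0 <= (m n k - f k - f k) ^+ 2 by exact: sqr_ge0.
  nra.
rewrite big_split/= -mulr_sumr.
have h4 : \sum_(1 <= k < K.+1) (2 * f n ^+ 2) <= 2 * S * (n%:R * f n ^+ 2).
  rewrite sumr_const_nat subn1/= -[leLHS]mulr_natl.
  have : K%:R * f n ^+ 2 <= S * n%:R * f n ^+ 2 by rewrite ler_wpM2r// sqr_ge0.
  lra.
move: h h4; set A := C * _; set Z := n%:R * _ => h h4; rewrite mulrDl; lra.
Unshelve. all: by end_near. Qed.

Section weighted_mean.
Variables (rho a : R) (f : nat -> R) (m q : nat -> nat -> R).
Hypotheses (rho0 : 0 <= rho) (rf : ratio_regular rho f) (mf : row_close f m).

(** Its primitive is e^(-at) mu_rho(t), the limit profile of the weighted process q_k X_k. *)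
Definition mean_density (u : R) : R := u `^ rho * expR (- (a * u)).

Hypothesis qa : forall S e : R, 0 < e -> \forall n \near \oo, forall k : nat,
  k%:R <= S * n%:R -> `|q n k - expR (- (a * (k%:R / n%:R)))| <= e.

Lemma powR_le_bound (u t : R) : 0 <= u <= t -> u `^ rho <= t `^ rho.
Proof.
by move=> /andP[u0 ut]; rewrite ge0_ler_powR ?nnegrE// (le_trans u0).
Qed.

Lemma expR_le_bound (u t : R) : 0 <= u <= t -> expR (- (a * u)) <= expR (`|a| * t).
Proof.
move=> /andP[u0 ut]; rewrite ler_expR -mulNr (@le_trans _ _ (`|a| * u))//.
  by rewrite ler_wpM2r// -normrN ler_norm.
by rewrite ler_wpM2l.
Qed.

Lemma mean_density_ge0 (u : R) : 0 <= mean_density u.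
Proof. by rewrite mulr_ge0 ?powR_ge0 ?expR_ge0. Qed.

Lemma mean_density_le (u t : R) : 0 <= u <= t ->
  `|mean_density u| <= t `^ rho * expR (`|a| * t).
Proof.
move=> ut; rewrite ger0_norm ?mean_density_ge0//.
by rewrite ler_pM ?powR_ge0 ?expR_ge0 ?powR_le_bound ?expR_le_bound.
Qed.

Lemma integrable_mean_density (t : R) :
  lebesgue_measure.-integrable `[0, t] (EFin \o mean_density).
Proof.
apply: measurable_bounded_integrable => //.
- by rewrite /= lebesgue_measure_itv/=; case: ifP => _; rewrite -?EFinB ltry.
- apply: measurable_funTS; apply: measurable_funM.
    exact: measurable_powR.
  apply: (measurableT_comp (@measurable_expR R)).
  by under eq_fun do rewrite -mulNr; exact: mulrl_measurable.
- exists (t `^ rho * expR (`|a| * t)); split; first exact: num_real.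
  move=> M /ltW hM u /=; rewrite in_itv/= => ut.
  by apply: (le_trans _ hM); exact: mean_density_le.
Qed.

Lemma mean_density_exp (u : R) : 0 < u -> mean_density u = expR (rho * ln u - a * u).
Proof.
move=> u0; rewrite expRD /mean_density; congr (_ * _).
by rewrite -ln_powR lnK// posrE powR_gt0.
Qed.

(** The density is the exponential of rho ln u - a u, which is Lipschitz on [[delta, t]] with
    constant rho/delta + |a|. The restriction to [u >= delta] is due to the logarithm; the [+ 1] in
    [L] keeps it positive. *)
Lemma mean_density_unif (t delta e : R) : 0 < delta -> 0 < e ->
  exists2 eta, 0 < eta & forall u v, delta <= u <= t -> delta <= v <= t ->
    `|u - v| <= eta -> `|mean_density u - mean_density v| <= e.
Proof.
move=> delta0 e0.
pose B := t `^ rho * expR (`|a| * t) + 1.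
have B0 : 0 < B by rewrite ltr_wpDl// mulr_ge0 ?powR_ge0 ?expR_ge0.
pose L := rho / delta + `|a| + 1.
have L0 : 0 < L by rewrite ltr_wpDl// addr_ge0// divr_ge0// ltW.
have eB : 0 < e / B by rewrite divr_gt0.
have le0 : 0 < ln (1 + e / B) by rewrite ln_gt0// ltrDl.
exists (ln (1 + e / B) / L); first exact: divr_gt0.
move=> u v /andP[du ut] /andP[dv vt] uv.
have u0 : 0 < u by exact: lt_le_trans du.
have v0 : 0 < v by exact: lt_le_trans dv.
have lnle x y : delta <= x -> delta <= y -> ln x - ln y <= `|x - y| / delta.
  move=> dx dy; have x0 : 0 < x by exact: lt_le_trans dx.
  have y0 : 0 < y by exact: lt_le_trans dy.
  rewrite -ln_div ?posrE//.
  have := @le_ln1Dx R (x / y - 1); rewrite [1 + _]addrC subrK => h.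
  apply: (le_trans (h _)); first by rewrite ltrBrDl subrr divr_gt0.
  rewrite -(@divff _ y) ?gt_eqF// -mulrBl.
  apply: (@le_trans _ _ (`|x - y| / y)); first by rewrite ler_pM2r ?invr_gt0// ler_norm.
  by rewrite ler_wpM2l// lef_pV2.
have hln : `|ln u - ln v| <= `|u - v| / delta.
  by rewrite ler_norml lerNl opprB lnle// distrC lnle.
pose th := (rho * ln u - a * u) - (rho * ln v - a * v).
have hth : `|th| <= ln (1 + e / B).
  have -> : th = rho * (ln u - ln v) - a * (u - v) by rewrite /th; ring.
  apply: (le_trans (ler_normB _ _)); rewrite !normrM (ger0_norm rho0).
  apply: (@le_trans _ _ (L * `|u - v|)); last by rewrite mulrC -ler_pdivlMr.
  have := ler_wpM2l rho0 hln.
  rewrite /L !mulrDl mul1r (_ : rho / delta * _ = rho * (`|u - v| / delta)); last by ring.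
  by have := normr_ge0 (u - v); lra.
have -> : mean_density u = mean_density v * expR th.
  by rewrite !mean_density_exp// -expRD; congr expR; rewrite /th; ring.
rewrite -{2}[mean_density v]mulr1 -mulrBr normrM.
apply: (@le_trans _ _ (B * (e / B))); last by rewrite mulrC divfK ?gt_eqF.
apply: ler_pM => //; last exact: abs_expRB1 (ltW eB) hth.
by rewrite (le_trans (mean_density_le (t := t) _)) ?lerDl// (ltW v0).
Qed.

Lemma mean_array_near (t delta e : R) : 0 < delta -> 0 < e ->
  \forall n \near \oo, forall k : nat, delta * n%:R <= k%:R <= t * n%:R ->
    `|q n k * (m n k / f n) - mean_density (k%:R / n%:R)| <= e.
Proof.
move=> delta0 e0.
(* The expansion of [y * z - s * x] below has total error at most e1 (t^rho + 2 + 2 e^(|a|t)), which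
   is below 2 B e1. *)
pose B := expR (`|a| * t) + t `^ rho + 3.
have B0 : 0 < B by rewrite ltr_wpDl// addr_ge0 ?powR_ge0 ?expR_ge0.
pose e1 := Num.min 1 (e / (2 * B)).
have e10 : 0 < e1 by rewrite lt_min ltr01 divr_gt0// mulr_gt0.
have e11 : e1 <= 1 by rewrite ge_min lexx.
have e1B : e1 * (2 * B) <= e by rewrite -ler_pdivlMr ?mulr_gt0// ge_min lexx orbT.
near=> n => k /[dup] dkt /andP[dk kt].
have n0 : (0 < n)%N by near: n; exists 1%N.
have n0R : 0 < n%:R :> R by rewrite ltr0n.
have fn0 : 0 < f n by apply rf.1.
have k0R : 0 < k%:R :> R by rewrite (lt_le_trans _ dk)// mulr_gt0.
have k0 : (0 < k)%N by rewrite -(ltr0n R).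
have hq : `|q n k - expR (- (a * (k%:R / n%:R)))| <= e1.
  by move: (k) kt; near: n; exact: qa.
have hm : `|m n k - f k| <= e1 * f n.
  by move: (k) k0 kt; near: n; exact: mf.
have hf : `|f k / f n - (k%:R / n%:R) `^ rho| <= e1.
  by move: (k) dkt; near: n; exact: rf.2.
have kn : 0 <= (k%:R / n%:R : R) <= t by rewrite divr_ge0//= ler_pdivrMr.
have s0 := powR_ge0 (k%:R / n%:R) rho; have st := powR_le_bound kn.
have x0 := expR_ge0 (- (a * (k%:R / n%:R))); have xt := expR_le_bound kn.
rewrite /mean_density; move: hq hf s0 st x0 xt.
set s := (_ / _) `^ _; set x := expR (- _); set y := q n k => hq hf s0 st x0 xt.
have hm' : `|m n k / f n - f k / f n| <= e1.
  by rewrite -mulrBl normrM normfV (gtr0_norm fn0) ler_pdivrMr.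
move: hm' hf; set z := m n k / f n; set w := f k / f n => hm' hf.
have hz : `|z - s| <= 2 * e1.
  by rewrite (le_trans (ler_distD w _ _))// mulr2n mulrDl mul1r lerD.
have -> : y * z - s * x = (y - x) * s + (y - x) * (z - s) + x * (z - s) by ring.
apply: (le_trans _ e1B).
apply: (@le_trans _ _ (e1 * t `^ rho + e1 * 2 + expR (`|a| * t) * (2 * e1))); last first.
  have h1 := powR_ge0 t rho; have h2 := expR_ge0 (`|a| * t).
  by rewrite /B; nra.
apply: (le_trans (ler_normD _ _)); apply: lerD.
  apply: (le_trans (ler_normD _ _)); rewrite !normrM; apply: lerD.
    by rewrite ler_pM// ger0_norm.
  by rewrite ler_pM// (le_trans hz)//; lra.
by rewrite normrM ler_pM// ger0_norm.
Unshelve. all: by end_near. Qed.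

(** The constant must not depend on [delta]: the weights are bounded by [Q], and
    [ratio_regular_sum_le] with range [delta] supplies the factor delta (delta^rho + 1) <= 2
    delta. *)
Lemma mean_array_small : exists C : R, forall delta : R, 0 < delta <= 1 ->
  \forall n \near \oo, forall K : nat, K%:R <= delta * n%:R ->
    `|\sum_(1 <= k < K.+1) q n k * (m n k / f n)| <= C * delta * n%:R.
Proof.
have [C C0 HC] := ratio_regular_sum_le rho0 rf.
pose Q := expR `|a| + 1.
exists (Q * (2 * C + 1)) => delta /andP[delta0 delta1].
near=> n => K Kd.
have n0 : (0 < n)%N by near: n; exists 1%N.
have n0R : 0 < n%:R :> R by rewrite ltr0n.
have fn0 : 0 < f n by apply rf.1.
have hq : forall k : nat, k%:R <= 1 * n%:R :> R ->
    `|q n k - expR (- (a * (k%:R / n%:R)))| <= 1 by near: n; exact: (qa 1 ltr01).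
have hm : forall k : nat, (0 < k)%N -> k%:R <= 1 * n%:R :> R ->
    `|m n k - f k| <= 1 * f n by near: n; exact: (mf 1 ltr01).
have hs : \sum_(1 <= k < K.+1) f k <= C * (delta * (delta `^ rho + 1)) * (n%:R * f n).
  by move: (K) Kd; near: n; exact: HC.
apply: (le_trans (ler_norm_sum _ _ _)).
apply: (@le_trans _ _ (\sum_(1 <= k < K.+1) (Q / f n * (f k + f n)))).
  rewrite big_seq [leRHS]big_seq; apply: ler_sum => k.
  rewrite mem_index_iota ltnS => /andP[k0 kK].
  have k1 : k%:R <= 1 * n%:R :> R.
    rewrite (@le_trans _ _ K%:R) ?ler_nat// (le_trans Kd)// ler_wpM2r//.
  have kn : 0 <= (k%:R / n%:R : R) <= 1 by rewrite divr_ge0//= ler_pdivrMr.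
  have fk0 : 0 < f k by exact: rf.1.
  rewrite !normrM normfV (gtr0_norm fn0) [Q / _ * _]mulrAC -[Q * _ / _]mulrA.
  apply: ler_pM; rewrite ?divr_ge0 ?(ltW fn0)//.
    have := hq k k1; have := expR_le_bound kn; rewrite mulr1.
    have := expR_ge0 (- (a * (k%:R / n%:R))) => h1 h2.
    by rewrite /Q !ler_norml => /andP[h3 h4]; apply/andP; split; lra.
  rewrite ler_pM2r ?invr_gt0//.
  by have := hm k k0 k1; rewrite mul1r !ler_norml => /andP[h3 h4]; apply/andP; split; lra.
rewrite -mulr_sumr big_split/= sumr_const_nat subn1/= -[X in _ + X]mulr_natl.
have Q0 : 0 < Q by rewrite ltr_wpDl ?expR_ge0.
rewrite -!mulrA ler_pM2l// ler_pdivrMl//.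
have dr : delta `^ rho <= 1.
  by apply: (le_trans (@powR_le_bound delta 1 _)); rewrite ?powR1// ltW.
have h1 : C * (delta * (delta `^ rho + 1)) * (n%:R * f n) <=
   C * (delta * 2) * (n%:R * f n).
  apply: ler_wpM2r; first by rewrite mulr_ge0// ltW.
  by rewrite ler_pM2l// ler_pM2l//; lra.
have h2 : K%:R * f n <= delta * n%:R * f n by rewrite ler_wpM2r// ltW.
apply: (le_trans (lerD (le_trans hs h1) h2)).
by rewrite le_eqVlt; apply/orP; left; apply/eqP; ring.
Unshelve. all: by end_near. Qed.

Lemma weighted_mean_limit (t : R) : 0 <= t ->
  n%:R^-1 * (\sum_(1 <= k < (Num.truncn (n%:R * t)).+1) q n k * (m n k / f n))
    @[n --> \oo] --> primitive mean_density t.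
Proof.
move=> t0; have [C HC] := mean_array_small.
apply: (@riemann_limit _ mean_density (fun n k => q n k * (m n k / f n)) t _ C) => //.
- by move=> s _; exact: integrable_mean_density.
- by move=> u ut; exact: mean_density_le ut.
- exact: mean_density_unif.
- exact: mean_array_near.
Qed.

End weighted_mean.
End array_sums.

(** * Offspring and immigration *)

Section countable_valued.
Context {d : measure_display} {T : measurableType d}.

(** Asking only for level sets puts no sigma-algebra on [S], so the notion applies to sequences of
    pairs, and with [T] carrying a smaller sigma-algebra as well. *)
Definition measurable_levels {S : Type} (X : T -> S) : Prop :=
  forall s, measurable [set w | X w = s].

Lemma measurable_levels_preimage {S : countType} (X : T -> S) (B : set S) :
  measurable_levels X -> measurable (X @^-1` B).
Proof.
move=> mX; rewrite (_ : _ @^-1` _ = \bigcup_(s in B) [set w | X w = s]).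
  rewrite bigcup_mkcond; apply: countable_bigcupT_measurable => // s.
  by case: ifP => // _; exact: mX.
by apply/seteqP; split=> w /=; [exists (X w)|move=> [s Bs ->]].
Qed.

Lemma measurable_levels_fun {d'} {U : measurableType d'} {S : countType}
    (X : T -> S) (f : T -> U) : measurable_levels X ->
  (forall w w', X w = X w' -> f w = f w') -> measurable_fun setT f.
Proof.
move=> mX Xf _ B mB; rewrite setTI.
rewrite (_ : _ @^-1` _ = X @^-1` [set s | exists w, X w = s /\ B (f w)]).
  exact: measurable_levels_preimage.
apply/seteqP; split=> w /=; first by exists w.
by move=> [w' [/esym/Xf -> ]].
Qed.

(** Handles sums with a random number of terms: fix the number, then take the union over its
    values. *)
Lemma measurable_levels_bind {S S' : countType} (X : T -> S) (Y : S -> T -> S') :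
  measurable_levels X -> (forall s, measurable_levels (Y s)) ->
  measurable_levels (fun w => Y (X w) w).
Proof.
move=> mX mY y; rewrite (_ : [set _ | _] =
    \bigcup_(s in setT) ([set w | X w = s] `&` [set w | Y s w = y])).
  apply: countable_bigcupT_measurable => // s.
  by apply: measurableI; [exact: mX|exact: mY].
apply/seteqP; split=> w /=; first by move=> <-; exists (X w).
by move=> [s _ [/= ->]].
Qed.

Lemma measurable_levels_map {S S' : countType} (X : T -> S) (h : S -> S') :
  measurable_levels X -> measurable_levels (h \o X).
Proof.
by move=> mX s; exact: (measurable_levels_preimage [set t | h t = s] mX).
Qed.

Lemma measurable_levels_add (X Y : T -> nat) :
  measurable_levels X -> measurable_levels Y ->
  measurable_levels (fun w => X w + Y w)%N.
Proof.
move=> mX mY; apply: (measurable_levels_bind (Y := fun x w => (x + Y w)%N) mX) => x.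
exact: (measurable_levels_map (addn x) mY).
Qed.

Lemma measurable_levels_pair {S S' : Type} (X : T -> S) (Y : T -> S') :
  measurable_levels X -> measurable_levels Y ->
  measurable_levels (fun w => (X w, Y w)).
Proof.
move=> mX mY [x y].
rewrite (_ : [set _ | _] = [set w | X w = x] `&` [set w | Y w = y]).
  by apply: measurableI; [exact: mX|exact: mY].
by apply/seteqP; split=> w /= [-> ->].
Qed.

Lemma measurable_levels_sum (X : nat -> T -> nat) (n : nat) :
  (forall j, (0 < j)%N -> measurable_levels (X j)) ->
  measurable_levels (fun w => \sum_(1 <= j < n.+1) X j w)%N.
Proof.
move=> mX; elim: n => [|n IH].
  move=> s; under eq_set do rewrite big_nil.
  have [<-|s0] := eqVneq 0%N s.
    by rewrite (_ : [set _ | _] = setT)//; apply/seteqP; split.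
  by rewrite (_ : [set _ | _] = set0)//; apply/seteqP; split => // w /eqP; rewrite (negbTE s0).
under eq_fun do rewrite big_nat_recr//=.
by apply: measurable_levels_add => //; exact: mX.
Qed.

(** Only generations up to [K] are asked to be measurable, so that the lemma also applies over the
    sigma-algebra of the past. *)
Lemma measurable_levels_branching (xi : nat -> nat -> T -> nat)
    (eps : nat -> T -> nat) (K : nat) :
  (forall k j, (0 < k <= K)%N -> (0 < j)%N -> measurable_levels (xi k j)) ->
  (forall k, (0 < k)%N -> measurable_levels (eps k)) ->
  forall k, (k <= K)%N -> measurable_levels (branching xi eps k).
Proof.
move=> mxi meps; elim=> [_ s|k IH kK] /=.
  have [<-|s0] := eqVneq 0%N s.
    by rewrite (_ : [set _ | _] = setT)//; apply/seteqP; split.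
  by rewrite (_ : [set _ | _] = set0)//; apply/seteqP; split => // w /eqP; rewrite (negbTE s0).
apply: measurable_levels_add; last exact: meps.
apply: (measurable_levels_bind (Y := fun x w => (\sum_(1 <= j < x.+1) xi k.+1 j w)%N)).
  by apply: IH; exact: ltnW.
by move=> x; apply: measurable_levels_sum => j j0; exact: mxi.
Qed.

End countable_valued.

(** * Integration over the level sets of an integer-valued map *)

Section countable_partition.
Context {d : measure_display} {T : measurableType d} {R : realType}.
Variable mu : {measure set T -> \bar R}.
Local Open Scope ereal_scope.

Lemma ge0_integral_levels (U : T -> nat) (D : set T) (f : T -> \bar R) :
  measurable_levels U -> measurable D -> measurable_fun setT f ->
  (forall w, 0 <= f w) ->
  \int[mu]_(w in D) f w =
  \sum_(i <oo) \int[mu]_(w in D `&` [set w | U w = i]) f w.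
Proof.
move=> mU mD mf f0.
have DE : D = \bigcup_i (D `&` [set w | U w = i]).
  by apply/seteqP; split => w; [exists (U w)|move=> [i _ []]].
rewrite [in LHS]DE ge0_integral_bigcup//.
- by move=> i; apply: measurableI => //; exact: mU.
- exact: measurable_funTS.
- by apply/trivIsetP => i j _ _ ij; apply/seteqP; split => // w [[_ /= ->] [_ /=]] /eqP; rewrite (negbTE ij).
Qed.

Lemma ge0_integral_level_eq (U : T -> nat) (D : set T) (f g : T -> \bar R) :
  measurable_levels U -> measurable D ->
  measurable_fun setT f -> measurable_fun setT g ->
  (forall w, 0 <= f w) -> (forall w, 0 <= g w) ->
  (forall i, \int[mu]_(w in D `&` [set w | U w = i]) f w =
             \int[mu]_(w in D `&` [set w | U w = i]) g w) ->
  \int[mu]_(w in D) f w = \int[mu]_(w in D) g w.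
Proof.
move=> mU mD mf mg f0 g0 fg.
by rewrite !(ge0_integral_levels mU mD)//; apply: eq_eseriesr => i _; exact: fg.
Qed.

Lemma ge0_integral_comp_levels (U : T -> nat) (D : set T) (h : nat -> \bar R) :
  measurable_levels U -> measurable D -> (forall i, 0 <= h i) ->
  \int[mu]_(w in D) h (U w) =
  \sum_(i <oo) h i * mu (D `&` [set w | U w = i]).
Proof.
move=> mU mD h0; rewrite (ge0_integral_levels mU mD)//; last first.
  by apply: (measurable_levels_fun mU) => w w' ->.
apply: eq_eseriesr => i _.
rewrite -integral_cst; last by apply: measurableI => //; exact: mU.
by apply: eq_integral => w; rewrite inE => -[_ /= ->].
Qed.

(** Meant for [c] the measure of [D]: [U] is independent of [D] and distributed as [V], both
    expressed on level sets only. *)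
Lemma ge0_integral_indep (U V : T -> nat) (D : set T) (h : nat -> \bar R) (c : R) :
  measurable_levels U -> measurable_levels V -> measurable D ->
  (forall i, 0 <= h i) -> (0 <= c)%R ->
  (forall i, mu (D `&` [set w | U w = i]) = c%:E * mu [set w | V w = i]) ->
  \int[mu]_(w in D) h (U w) = c%:E * \int[mu]_w h (V w).
Proof.
move=> mU mV mD h0 c0 H; rewrite !ge0_integral_comp_levels//.
rewrite -nneseriesZl//; last by move=> i _; rewrite mule_ge0.
by apply: eq_eseriesr => i _; rewrite H setTI muleCA.
Qed.

(** One-sided variant for mixing, where [c] is the measure of [D] times a factor 1 + psi. *)
Lemma ge0_integral_weak_indep (U : T -> nat) (D : set T) (h : nat -> \bar R) (c : R) :
  measurable_levels U -> measurable D ->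
  (forall i, 0 <= h i) -> (0 <= c)%R ->
  (forall i, mu (D `&` [set w | U w = i]) <= c%:E * mu [set w | U w = i]) ->
  \int[mu]_(w in D) h (U w) <= c%:E * \int[mu]_w h (U w).
Proof.
move=> mU mD h0 c0 H; rewrite !ge0_integral_comp_levels//.
rewrite -nneseriesZl//; last by move=> i _; rewrite mule_ge0.
apply: lee_nneseries; first by move=> i _ _; rewrite mule_ge0.
by move=> i _; rewrite setTI muleCA lee_wpmul2l.
Qed.

End countable_partition.

Lemma sigma_generated_preimage {d d' : measure_display} {T : measurableType d}
    {S : measurableType d'} {I : Type} (D : set I) (X : I -> T -> S) i (B : set S) :
  D i -> measurable B -> sigma_generated D X (X i @^-1` B).
Proof.
move=> Di mB; apply: sub_sigma_algebra; exists i => //.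
by exists B => //; rewrite setTI.
Qed.

Lemma sigma_generated_bigcap {d d' : measure_display} {T : measurableType d}
    {S : measurableType d'} {I : choiceType} (D : set I) (X : I -> T -> S)
    (J : {fset I}) (B : I -> set S) :
  [set` J] `<=` D -> (forall i, measurable (B i)) ->
  sigma_generated D X (\bigcap_(i in [set` J]) X i @^-1` B i).
Proof.
move=> JD mB.
apply: (@fin_bigcap_measurable _ (g_sigma_algebraType
   (\bigcup_(i in D) preimage_set_system setT (X i) measurable))) => //.
by move=> i Ji; apply: sigma_generated_preimage => //; exact: JD.
Qed.

Lemma sigma_generated_setI {d d' : measure_display} {T : measurableType d}
    {S : measurableType d'} {I : Type} (D : set I) (X : I -> T -> S) A B :
  sigma_generated D X A -> sigma_generated D X B -> sigma_generated D X (A `&` B).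
Proof.
exact: (@measurableI _ (g_sigma_algebraType
   (\bigcup_(i in D) preimage_set_system setT (X i) measurable))).
Qed.

Lemma sigma_generated_measurable {d d' : measure_display} {T : measurableType d}
    {S : measurableType d'} {I : Type} (D : set I) (X : I -> T -> S) A :
  (forall i, measurable_fun setT (X i)) -> sigma_generated D X A -> measurable A.
Proof.
move=> mX; apply: smallest_sub; first exact: sigma_algebra_measurable.
by move=> _ [i Di [B mB <-]]; exact: mX.
Qed.

(** * The past of a generation and its independence of the next one *)

Section past.
Context {d : measure_display} {T : measurableType d} {R : realType}.
Variable P : probability T R.
Variables (xi : nat -> nat -> T -> nat) (eps : nat -> T -> nat).
Let D := [set p : nat * nat | (0 < p.1)%N /\ (0 < p.2)%N].
Let X := fun p : nat * nat => xi p.1 p.2.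
Let sxi := sigma_generated D X.
Let seps := sigma_generated [set k : nat | (0 < k)%N] eps.
Hypothesis mxi : forall k j, measurable_fun setT (xi k j).
Hypothesis meps : forall k, measurable_fun setT (eps k).
Hypothesis xi_indep : mutually_independent P D X.
Hypothesis xi_eps_indep : independent_sigma P sxi seps.

Let cyl (J : {fset nat * nat}) (B : nat * nat -> set nat) :=
  \bigcap_(p in [set` J]) X p @^-1` B p.

(* The whole immigration sequence belongs to every past. *)
Definition past_generator (K : nat) : set (set T) := [set A | exists J B E,
  [/\ [set` J] `<=` [set p | (0 < p.1 <= K)%N && (0 < p.2)%N], seps E &
      A = cyl J B `&` E]].

(** The sigma-algebra is made a measurable type so that the lemmas on level sets hold over it
    verbatim. *)
Definition past (K : nat) := g_sigma_algebraType (past_generator K).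

Lemma past_generator_sub K A : past_generator K A -> measurable A.
Proof.
move=> [J [B [E [JK sE ->]]]]; apply: measurableI.
  apply: (@sigma_generated_measurable _ _ _ _ _ D X); first by move=> i; exact: mxi.
  apply: sigma_generated_bigcap => // p /JK /= /andP[/andP[p0 _] p1].
  by split.
exact: (@sigma_generated_measurable _ _ _ _ _ [set k : nat | (0 < k)%N] eps).
Qed.

Lemma past_sub K A : <<s past_generator K >> A -> measurable A.
Proof.
by apply: smallest_sub; [exact: sigma_algebra_measurable|exact: past_generator_sub].
Qed.

Lemma past_generator_setI K : setI_closed (past_generator K).
Proof.
move=> _ _ [J [B [E [JK sE ->]]]] [J' [B' [E' [JK' sE' ->]]]].
exists (J `|` J')%fset, (fun p => (if p \in J then B p else setT) `&`
  (if p \in J' then B' p else setT)), (E `&` E'); split.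
- by move=> p /=; rewrite in_fsetU => /orP[/JK|/JK'].
- exact: sigma_generated_setI.
apply/seteqP; split => w /=.
  move=> [[JB Ew] [JB' E'w]]; split => // p /= _; split.
    by case: ifP => // pJ; exact: JB.
  by case: ifP => // pJ; exact: JB'.
move=> [JJ [Ew E'w]]; split; split => // p /= pJ.
  have := JJ p; rewrite /= in_fsetU pJ => /(_ isT)[].
  by [].
have := JJ p; rewrite /= in_fsetU pJ orbT => /(_ isT)[_].
by [].
Qed.

(** Both sides are finite measures in [A]: the restriction of [P] to the cylinder and a multiple of
    [P]. They agree on the pi-system [past_generator K], hence on the sigma-algebra it generates. *)
Lemma past_indep K (A : set T) (J' : {fset nat * nat}) (B' : nat * nat -> set nat) :
  <<s past_generator K >> A ->
  [set` J'] `<=` [set p | (p.1 == K.+1)%N && (0 < p.2)%N] ->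
  P (A `&` cyl J' B') = (P A * P (cyl J' B'))%E.
Proof.
move=> sA J'K.
have J'D : [set` J'] `<=` D.
  by move=> p /J'K /= /andP[/eqP p1 p2]; split => //; rewrite p1.
have sC : sxi (cyl J' B') by exact: sigma_generated_bigcap.
have mC : measurable (cyl J' B').
  by apply: sigma_generated_measurable sC => p; exact: mxi.
have PC0 : 0 <= fine (P (cyl J' B')) by exact: fine_ge0.
rewrite [RHS]muleC -[X in (X * _)%E]fineK ?fin_num_measure//.
pose c := NngNum PC0.
have cE : (c%:num%:E = P (cyl J' B'))%E by rewrite -[RHS]fineK ?fin_num_measure.
rewrite -[LHS]/(mrestr P mC A) -[RHS]/(mscale c P A).
apply: (@g_sigma_algebra_measure_unique _ _ _ (past_generator K) _ (fun=> setT)) => //.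
- by move=> B; exact: past_generator_sub.
- move=> _; exists fset0, (fun=> setT), setT; split.
  + by move=> p /=; rewrite in_fset0.
  + exact: (@measurableT _ (g_sigma_algebraType
     (\bigcup_(i in [set k : nat | (0 < k)%N]) preimage_set_system setT (eps i) measurable))).
  + by apply/seteqP; split=> // w _; split.
- by apply/seteqP; split => // w _; exists 0%N.
- exact: past_generator_setI.
- move=> {sA}_ [J [B [E [JK sE ->]]]].
  suff : P (cyl J B `&` E `&` cyl J' B') = (c%:num%:E * P (cyl J B `&` E))%E by [].
  rewrite cE.
  have JD : [set` J] `<=` D.
    by move=> p /JK /= /andP[/andP[p1 _] p2]; split.
  have sB : sxi (cyl J B) by exact: sigma_generated_bigcap.
  (* Independence of offspring and immigration splits off [E] on both sides; what remains is a
     product formula for two cylinders over disjoint index sets. *)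
  rewrite setIAC.
  rewrite xi_eps_indep//; last exact: sigma_generated_setI.
  rewrite [P (cyl J B `&` E)]xi_eps_indep// muleA; congr (_ * _)%E.
  have JJ' p : p \in J -> p \in J' -> False.
    move=> /JK/= /andP[/andP[_ pK] _] /J'K /= /andP[/eqP pK1 _].
    by move: pK; rewrite pK1 ltnn.
  pose B2 p := if p \in J then B p else B' p.
  have -> : cyl J B `&` cyl J' B' = cyl (J `|` J')%fset B2.
    apply/seteqP; split => w /=.
      move=> [wJ wJ'] p /=; rewrite in_fsetU /B2; case: ifP => pJ /=.
        by move=> _; exact: wJ.
      by move=> pJ'; exact: wJ'.
    move=> wJ; split => p /= pJ.
      by have := wJ p; rewrite /= in_fsetU pJ /B2 pJ => /(_ isT).
    have := wJ p; rewrite /= in_fsetU pJ orbT /B2 => /(_ isT).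
    by case: ifP => // pJ'; have := JJ' _ pJ' pJ.
  rewrite /cyl !xi_indep//; last first.
    by move=> p /=; rewrite in_fsetU => /orP[/JD|/J'D].
  rewrite (perm_big (enum_fset J ++ enum_fset J'))/=; last first.
    apply: uniq_perm; rewrite ?cat_uniq ?fset_uniq ?andbT//=.
      by apply/hasPn => p pJ'; apply/negP => pJ; exact: JJ' pJ pJ'.
    by move=> p; rewrite mem_cat in_fsetU.
  rewrite big_cat/= muleC; congr (_ * _)%E.
    rewrite big_seq [RHS]big_seq; apply: eq_bigr => p pJ'.
    by rewrite /B2; case: ifP => // pJ; have := JJ' _ pJ pJ'.
  rewrite big_seq [RHS]big_seq; apply: eq_bigr => p pJ.
  by rewrite /B2; case: ifP => // /negP.
- move=> _; apply: (@le_lt_trans _ _ (P setT)); last by rewrite probability_setT ltry.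
  by apply: le_measure; rewrite ?inE//; exact: measurableI.
Qed.

End past.

Section second_moment.
Context {d : measure_display} {T : measurableType d} {R : realType}.
Variable P : probability T R.

Lemma measurable_fun_levels (X : T -> nat) :
  measurable_fun setT X -> measurable_levels X.
Proof. by move=> mX s; have := mX measurableT [set s] I; rewrite setTI. Qed.

Lemma measurable_levels_EFin (X : T -> nat) (h : nat -> \bar R) :
  measurable_levels X -> measurable_fun setT (fun w => h (X w)).
Proof. by move=> mX; apply: (measurable_levels_fun mX) => w w' ->. Qed.

Lemma integral_mean (Z : T -> nat) : mean P Z \is a fin_num ->
  (\int[P]_w (Z w)%:R%:E = (fine (mean P Z))%:E)%E.
Proof. by move=> mZ; rewrite fineK// /mean unlock. Qed.

(* The cross term of the variance is moved to the other side of the equation, so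
   that only nonnegative functions are integrated. *)
Lemma integral_sqr (Z : T -> nat) : measurable_levels Z ->
  mean P Z \is a fin_num -> var P Z \is a fin_num ->
  (\int[P]_w ((Z w)%:R ^+ 2)%:E = (fine (var P Z) + fine (mean P Z) ^+ 2)%:E)%E.
Proof.
move=> mZ mean_fin var_fin; set m := fine (mean P Z).
have m0 : 0 <= m.
  by apply: fine_ge0; rewrite /mean expectation_ge0// => w.
have varE : (\int[P]_w (((Z w)%:R - m) ^+ 2)%:E = (fine (var P Z))%:E)%E.
  rewrite fineK// /var /variance !unlock; apply: eq_integral => w _.
  by rewrite expr2 /m /mean unlock.
have mfun (h : nat -> R) : measurable_fun setT (fun w => (h (Z w))%:E).
  exact: (measurable_levels_EFin (fun n => (h n)%:E) mZ).
have E : (\int[P]_w ((Z w)%:R ^+ 2)%:E + \int[P]_w (m ^+ 2)%:E =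
    \int[P]_w (((Z w)%:R - m) ^+ 2)%:E + \int[P]_w (2 * m * (Z w)%:R)%:E)%E.
  rewrite -!ge0_integralD//=.
  all: try by move=> w _; rewrite lee_fin ?sqr_ge0 ?mulr_ge0.
  all: try exact: (mfun (fun n => 2 * m * n%:R)).
  all: try exact: (mfun (fun n => (n%:R - m) ^+ 2)).
  all: try exact: (mfun (fun n => n%:R ^+ 2)).
  by apply: eq_integral => w _; rewrite -!EFinD; congr EFin; ring.
have PT : (\int[P]_w (m ^+ 2)%:E = (m ^+ 2)%:E)%E.
  by rewrite integral_cst// -[RHS]mule1; congr (_ * _)%E; exact: probability_setT.
have mE : (\int[P]_w (2 * m * (Z w)%:R)%:E = (2 * m ^+ 2)%:E)%E.
  under eq_integral do rewrite EFinM.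
  rewrite ge0_integralZl_EFin ?mulr_ge0//.
  by rewrite integral_mean// -EFinM -/m; congr EFin; ring.
move: E; rewrite PT mE varE -EFinD => E.
by rewrite -[LHS](@addeK _ (m ^+ 2)%:E)// E -EFinB; congr EFin; ring.
Qed.

End second_moment.

(** * Moments of one generation on an event of the past *)

Section offspring.
Context {d : measure_display} {T : measurableType d} {R : realType}.
Variable P : probability T R.
Variables (xi : nat -> nat -> T -> nat) (eps : nat -> T -> nat).
Let D := [set p : nat * nat | (0 < p.1)%N /\ (0 < p.2)%N].
Let X := fun p : nat * nat => xi p.1 p.2.
Let sxi := sigma_generated D X.
Let seps := sigma_generated [set k : nat | (0 < k)%N] eps.
Hypothesis mxi : forall k j, measurable_fun setT (xi k j).
Hypothesis meps : forall k, measurable_fun setT (eps k).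
Hypothesis xi_indep : mutually_independent P D X.
Hypothesis xi_id : identically_distributed P D X.
Hypothesis xi_eps_indep : independent_sigma P sxi seps.
Notation pastG := (past_generator xi eps).
Let lxi k j : measurable_levels (xi k j).
Proof. exact: measurable_fun_levels. Qed.

Lemma past_level_indep K A (j i : nat) : <<s pastG K >> A -> (0 < j)%N ->
  (P (A `&` [set w | xi K.+1 j w = i]) = P A * P [set w | xi 1 1 w = i])%E.
Proof.
move=> sA j0.
have := past_indep mxi meps xi_indep xi_eps_indep
  (J' := [fset (K.+1, j)]%fset) (fun=> [set i]) sA.
rewrite (_ : \bigcap_(_ in _) _ = [set w | xi K.+1 j w = i]); last first.
  apply/seteqP; split => w /=.
    by move=> /(_ (K.+1, j)) /=; rewrite in_fset1 eqxx; exact.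
  by move=> wi p /=; rewrite inE => /eqP ->.
move=> ->; last by move=> p /=; rewrite inE => /eqP ->/=; rewrite eqxx.
by congr (_ * _)%E; exact: (xi_id (i := (K.+1, j)) (j := (1, 1)%N) (B := [set i])).
Qed.

(** Fixing the offspring number of one individual on [A] leaves an event still independent of
    another individual; this yields the mixed moments. *)
Lemma past_level_indep2 K A (j l y i : nat) : <<s pastG K >> A ->
  (0 < j)%N -> (0 < l)%N -> j != l ->
  (P (A `&` [set w | xi K.+1 j w = y] `&` [set w | xi K.+1 l w = i]) =
   P (A `&` [set w | xi K.+1 j w = y]) * P [set w | xi 1 1 w = i])%E.
Proof.
move=> sA j0 l0 jl.
pose B (p : nat * nat) : set nat := if p.2 == j then [set y] else [set i].
pose J := [fset (K.+1, j); (K.+1, l)]%fset.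
have E : \bigcap_(p in [set` J]) X p @^-1` B p =
    [set w | xi K.+1 j w = y] `&` [set w | xi K.+1 l w = i].
  apply/seteqP; split => w /=.
    move=> wJ; split.
      by have := wJ (K.+1, j); rewrite /= !inE eqxx /B/= eqxx => /(_ isT).
    have := wJ (K.+1, l); rewrite /= !inE eqxx orbT /B/= eq_sym (negbTE jl).
    by apply.
  move=> [wj wl] p /=; rewrite !inE => /orP[|] /eqP -> /=; rewrite /B/= ?eqxx//.
  by rewrite eq_sym (negbTE jl).
have JD : [set` J] `<=` D by move=> p /=; rewrite !inE => /orP[|] /eqP ->.
have := past_indep mxi meps xi_indep xi_eps_indep (J' := J) B sA.
rewrite E setIA => ->; last first.
  by move=> p /=; rewrite !inE => /orP[|] /eqP -> /=; rewrite eqxx.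
rewrite -E xi_indep// (perm_big [:: (K.+1, j); (K.+1, l)])/=; last first.
  apply: uniq_perm; rewrite ?fset_uniq//= ?inE ?andbT.
    by apply/eqP => -[/eqP]; rewrite (negbTE jl).
  by move=> p; rewrite !inE.
rewrite !big_cons big_nil mule1 (past_level_indep _ sA)// -muleA; congr (_ * _)%E.
rewrite /B/= eqxx eq_sym (negbTE jl).
congr (_ * _)%E.
  exact: (xi_id (i := (K.+1, j)) (j := (1, 1)%N) (B := [set y])).
exact: (xi_id (i := (K.+1, l)) (j := (1, 1)%N) (B := [set i])).
Qed.

Variables a b : R.
Hypothesis xi_mean : (\int[P]_w (xi 1 1 w)%:R%:E = a%:E)%E.
Hypothesis xi_sqr : (\int[P]_w ((xi 1 1 w)%:R ^+ 2)%:E = (b + a ^+ 2)%:E)%E.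

Let past_meas K A : <<s pastG K >> A -> measurable A.
Proof. exact: past_sub. Qed.

Lemma past_integral K A (j : nat) (h : nat -> \bar R) : <<s pastG K >> A ->
  (0 < j)%N -> (forall i, 0 <= h i)%E ->
  (\int[P]_(w in A) h (xi K.+1 j w) = P A * \int[P]_w h (xi 1 1 w))%E.
Proof.
move=> sA j0 h0; have mA := past_meas sA.
rewrite (ge0_integral_indep (V := xi 1 1) (c := fine (P A)))//.
- by rewrite fineK// fin_num_measure.
- exact: fine_ge0.
- by move=> i; rewrite fineK ?fin_num_measure//; exact: past_level_indep.
Qed.

Lemma past_integral_prod K A (j l : nat) : <<s pastG K >> A ->
  (0 < j)%N -> (0 < l)%N -> j != l ->
  (\int[P]_(w in A) ((xi K.+1 j w)%:R * (xi K.+1 l w)%:R)%:E = P A * (a ^+ 2)%:E)%E.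
Proof.
move=> sA j0 l0 jl; have mA := past_meas sA.
have mD i : measurable (A `&` [set w | xi K.+1 j w = i]).
  by apply: measurableI => //; exact: lxi.
have mprod : measurable_fun setT
    (fun w => ((xi K.+1 j w)%:R * (xi K.+1 l w)%:R : R)%:E).
  apply: (measurable_levels_fun (measurable_levels_pair (lxi K.+1 j) (lxi K.+1 l))).
  by move=> w w' [-> ->].
rewrite (ge0_integral_levels P (lxi K.+1 j) mA mprod)//.
transitivity (\sum_(i <oo) (a%:E * \int[P]_(w in A `&` [set w | xi K.+1 j w = i])
    (xi K.+1 j w)%:R%:E))%E.
  apply: eq_eseriesr => i _.
  have -> : (\int[P]_(w in A `&` [set w | xi K.+1 j w = i])
      ((xi K.+1 j w)%:R * (xi K.+1 l w)%:R)%:E =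
     \int[P]_(w in A `&` [set w | xi K.+1 j w = i])
      (i%:R%:E * (xi K.+1 l w)%:R%:E))%E.
    by apply: eq_integral => w; rewrite inE => -[_ /= ->]; rewrite EFinM.
  rewrite ge0_integralZl_EFin//; last first.
    apply: measurable_funTS.
    exact: (measurable_levels_EFin (fun n => n%:R%:E) (lxi K.+1 l)).
  rewrite (ge0_integral_indep (h := fun n => n%:R%:E) (V := xi 1 1)
     (c := fine (P (A `&` [set w | xi K.+1 j w = i]))))//; first last.
  - by move=> i'; rewrite fineK ?fin_num_measure//; exact: past_level_indep2.
  - exact: fine_ge0.
  have -> : (\int[P]_(w in A `&` [set w | xi K.+1 j w = i]) (xi K.+1 j w)%:R%:E =
      i%:R%:E * P (A `&` [set w | xi K.+1 j w = i]))%E.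
    rewrite -integral_cst//.
    by apply: eq_integral => w; rewrite inE => -[_ /= ->].
  by rewrite fineK ?fin_num_measure// xi_mean [(_ * a%:E)%E]muleC muleCA.
rewrite nneseriesZl; last by move=> i _; exact: integral_ge0.
rewrite -ge0_integral_levels//; last first.
  exact: (measurable_levels_EFin (fun n => n%:R%:E) (lxi K.+1 j)).
rewrite (past_integral (h := fun n => n%:R%:E))// xi_mean muleCA -EFinM.
by rewrite expr2.
Qed.

(** The size [x] is deterministic; the random size [X K w] is substituted only on level sets where
    it is constant. *)
Definition brood K x w := (\sum_(1 <= j < x.+1) xi K.+1 j w)%N.

Lemma brood_levels K x : measurable_levels (brood K x).
Proof. by apply: measurable_levels_sum => j _; exact: lxi. Qed.

Let iota_gt0 x j : j \in index_iota 1 x.+1 -> (0 < j)%N.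
Proof. by rewrite mem_index_iota => /andP[]. Qed.

Lemma brood_mean K A x : <<s pastG K >> A ->
  (\int[P]_(w in A) (brood K x w)%:R%:E = P A * (x%:R * a)%:E)%E.
Proof.
move=> sA; have mA := past_meas sA.
transitivity (\int[P]_(w in A) \sum_(1 <= j < x.+1) (xi K.+1 j w)%:R%:E)%E.
  by apply: eq_integral => w _; rewrite /brood natr_sum sumEFin.
rewrite ge0_integral_sum//; last first.
  move=> j; apply: measurable_funTS.
  exact: (measurable_levels_EFin (fun n => n%:R%:E) (lxi K.+1 j)).
rewrite -[P A]fineK ?fin_num_measure// -EFinM.
rewrite (eq_big_seq (fun=> (fine (P A) * a)%:E)) => [|j /iota_gt0 j0].
  by rewrite sumEFin sumr_const_nat subn1/=; congr EFin; ring.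
by rewrite (past_integral (h := fun n => n%:R%:E))// xi_mean EFinM fineK// fin_num_measure.
Qed.

Lemma brood_sqr K A x : <<s pastG K >> A ->
  (\int[P]_(w in A) ((brood K x w)%:R ^+ 2)%:E =
   P A * (x%:R * b + x%:R ^+ 2 * a ^+ 2)%:E)%E.
Proof.
move=> sA; have mA := past_meas sA.
have mprod j l : measurable_fun A
    (fun w => ((xi K.+1 j w)%:R * (xi K.+1 l w)%:R : R)%:E).
  apply: measurable_funTS.
  apply: (measurable_levels_fun (measurable_levels_pair (lxi K.+1 j) (lxi K.+1 l))).
  by move=> w w' [-> ->].
transitivity (\int[P]_(w in A) \sum_(1 <= j < x.+1) \sum_(1 <= l < x.+1)
    ((xi K.+1 j w)%:R * (xi K.+1 l w)%:R)%:E)%E.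
  apply: eq_integral => w _; rewrite /brood natr_sum expr2 mulr_suml -sumEFin.
  by apply: eq_bigr => j _; rewrite mulr_sumr -sumEFin.
rewrite ge0_integral_sum//; first last.
- by move=> j w _; rewrite sume_ge0// => l _; rewrite lee_fin mulr_ge0.
- by move=> j; apply: emeasurable_sum => l; exact: mprod.
pose p := fine (P A); have pE : P A = p%:E by rewrite fineK// fin_num_measure.
rewrite (eq_big_seq (fun=> (p * (b + x%:R * a ^+ 2))%:E)) => [|j jx].
  by rewrite sumEFin sumr_const_nat subn1/= pE -EFinM; congr EFin; ring.
have j0 := iota_gt0 jx.
rewrite ge0_integral_sum//.
rewrite (eq_big_seq (fun l => (p * a ^+ 2 + (if l == j then p * b else 0))%:E)).
  rewrite sumEFin big_split/= sumr_const_nat subn1/=.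
  rewrite (bigD1_seq j) ?iota_uniq//= eqxx big1 ?addr0 => [|l /negbTE->//].
  by congr EFin; ring.
move=> l /iota_gt0 l0; have [->|lj] := eqVneq l j.
  under eq_integral do rewrite -expr2.
  rewrite (past_integral (h := fun n => (n%:R ^+ 2)%:E))//.
  by rewrite xi_sqr pE -EFinM; congr EFin; ring.
by rewrite past_integral_prod// 1?eq_sym// pE -EFinM addr0.
Qed.

(** The conditional second moment of a martingale step from the value [N] with [x] parents: the
    centred increment has no cross term with [N] and variance c^2 b x. *)
Lemma brood_affine K A x (N c : R) : <<s pastG K >> A ->
  (\int[P]_(w in A) ((N + c * ((brood K x w)%:R - a * x%:R)) ^+ 2)%:E =
   P A * (N ^+ 2 + c ^+ 2 * b * x%:R)%:E)%E.
Proof.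
move=> sA; have mA := past_meas sA; set S := fun w => (brood K x w)%:R : R.
pose p := fine (P A); have pE : P A = p%:E by rewrite fineK// fin_num_measure.
have mS (h : nat -> R) : measurable_fun A (fun w => (h (brood K x w))%:E).
  apply: measurable_funTS.
  exact: (measurable_levels_EFin (fun n => (h n)%:E) (brood_levels K x)).
have iS : P.-integrable A (EFin \o S).
  apply/integrableP; split; first exact: (mS (fun n => n%:R)).
  rewrite (eq_integral (fun w => (brood K x w)%:R%:E)) => [|w _]; last first.
    by rewrite /= ger0_norm.
  by rewrite brood_mean// pE -EFinM ltry.
have iS2 : P.-integrable A (EFin \o (fun w => S w ^+ 2)).
  apply/integrableP; split; first exact: (mS (fun n => n%:R ^+ 2)).
  rewrite (eq_integral (fun w => ((brood K x w)%:R ^+ 2)%:E)) => [|w _]; last first.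
    by rewrite /= ger0_norm// sqr_ge0.
  by rewrite brood_sqr// pE -EFinM ltry.
(* Collecting all constants in [u] leaves the integrand (u + c S)^2, which needs only the integrals
   of S and S^2. *)
pose u := N - c * a * x%:R.
transitivity (\int[P]_(w in A) ((u ^+ 2)%:E + (2 * c * u)%:E * (S w)%:E +
   (c ^+ 2)%:E * (S w ^+ 2)%:E))%E.
  apply: eq_integral => w _; rewrite -!EFinM -!EFinD /u; congr EFin.
  by rewrite -/(S w); ring.
have iu : P.-integrable A (fun=> (u ^+ 2)%:E).
  exact: finite_measure_integrable_cst.
have iuE : (\int[P]_(w in A) (u ^+ 2)%:E = (u ^+ 2 * p)%:E)%E.
  by rewrite integral_cst// [RHS]EFinM -pE.
have iuS := integrableZl mA (2 * c * u) iS.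
have iuS2 := integrableZl mA (c ^+ 2) iS2.
rewrite (integralD mA (integrableD mA iu iuS) iuS2) (integralD mA iu iuS).
rewrite (integralZl mA iS) (integralZl mA iS2) iuE.
rewrite brood_mean// brood_sqr// pE -!EFinM -!EFinD; congr EFin.
by rewrite /u; ring.
Qed.

End offspring.

(** * Kolmogorov's inequality for the offspring martingale *)

Section maximal_inequality.
Context {d : measure_display} {T : measurableType d} {R : realType}.
Variable P : probability T R.
Variables (xi : nat -> nat -> T -> nat) (eps : nat -> T -> nat).
Let D := [set p : nat * nat | (0 < p.1)%N /\ (0 < p.2)%N].
Let Xi := fun p : nat * nat => xi p.1 p.2.
Let sxi := sigma_generated D Xi.
Let seps := sigma_generated [set k : nat | (0 < k)%N] eps.
Hypothesis mxi : forall k j, measurable_fun setT (xi k j).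
Hypothesis meps : forall k, measurable_fun setT (eps k).
Hypothesis xi_indep : mutually_independent P D Xi.
Hypothesis xi_id : identically_distributed P D Xi.
Hypothesis xi_eps_indep : independent_sigma P sxi seps.
Variables a b : R.
Hypothesis xi_mean : (\int[P]_w (xi 1 1 w)%:R%:E = a%:E)%E.
Hypothesis xi_sqr : (\int[P]_w ((xi 1 1 w)%:R ^+ 2)%:E = (b + a ^+ 2)%:E)%E.
Hypotheses (a0 : 0 <= a) (b0 : 0 <= b).
Notation pastG := (past_generator xi eps).
Notation X := (branching xi eps).

Lemma past_xi K l j s : (0 < l <= K)%N -> (0 < j)%N ->
  <<s pastG K >> [set w | xi l j w = s].
Proof.
move=> /andP[l0 lK] j0; apply: sub_sigma_algebra.
exists [fset (l, j)]%fset, (fun=> [set s]), setT; split.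
- by move=> p /=; rewrite in_fset1 => /eqP -> /=; rewrite l0 lK.
- exact: (@measurableT _ (g_sigma_algebraType
   (\bigcup_(i in [set k : nat | (0 < k)%N]) preimage_set_system setT (eps i) measurable))).
apply/seteqP; split => w /=; last first.
  by move=> [/(_ (l, j)) /=]; rewrite in_fset1 eqxx => /(_ isT).
by move=> ws; split => // p /=; rewrite in_fset1 => /eqP ->.
Qed.

Lemma past_eps K l s : (0 < l)%N -> <<s pastG K >> [set w | eps l w = s].
Proof.
move=> l0; apply: sub_sigma_algebra.
exists fset0, (fun=> setT), [set w | eps l w = s]; split.
- by move=> p /=; rewrite in_fset0.
- by apply: (sigma_generated_preimage (B := [set s]) (i := l)).
- by apply/seteqP; split => w; [split|case].
Qed.

Lemma past_branching K k : (k <= K)%N ->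
  @measurable_levels _ (past xi eps K) nat (X k).
Proof.
move=> kK; apply: (@measurable_levels_branching _ (past xi eps K) xi eps K) => //.
- by move=> l j lK j0 s; exact: past_xi.
- by move=> l l0 s; exact: past_eps.
Qed.

(** Indices start at 1, since [X 0] is 0 and [eps 0] does not belong to the past. The immigration is
    recorded because the martingale increments subtract it. *)
Definition history k w := [seq (X i.+1 w, eps i.+1 w) | i <- iota 0 k].
(* Coding the history by an integer turns conditioning into a countable sum. *)
Definition history_code k w : nat := choice.pickle (history k w).

Lemma past_history k : @measurable_levels _ (past xi eps k) nat (history_code k).
Proof.
apply: (@measurable_levels_map _ (past xi eps k) _ _ (history k) choice.pickle) => v.
(* [measurable_history] asks for every index, but only [X i] with [i <= k] is known to be measurable
   over the past; [minn] caps the index without changing the history. *)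
rewrite (_ : [set _ | _] = [set w | [seq (X (minn i.+1 k) w, eps i.+1 w) | i <- iota 0 k] = v]).
  apply: (@measurable_history _ (past xi eps k) _
    (fun i w => (X (minn i.+1 k) w, eps i.+1 w))) => i s.
  apply: (@measurable_levels_pair _ (past xi eps k)).
    by apply: past_branching; exact: geq_minr.
  by move=> t; exact: past_eps.
apply/seteqP; split => w /= <-; rewrite /history; apply/eq_in_map => i;
  by rewrite mem_iota add0n => /andP[_ ik]; rewrite (minn_idPl _).
Qed.

Lemma history_code_eq k w w' i : history_code k w = history_code k w' ->
  (0 < i <= k)%N -> X i w = X i w' /\ eps i w = eps i w'.
Proof.
move=> /(pcan_inj choice.pickleK) /eq_in_map hw /andP[i0 ik].
have := hw i.-1; rewrite mem_iota add0n leq0n prednK//= => /(_ ik)[].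
by move=> -> ->.
Qed.

Lemma history_code_eqX k w w' i : history_code k w = history_code k w' ->
  (i <= k)%N -> X i w = X i w'.
Proof.
move=> hw ik; case: (posnP i) => [->//|i0].
by have [] := history_code_eq hw (i := i); rewrite ?i0.
Qed.

Lemma levels_history k : measurable_levels (history_code k).
Proof. by move=> s; apply: past_sub; [exact: mxi|exact: meps|exact: past_history]. Qed.

Lemma levels_branching k : measurable_levels (X k).
Proof.
apply: (@measurable_levels_branching _ _ xi eps k) => // [l j _ _|l _];
  exact: measurable_fun_levels.
Qed.

Variable c : nat -> R.

(** Written with [X] and [eps] instead of the centred sums of [xi], so that its value is visibly a
    function of the history. *)
Definition martingale (k : nat) (w : T) : R :=
  \sum_(1 <= i < k.+1) c i * ((X i w)%:R - (eps i w)%:R - a * (X i.-1 w)%:R).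

Lemma martingaleS k w : martingale k.+1 w =
  martingale k w + c k.+1 * ((brood xi k (X k w) w)%:R - a * (X k w)%:R).
Proof.
by rewrite /martingale big_nat_recr//= natrD addrK.
Qed.

Lemma history_code_martingale k w w' : history_code k w = history_code k w' ->
  martingale k w = martingale k w'.
Proof.
move=> hw; rewrite /martingale big_seq [RHS]big_seq; apply: eq_bigr => i.
rewrite mem_index_iota ltnS => /andP[i0 ik].
have [-> ->] := history_code_eq hw (i := i) (introT andP (conj i0 ik)).
by rewrite (history_code_eqX hw (i := i.-1))// (leq_trans (leq_pred _)).
Qed.

Lemma measurable_martingale k : measurable_fun setT (martingale k).
Proof.
by apply: (measurable_levels_fun (levels_history k)) => w w'; exact: history_code_martingale.
Qed.

Lemma history_level k (A : set T) i w0 :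
  (forall w w', history_code k w = history_code k w' -> A w -> A w') ->
  A w0 -> history_code k w0 = i ->
  A `&` [set w | history_code k w = i] = [set w | history_code k w = i].
Proof.
move=> hA Aw0 w0i; apply/seteqP; split => w /=; first by case.
by move=> wi; split => //; apply: hA Aw0; rewrite w0i.
Qed.

(** [A] is a union of level sets of the history. On each of them [martingale k] and [X k] are
    constant, and [brood_affine] applies. *)
Lemma martingale_sqr_step k (A : set T) : measurable A ->
  (forall w w', history_code k w = history_code k w' -> A w -> A w') ->
  (\int[P]_(w in A) (martingale k.+1 w ^+ 2)%:E =
   \int[P]_(w in A) (martingale k w ^+ 2 + c k.+1 ^+ 2 * b * (X k w)%:R)%:E)%E.
Proof.
move=> mA hA; apply: (@ge0_integral_level_eq _ _ _ P (history_code k)) => //.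
- exact: levels_history.
- apply/measurable_EFinP; apply: measurable_funX; exact: measurable_martingale.
- apply: (measurable_levels_fun (levels_history k)) => w w' hw.
  by rewrite (history_code_martingale hw) (history_code_eqX hw (leqnn k)).
- by move=> w; rewrite lee_fin sqr_ge0.
- by move=> w; rewrite lee_fin addr_ge0 ?sqr_ge0// mulr_ge0// mulr_ge0// sqr_ge0.
move=> i; have [[w0 [Aw0 w0i]]|noA] := pselect (exists w, A w /\ history_code k w = i);
  last first.
  rewrite (_ : A `&` _ = set0) ?integral_set0//.
  by apply/seteqP; split => // w [Aw wi]; apply: noA; exists w.
rewrite (history_level hA Aw0 w0i).
have sH : <<s pastG k >> [set w | history_code k w = i] by exact: past_history.
transitivity (\int[P]_(w in [set w | history_code k w = i])
   ((martingale k w0 + c k.+1 * ((brood xi k (X k w0) w)%:R - a * (X k w0)%:R)) ^+ 2)%:E)%E.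
  apply: eq_integral => w; rewrite inE /= => wi; rewrite martingaleS.
  have hw : history_code k w = history_code k w0 by rewrite wi.
  by rewrite (history_code_martingale hw) (history_code_eqX hw (leqnn k)).
rewrite (brood_affine mxi meps xi_indep xi_id xi_eps_indep xi_mean xi_sqr _ _ _ sH).
rewrite muleC -integral_cst; last exact: levels_history.
apply: eq_integral => w; rewrite inE /= => wi.
have hw : history_code k w = history_code k w0 by rewrite wi.
by rewrite (history_code_martingale hw) (history_code_eqX hw (leqnn k)).
Qed.

(** Wald's identity for the random sum, verified on the level sets of the history. *)
Lemma branching_mean_step k :
  (\int[P]_w (X k.+1 w)%:R%:E =
   a%:E * \int[P]_w (X k w)%:R%:E + \int[P]_w (eps k.+1 w)%:R%:E)%E.
Proof.
have mX l : measurable_fun setT (fun w => (X l w)%:R%:E : \bar R).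
  exact: (measurable_levels_EFin (fun n => n%:R%:E) (levels_branching l)).
have me l : measurable_fun setT (fun w => (eps l w)%:R%:E : \bar R).
  exact: (measurable_levels_EFin (fun n => n%:R%:E) (measurable_fun_levels (meps l))).
have mB : measurable_fun setT (fun w => (brood xi k (X k w) w)%:R%:E : \bar R).
  apply: (measurable_levels_EFin (fun n => n%:R%:E)).
  apply: (measurable_levels_bind (Y := brood xi k) (levels_branching k)) => x.
  exact: brood_levels.
transitivity (\int[P]_w ((brood xi k (X k w) w)%:R%:E + (eps k.+1 w)%:R%:E))%E.
  by apply: eq_integral => w _; rewrite /= natrD EFinD.
rewrite ge0_integralD//; congr (_ + _)%E.
rewrite -ge0_integralZl_EFin//.
apply: (@ge0_integral_level_eq _ _ _ P (history_code k)) => //.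
- exact: levels_history.
- exact: measurable_funeM.
- by move=> w; rewrite mule_ge0.
move=> i; rewrite setTI.
have [[w0 w0i]|noA] := pselect (exists w, history_code k w = i); last first.
  rewrite (_ : [set _ | _] = set0) ?integral_set0//.
  by apply/seteqP; split => // w wi; apply: noA; exists w.
have sH : <<s pastG k >> [set w | history_code k w = i] by exact: past_history.
transitivity (\int[P]_(w in [set w | history_code k w = i])
   (brood xi k (X k w0) w)%:R%:E)%E.
  apply: eq_integral => w; rewrite inE /= => wi.
  by rewrite (history_code_eqX (w' := w0) _ (leqnn k))// wi.
rewrite (brood_mean mxi meps xi_indep xi_id xi_eps_indep xi_mean _ sH).
rewrite muleC -integral_cst; last exact: levels_history.
apply: eq_integral => w; rewrite inE /= => wi.
by rewrite (history_code_eqX (w' := w0) (k := k) _ (leqnn k)) ?wi// -EFinM mulrC.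
Qed.

Variable m : nat -> R.
Hypothesis X_mean : forall k, (\int[P]_w (X k w)%:R%:E = (m k)%:E)%E.

Let stay lam k := [set w | forall i, (i <= k)%N -> `|martingale i w| < lam].

Let measurable_stay lam k : measurable (stay lam k).
Proof.
rewrite (_ : stay lam k = \bigcap_(i in `I_k.+1) [set w | `|martingale i w| < lam]).
  apply: bigcap_measurable; first by exists 0%N.
  move=> i _; have : measurable_fun setT (fun w => `|martingale i w|).
    by apply: measurableT_comp => //; exact: measurable_martingale.
  move=> /(_ measurableT _ (measurable_itv `]-oo, lam[)); rewrite setTI.
  by congr measurable; apply/seteqP; split => w /=; rewrite in_itv.
by apply/seteqP; split => w wk i /=; [rewrite ltnS|rewrite -ltnS] => /wk.
Qed.

(* Keeping the second moment on the event where the path has stayed small makes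
   the bound provable by induction on K. *)
Lemma kolmogorov_inequality (lam : R) (K : nat) : 0 < lam ->
  ((lam ^+ 2)%:E * P (~` stay lam K) +
     \int[P]_(w in stay lam K) (martingale K w ^+ 2)%:E <=
   (\sum_(0 <= k < K) c k.+1 ^+ 2 * b * m k)%:E)%E.
Proof.
move=> lam0.
have mM k : measurable_fun setT (fun w => (martingale k w ^+ 2)%:E).
  apply/measurable_EFinP; apply: measurable_funX; exact: measurable_martingale.
have M0 k w : (0 <= (martingale k w ^+ 2)%:E)%E by rewrite lee_fin sqr_ge0.
have mX l : measurable_fun setT (fun w => (X l w)%:R%:E : \bar R).
  exact: (measurable_levels_EFin (fun n => n%:R%:E) (levels_branching l)).
elim: K => [|K IH].
  rewrite big_nil (_ : stay lam 0 = setT).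
    rewrite setCT measure0 mule0 add0e.
    under eq_integral do rewrite /martingale big_nil expr0n.
    by rewrite integral0.
  by apply/seteqP; split => // w _ i; rewrite leqn0 => /eqP ->; rewrite /martingale big_nil normr0.
have sub : stay lam K.+1 `<=` stay lam K by move=> w wK i iK; apply: wK; exact: leqW.
(* The event that the level [lam] is first reached at step [K.+1]; there the squared martingale is
   at least [lam ^+ 2]. *)
pose jump := stay lam K `\` stay lam K.+1.
have mjump : measurable jump by exact: measurableD.
have step : (\int[P]_(w in stay lam K) (martingale K.+1 w ^+ 2)%:E <=
    \int[P]_(w in stay lam K) (martingale K w ^+ 2)%:E +
    (c K.+1 ^+ 2 * b * m K)%:E)%E.
  rewrite martingale_sqr_step//; last first.
    move=> w w' hw wK i iK; have {}hw : history_code i w = history_code i w'.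
      congr choice.pickle; have /(pcan_inj choice.pickleK) /eq_in_map hw' := hw.
      apply/eq_in_map => j; rewrite mem_iota add0n => /andP[_ ji]; apply: hw'.
      by rewrite mem_iota/= add0n (leq_trans ji).
    by rewrite -(history_code_martingale hw); exact: wK.
  under eq_integral do rewrite EFinD.
  have cb0 : 0 <= c K.+1 ^+ 2 * b by rewrite mulr_ge0 ?sqr_ge0.
  have mcX : measurable_fun setT (fun w => (c K.+1 ^+ 2 * b * (X K w)%:R)%:E).
    exact: (measurable_levels_EFin (fun n => (c K.+1 ^+ 2 * b * n%:R)%:E) (levels_branching K)).
  rewrite ge0_integralD//=; first last.
  - exact: measurable_funTS.
  - by move=> w _; rewrite lee_fin mulr_ge0.
  - exact: measurable_funTS.
  rewrite leeD2l//.
  apply: (@le_trans _ _ (\int[P]_w (c K.+1 ^+ 2 * b * (X K w)%:R)%:E)%E).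
    by apply: ge0_subset_integral => // w _; rewrite lee_fin mulr_ge0.
  under eq_integral do rewrite EFinM.
  by rewrite ge0_integralZl_EFin// X_mean -EFinM.
have split_int : (\int[P]_(w in stay lam K) (martingale K.+1 w ^+ 2)%:E =
    \int[P]_(w in stay lam K.+1) (martingale K.+1 w ^+ 2)%:E +
    \int[P]_(w in jump) (martingale K.+1 w ^+ 2)%:E)%E.
  rewrite -[in LHS](setDUK sub) ge0_integral_setU//.
  - exact: measurable_funTS.
  - by rewrite disj_set2E; apply/eqP; rewrite setDIK.
have jump_le : ((lam ^+ 2)%:E * P jump <=
    \int[P]_(w in jump) (martingale K.+1 w ^+ 2)%:E)%E.
  rewrite -integral_cst//; apply: ge0_le_integral => //.
  - by move=> w _; rewrite lee_fin sqr_ge0.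
  - exact: measurable_funTS.
  move=> w [wK wK1]; rewrite lee_fin.
  have : lam <= `|martingale K.+1 w|.
    rewrite leNgt; apply/negP => h; apply: wK1 => i.
    by rewrite leq_eqVlt => /predU1P[->//|]; rewrite ltnS; exact: wK.
  move=> h; rewrite -[leRHS]real_normK ?num_real//.
  by rewrite ler_sqr ?nnegrE// ltW.
have PC : (P (~` stay lam K.+1) = P (~` stay lam K) + P jump)%E.
  rewrite -measureU//; [congr (P _)|exact: measurableC|].
    apply/seteqP; split => w /=.
      by move=> wK1; have [wK|] := pselect (stay lam K w); [right|left].
    by move=> [wK /sub//|[_]].
  by apply/seteqP; split => // w [/= wK [wK' _]].
rewrite big_nat_recr//= EFinD PC ge0_muleDr//.
apply: (le_trans _ (leeD IH (lexx _))).
rewrite -[leLHS]addeA -[leRHS]addeA leeD2l//; apply: (le_trans _ step).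
by rewrite split_int addeC leeD2l.
Qed.

End maximal_inequality.

(** * Second moments of weighted sums of psi-mixing variables *)

Section mixing.
Context {d : measure_display} {T : measurableType d} {R : realType}.
Variable P : probability T R.
Variable eps : nat -> T -> nat.
Hypothesis meps : forall k, measurable_fun setT (eps k).

Lemma mixing_coef_ge0 r : (0 <= mixing_coef P eps r)%E.
Proof.
have sT (I : set nat) : sigma_generated I eps setT.
  exact: (@measurableT _ (g_sigma_algebraType
    (\bigcup_(i in I) preimage_set_system setT (eps i) measurable))).
apply: (@le_trans _ _ (psi_coef P (sigma_generated [set i | (1 <= i <= 1)%N] eps)
   (sigma_generated [set i | (1 + r <= i)%N] eps))); last first.
  by apply: ereal_sup_ubound; exists 1%N.
have PT : P setT = 1%E := probability_setT P.
apply: ereal_sup_ubound; exists setT, setT; split => //.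
  by rewrite PT mule1 lte01.
by rewrite setTI PT/= mulr1 divr1 subrr normr0.
Qed.

Lemma mixing_coef_le k r A B (psi : R) : (0 < k)%N ->
  (mixing_coef P eps r <= psi%:E)%E ->
  sigma_generated [set i | (1 <= i <= k)%N] eps A ->
  sigma_generated [set i | (k + r <= i)%N] eps B ->
  (P (A `&` B) <= (1 + psi)%:E * (P A * P B))%E.
Proof.
move=> k0 hpsi sA sB.
have mA : measurable A by exact: (sigma_generated_measurable meps sA).
have mB : measurable B by exact: (sigma_generated_measurable meps sB).
have mAB : measurable (A `&` B) by exact: measurableI.
pose p := fine (P A); pose q := fine (P B); pose s := fine (P (A `&` B)).
have pE : P A = p%:E by rewrite fineK// fin_num_measure.
have qE : P B = q%:E by rewrite fineK// fin_num_measure.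
have sE : P (A `&` B) = s%:E by rewrite fineK// fin_num_measure.
have p0 : 0 <= p by exact: fine_ge0.
have q0 : 0 <= q by exact: fine_ge0.
have sp : s <= p.
  by rewrite -lee_fin -sE -pE; apply: le_measure; rewrite ?inE//; exact: subIsetl.
have sq : s <= q.
  by rewrite -lee_fin -sE -qE; apply: le_measure; rewrite ?inE//; exact: subIsetr.
have psi0 : 0 <= psi by rewrite -lee_fin; exact: le_trans (mixing_coef_ge0 r) hpsi.
rewrite sE pE qE -!EFinM lee_fin.
(* Pairs with P(A) P(B) = 0 are excluded from the supremum, but then the joint probability vanishes
   as well. *)
have [pq|] := ltP 0 (p * q); last first.
  move=> pq; have : s <= 0.
    have [/(le_trans sp)//|p1] := leP p 0.
    have [/(le_trans sq)//|q1] := leP q 0.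
    by move: pq; rewrite leNgt mulr_gt0.
  by move/le_trans; apply; rewrite mulr_ge0 ?addr_ge0// mulr_ge0.
have : (`|s / (p * q) - 1|%:E <= psi%:E)%E.
  apply: le_trans hpsi.
  apply: (@le_trans _ _ (psi_coef P (sigma_generated [set i | (1 <= i <= k)%N] eps)
     (sigma_generated [set i | (k + r <= i)%N] eps))); last first.
    by apply: ereal_sup_ubound; exists k.
  apply: ereal_sup_ubound; exists A, B; split => //.
  by rewrite pE qE -EFinM lte_fin.
by rewrite lee_fin ler_norml -ler_pdivrMr// => /andP[_]; lra.
Qed.

Variables (psi : nat -> R) (Psi : R) (e v : nat -> R).
Hypothesis mixing_psi : forall r, (0 < r)%N -> (mixing_coef P eps r <= (psi r)%:E)%E.
Hypothesis psi_ge0 : forall r, 0 <= psi r.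
Hypothesis psi_sum : forall n, \sum_(1 <= r < n) psi r <= Psi.
Hypothesis eps_mean : forall k, (0 < k)%N -> (\int[P]_w (eps k w)%:R%:E = (e k)%:E)%E.
Hypothesis eps_sqr : forall k, (0 < k)%N ->
  (\int[P]_w ((eps k w)%:R ^+ 2)%:E = (v k + e k ^+ 2)%:E)%E.

Let leps k : measurable_levels (eps k).
Proof. exact: measurable_fun_levels. Qed.

Let e_ge0 k : (0 < k)%N -> 0 <= e k.
Proof. by move=> k0; rewrite -lee_fin -eps_mean//; exact: integral_ge0. Qed.

Let meps2 i j : measurable_fun setT (fun w => ((eps i w)%:R * (eps j w)%:R : R)%:E).
Proof.
apply: (measurable_levels_fun (measurable_levels_pair (leps i) (leps j))).
by move=> w w' [-> ->].
Qed.

(* Immigration is nonnegative, so the upper mixing bound on joint probabilities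
   suffices and no centring is needed. *)
Lemma mixing_product i r : (0 < i)%N -> (0 < r)%N ->
  (\int[P]_w ((eps i w)%:R * (eps (i + r) w)%:R)%:E <=
   ((1 + psi r) * (e i * e (i + r)%N))%:E)%E.
Proof.
move=> i0 r0; set j := (i + r)%N; have j0 : (0 < j)%N by rewrite addn_gt0 i0.
rewrite (ge0_integral_levels P (leps i) measurableT (meps2 i j)); last first.
  by move=> w; rewrite lee_fin mulr_ge0.
have psi1 : 0 <= 1 + psi r by rewrite addr_ge0.
apply: (@le_trans _ _ (\sum_(x <oo) (((1 + psi r) * e j)%:E *
    (x%:R%:E * P (setT `&` [set w | eps i w = x]))))%E).
  apply: lee_nneseries => [x _ _|x _].
    by apply: integral_ge0 => w _; rewrite lee_fin mulr_ge0.
  rewrite setTI; have mx := leps i x.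
  have -> : (\int[P]_(w in [set w | eps i w = x]) ((eps i w)%:R * (eps j w)%:R)%:E =
      \int[P]_(w in [set w | eps i w = x]) (x%:R%:E * (eps j w)%:R%:E))%E.
    by apply: eq_integral => w; rewrite inE /= => ->; rewrite EFinM.
  rewrite ge0_integralZl_EFin//; last first.
    apply: measurable_funTS.
    exact: (measurable_levels_EFin (fun n => n%:R%:E) (leps j)).
  rewrite muleCA lee_wpmul2l//.
  pose p := fine (P [set w | eps i w = x]).
  have pE : P [set w | eps i w = x] = p%:E by rewrite fineK// fin_num_measure.
  rewrite [leRHS](_ : _ = ((1 + psi r) * p)%:E * \int[P]_w (eps j w)%:R%:E)%E; last first.
    by rewrite eps_mean// pE -!EFinM; congr EFin; ring.
  apply: (ge0_integral_weak_indep (h := fun n => n%:R%:E)) => //.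
    by rewrite mulr_ge0// fine_ge0.
  move=> y; rewrite EFinM -pE -muleA; apply: (@mixing_coef_le i r) => //.
  - exact: mixing_psi.
  - by apply: (sigma_generated_preimage (B := [set x]) (i := i)) => //=; rewrite i0 leqnn.
  - by apply: (sigma_generated_preimage (B := [set y]) (i := j)) => /=.
rewrite nneseriesZl//; last by move=> x _; rewrite mule_ge0.
rewrite -(ge0_integral_comp_levels P (h := fun n => n%:R%:E) (leps i))//.
by rewrite eps_mean// -EFinM lee_fin le_eqVlt; apply/orP; left; apply/eqP; ring.
Qed.

Let dist (i j : nat) := ((i - j) + (j - i))%N.

(** Every positive distance to [i] occurs at most once on each side of [i], hence twice [Psi]. *)
Lemma psi_dist_sum (i n : nat) : (0 < i < n)%N ->
  \sum_(1 <= j < n) (if i == j then 0 else psi (dist i j)) <= 2 * Psi.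
Proof.
move=> /andP[i0 i_n].
rewrite (@big_cat_nat _ _ _ i)//=; last exact: ltnW.
rewrite [X in _ + X]big_ltn// eqxx add0r mulr2n mulrDl mul1r lerD//.
  apply: le_trans (psi_sum i); rewrite big_nat_rev/= add1n.
  rewrite le_eqVlt; apply/orP; left; apply/eqP.
  rewrite big_seq [RHS]big_seq; apply: eq_bigr => j; rewrite mem_index_iota => /andP[j0 ji].
  rewrite subSS; case: eqP => [?|_]; first lia.
  by congr psi; rewrite /dist; lia.
apply: le_trans (psi_sum (n - i)).
rewrite -{1}[i.+1]add1n big_addn.
rewrite le_eqVlt; apply/orP; left; apply/eqP.
rewrite big_seq [RHS]big_seq; apply: eq_bigr => j; rewrite mem_index_iota => /andP[j0 ji].
case: eqP => [?|_]; first lia.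
by congr psi; rewrite /dist; lia.
Qed.

Variables (c : nat -> R) (n : nat).
Hypothesis c_ge0 : forall i, 0 <= c i.

Let Z w : R := \sum_(1 <= i < n.+1) c i * (eps i w)%:R.
Let mu := \sum_(1 <= i < n.+1) c i * e i.
Let V := \sum_(1 <= i < n.+1) c i ^+ 2 * v i +
  2 * Psi * \sum_(1 <= i < n.+1) (c i * e i) ^+ 2.

Let iota_gt0 j : j \in index_iota 1 n.+1 -> (0 < j)%N.
Proof. by rewrite mem_index_iota => /andP[]. Qed.

(** With x_i = c_i e_i, mixing lets an off-diagonal pair exceed x_i x_j by at most psi(|i - j|) x_i
    x_j. Replacing this product by (x_i^2 + x_j^2)/2 and summing psi along rows and columns gives 2
    Psi times the sum of the x_i^2. *)
Lemma mixing_second_moment : (\int[P]_w (Z w ^+ 2)%:E <= (mu ^+ 2 + V)%:E)%E.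
Proof.
pose x i := c i * e i.
pose F i j := x i * x j + (if i == j then c i ^+ 2 * v i else 0) +
  (if i == j then 0 else psi (dist i j)) * ((x i ^+ 2 + x j ^+ 2) / 2).
have le_prod i j : (0 < i)%N -> (0 < j)%N ->
    (\int[P]_w ((c i * c j) * ((eps i w)%:R * (eps j w)%:R))%:E <= (F i j)%:E)%E.
  move=> i0 j0; under eq_integral do rewrite EFinM.
  rewrite ge0_integralZl_EFin ?mulr_ge0//.
  have [<-|ij] := eqVneq i j.
    rewrite (eq_integral (fun w => ((eps i w)%:R ^+ 2)%:E)) => [|w _]; last by rewrite expr2.
    rewrite eps_sqr// -EFinM lee_fin /F eqxx mul0r addr0 /x.
    by rewrite le_eqVlt; apply/orP; left; apply/eqP; ring.
  rewrite /F (negbTE ij) addr0.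
  have xx : x i * x j <= (x i ^+ 2 + x j ^+ 2) / 2.
    by have := sqr_ge0 (x i - x j); nra.
  apply: (@le_trans _ _ (((1 + psi (dist i j)) * (x i * x j))%:E)%E); last first.
    rewrite lee_fin mulrDl mul1r lerD// ler_wpM2l//.
  rewrite (_ : (1 + psi (dist i j)) * (x i * x j) =
     c i * c j * ((1 + psi (dist i j)) * (e i * e j))); last by rewrite /x; ring.
  rewrite [leRHS]EFinM lee_wpmul2l ?lee_fin ?mulr_ge0//.
  move: ij; rewrite neq_ltn => /orP[ij|ji].
    have -> : dist i j = (j - i)%N by rewrite /dist; lia.
    have jd : (0 < j - i)%N by rewrite subn_gt0.
    by have := @mixing_product i (j - i) i0 jd; rewrite subnKC// ltnW.
  have -> : dist i j = (i - j)%N by rewrite /dist; lia.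
  have jd : (0 < i - j)%N by rewrite subn_gt0.
  have := @mixing_product j (i - j) j0 jd; rewrite subnKC 1?ltnW//.
  rewrite [e i * _]mulrC; apply: le_trans; rewrite le_eqVlt; apply/orP; left; apply/eqP.
  by apply: eq_integral => w _; rewrite mulrC.
have ZE w : (Z w ^+ 2)%:E = (\sum_(1 <= i < n.+1) \sum_(1 <= j < n.+1)
   ((c i * c j) * ((eps i w)%:R * (eps j w)%:R))%:E)%E.
  rewrite /Z expr2 mulr_suml -sumEFin; apply: eq_bigr => i _.
  rewrite mulr_sumr -sumEFin; apply: eq_bigr => j _.
  by congr EFin; ring.
have mprod i j : measurable_fun setT
    (fun w => ((c i * c j) * ((eps i w)%:R * (eps j w)%:R) : R)%:E).
  apply: (measurable_levels_fun (measurable_levels_pair (leps i) (leps j))).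
  by move=> w w' [-> ->].
have prod0 i j w : (0 <= ((c i * c j) * ((eps i w)%:R * (eps j w)%:R))%:E)%E.
  by rewrite lee_fin !mulr_ge0.
under eq_integral do rewrite ZE.
rewrite ge0_integral_sum//; first last.
- by move=> i w _; exact: sume_ge0.
- by move=> i; apply: emeasurable_sum => j; exact: mprod.
apply: (@le_trans _ _ (\sum_(1 <= i < n.+1) \sum_(1 <= j < n.+1) (F i j)%:E)%E).
  rewrite big_seq [leRHS]big_seq; apply: lee_sum => i /iota_gt0 i0.
  rewrite ge0_integral_sum//.
  rewrite big_seq [leRHS]big_seq; apply: lee_sum => j /iota_gt0 j0.
  exact: le_prod.
under eq_bigr do rewrite sumEFin.
rewrite sumEFin lee_fin.
under eq_bigr do rewrite !big_split/=.
rewrite !big_split/= /V -addrA lerD//.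
  by under eq_bigr do rewrite -mulr_sumr; rewrite -mulr_suml expr2.
rewrite lerD//.
  rewrite big_seq [leRHS]big_seq; apply: ler_sum => i i1.
  by rewrite (bigD1_seq i) ?iota_uniq//= eqxx big1 ?addr0// => j; rewrite eq_sym => /negbTE ->.
pose G i j := (if i == j then 0 else psi (dist i j)) * (x i ^+ 2 / 2).
have Gsum : \sum_(1 <= i < n.+1) \sum_(1 <= j < n.+1) G i j <=
    Psi * \sum_(1 <= i < n.+1) x i ^+ 2.
  rewrite mulr_sumr big_seq [leRHS]big_seq; apply: ler_sum => i i1.
  rewrite -mulr_suml (_ : Psi * _ = 2 * Psi * (x i ^+ 2 / 2)); last by field.
  rewrite ler_wpM2r ?divr_ge0 ?sqr_ge0//; apply: psi_dist_sum.
  by move: i1; rewrite mem_index_iota.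
apply: (@le_trans _ _ (\sum_(1 <= i < n.+1) \sum_(1 <= j < n.+1) G i j +
   \sum_(1 <= i < n.+1) \sum_(1 <= j < n.+1) G j i)).
  rewrite -big_split/=; apply: ler_sum => i _; rewrite -big_split/=; apply: ler_sum => j _.
  rewrite /G [j == i]eq_sym (_ : dist j i = dist i j) ?[dist j i]addnC//.
  by case: eqP => _; rewrite ?mul0r ?addr0// -mulrDr -mulrDl.
rewrite [X in _ + X]exchange_big/= -mulrA mulr2n mulrDl mul1r.
exact: lerD.
Qed.

Lemma mixing_chebyshev (lam : R) : 0 < lam ->
  ((lam ^+ 2)%:E * P [set w | (lam <= `|Z w - mu|)%R] <= V%:E)%E.
Proof.
move=> lam0.
have mu0 : 0 <= mu.
  by rewrite /mu big_seq sumr_ge0// => i /iota_gt0 i0; rewrite mulr_ge0// e_ge0.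
have Z0 w : 0 <= Z w by rewrite sumr_ge0// => i _; rewrite mulr_ge0.
have mceps i : measurable_fun setT (fun w => c i * (eps i w)%:R).
  by apply: (measurable_levels_fun (leps i)) => w w' ->.
have mZ : measurable_fun setT Z by exact: measurable_sum.
have mZE : measurable_fun setT (EFin \o Z) by exact/measurable_EFinP.
have mZ2 : measurable_fun setT (fun w => (Z w ^+ 2)%:E).
  by apply/measurable_EFinP; exact: measurable_funX.
have mZmu : measurable_fun setT (fun w => ((Z w - mu) ^+ 2)%:E).
  by apply/measurable_EFinP; apply: measurable_funX; exact: measurable_funB.
have intZ : (\int[P]_w (Z w)%:E = mu%:E)%E.
  under eq_integral do rewrite /Z -sumEFin.
  rewrite ge0_integral_sum//; first last.
  - by move=> i w _; rewrite lee_fin mulr_ge0.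
  - by move=> i; exact/measurable_EFinP.
  rewrite -sumEFin big_seq [RHS]big_seq; apply: eq_bigr => i /iota_gt0 i0.
  under eq_integral do rewrite EFinM.
  rewrite ge0_integralZl_EFin//; first by rewrite eps_mean// -EFinM.
  exact: (measurable_levels_EFin (fun n => n%:R%:E) (leps i)).
have varZ : (\int[P]_w ((Z w - mu) ^+ 2)%:E <= V%:E)%E.
  (* (Z - mu)^2 + 2 mu Z = Z^2 + mu^2, arranged so that all integrands are nonnegative. *)
  have : (\int[P]_w ((Z w - mu) ^+ 2)%:E + (2 * mu ^+ 2)%:E =
      \int[P]_w (Z w ^+ 2)%:E + (mu ^+ 2)%:E)%E.
    have -> : ((2 * mu ^+ 2)%:E = \int[P]_w ((2 * mu)%:E * (Z w)%:E))%E.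
      rewrite ge0_integralZl_EFin ?mulr_ge0//; first by rewrite intZ -EFinM; congr EFin; ring.
      by move=> w _; rewrite lee_fin.
    have -> : ((mu ^+ 2)%:E = \int[P]_w (mu ^+ 2)%:E)%E.
      by rewrite integral_cst// -[LHS]mule1; congr (_ * _)%E; exact/esym/probability_setT.
    rewrite -!ge0_integralD//=.
    all: try by move=> w _; rewrite -?EFinM lee_fin ?sqr_ge0 ?mulr_ge0.
    all: try exact: measurable_funeM.
    by apply: eq_integral => w _; rewrite -EFinM -!EFinD; congr EFin; ring.
  move=> H; rewrite -(@leeD2rE _ (2 * mu ^+ 2)%:E)// H.
  apply: (le_trans (leeD mixing_second_moment (lexx _))).
  by rewrite -!EFinD lee_fin; lra.
have mL : measurable [set w | (lam <= `|Z w - mu|)%R].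
  have : measurable_fun setT (fun w => `|Z w - mu|).
    by apply: measurableT_comp => //; exact: measurable_funB.
  move=> /(_ measurableT _ (measurable_itv `[lam, +oo[)); rewrite setTI.
  by congr measurable; apply/seteqP; split => w /=; rewrite in_itv/= andbT.
apply: le_trans varZ; rewrite -integral_cst//.
apply: (@le_trans _ _ (\int[P]_(w in [set w | (lam <= `|Z w - mu|)%R]) ((Z w - mu) ^+ 2)%:E)%E).
  apply: ge0_le_integral => //.
  - by move=> w _; rewrite lee_fin sqr_ge0.
  - exact: measurable_funTS.
  move=> w /= lw; rewrite lee_fin -[leRHS]real_normK ?num_real//.
  by rewrite ler_sqr ?nnegrE// ltW.
by apply: ge0_subset_integral => // w _; rewrite lee_fin sqr_ge0.
Qed.

End mixing.

(** * Asymptotics of the moments *)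

Section near_critical_powers.
Context {R : realType}.
Variables (u : nat -> R) (a : R).
Hypothesis ua : forall e : R, 0 < e ->
  \forall n \near \oo, `|u n - (1 + a * n%:R^-1)| <= e * n%:R^-1.

Lemma near_critical_scaled : n%:R * (u n - 1) @[n --> \oo] --> a.
Proof.
apply/cvgrPdist_le => e e0; near=> n.
have n0 : 0 < n%:R :> R by near: n; exact: nbhs_infty_gtr.
have : `|u n - (1 + a * n%:R^-1)| <= e * n%:R^-1 by near: n; exact: ua.
rewrite ler_pdivlMr// => h.
rewrite distrC (_ : n%:R * (u n - 1) - a = (u n - (1 + a * n%:R^-1)) * n%:R).
  by rewrite normrM (gtr0_norm n0).
by field; rewrite gt_eqF.
Unshelve. all: by end_near. Qed.

Lemma near_critical_cvg1 : u n @[n --> \oo] --> (1 : R).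
Proof.
have h : n%:R^-1 * (n%:R * (u n - 1)) + 1 @[n --> \oo] --> 0 * a + 1.
  apply: cvgD; last exact: cvg_cst.
  apply: cvgM; last exact: near_critical_scaled.
  rewrite gtr0_cvgV0; first exact: cvgr_idn.
  near=> n; near: n; exact: nbhs_infty_gtr.
rewrite mul0r add0r in h; apply: cvg_trans h; apply: near_eq_cvg; near=> n.
by rewrite mulKf ?subrK// gt_eqF//; near: n; exact: nbhs_infty_gtr.
Unshelve. all: by end_near. Qed.

(** Squeezed by (u - 1)/u <= ln u <= u - 1. *)
Lemma near_critical_log : n%:R * ln (u n) @[n --> \oo] --> a.
Proof.
have lower : n%:R * (u n - 1) / u n @[n --> \oo] --> a.
  rewrite -[X in _ --> X]divr1; apply: cvgM; first exact: near_critical_scaled.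
  by apply: cvgV; [exact: oner_neq0|exact: near_critical_cvg1].
apply: (squeeze_cvgr _ lower near_critical_scaled); near=> n.
have n0 : 0 < n%:R :> R by near: n; exact: nbhs_infty_gtr.
have u0 : 0 < u n by near: n; exact: (cvgr_gt _ near_critical_cvg1).
have ln_le (x : R) : 0 < x -> ln x <= x - 1.
  by move=> x0; have := @le_ln1Dx R (x - 1); rewrite [1 + _]addrC subrK; apply; rewrite ltrBrDl subrr.
apply/andP; split; last by rewrite ler_pM2l// ln_le.
rewrite -mulrA ler_pM2l//; have := ln_le (u n)^-1; rewrite invr_gt0 => /(_ u0).
rewrite lnV ?posrE// mulrBl divff ?gt_eqF// mul1r; lra.
Unshelve. all: by end_near. Qed.

(** [u n ^+ k] is the exponential of (n ln u_n)(k/n), so for k <= S n the exponent is off by at most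
    S |n ln u_n - a|, whatever [k]. *)
Lemma near_critical_powers (S e : R) : 0 < S -> 0 < e ->
  \forall n \near \oo, 0 < u n /\ forall k : nat, k%:R <= S * n%:R ->
    `|u n ^+ k - expR (a * (k%:R / n%:R))| <= e /\
    `|(u n ^+ k)^-1 - expR (- (a * (k%:R / n%:R)))| <= e.
Proof.
move=> S0 e0.
pose B := expR (`|a| * S); have B0 : 0 < B by exact: expR_gt0.
have eB : 0 < e / B by rewrite divr_gt0.
have L0 : 0 < ln (1 + e / B) / S by rewrite divr_gt0// ln_gt0// ltrDl.
near=> n.
have n0 : 0 < n%:R :> R by near: n; exact: nbhs_infty_gtr.
have u0 : 0 < u n by near: n; exact: (cvgr_gt _ near_critical_cvg1).
have hl : `|a - n%:R * ln (u n)| <= ln (1 + e / B) / S.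
  by near: n; move/cvgrPdist_le : near_critical_log; exact.
split => // k kS.
have kn : k%:R / n%:R <= S by rewrite ler_pdivrMr.
have kn0 : 0 <= k%:R / n%:R :> R by exact: divr_ge0.
have uk : u n ^+ k = expR (n%:R * ln (u n) * (k%:R / n%:R)).
  rewrite -[in LHS](lnK u0) -expRM_natl; congr expR.
  by field; rewrite gt_eqF.
pose th := (n%:R * ln (u n) - a) * (k%:R / n%:R).
have hth : `|th| <= ln (1 + e / B).
  rewrite normrM distrC (ger0_norm kn0).
  apply: (@le_trans _ _ (ln (1 + e / B) / S * S)); last by rewrite divfK ?gt_eqF.
  by apply: ler_pM.
have close y t : `|y| <= `|a| * S -> `|t| <= ln (1 + e / B) -> `|expR (y + t) - expR y| <= e.
  move=> yS tS; rewrite expRD -{2}[expR y]mulr1 -mulrBr normrM ger0_norm ?expR_ge0//.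
  apply: (@le_trans _ _ (B * (e / B))); last by rewrite mulrC divfK ?gt_eqF.
  apply: ler_pM; rewrite ?expR_ge0//; last exact: abs_expRB1 (ltW eB) tS.
  by rewrite ler_expR (le_trans (ler_norm _)).
have akS : `|a * (k%:R / n%:R)| <= `|a| * S by rewrite normrM (ger0_norm kn0) ler_wpM2l.
split.
  have := close _ _ akS hth; rewrite uk; congr (`|expR _ - _| <= _).
  by rewrite /th; ring.
rewrite -normrN in akS; rewrite -normrN in hth.
have := close _ _ akS hth; rewrite uk -expRN; congr (`|expR _ - _| <= _).
by rewrite /th; ring.
Unshelve. all: by end_near. Qed.

End near_critical_powers.

(** * Means of the process and the orders of the two variance bounds *)

Section mean_recursion.
Context {R : realType}.

(** The recursion satisfied by the mean of X_k, with [u] the offspring mean and [e] the immigration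
    means. *)
Fixpoint mean_rec (u : R) (e : nat -> R) (k : nat) : R :=
  if k is k'.+1 then u * mean_rec u e k' + e k else 0.

Lemma mean_recE (u : R) e k : u != 0 ->
  mean_rec u e k = u ^+ k * \sum_(1 <= i < k.+1) (u ^+ i)^-1 * e i.
Proof.
move=> u0; elim: k => [|k IH]; first by rewrite big_nil mulr0.
rewrite /= IH [in RHS]big_nat_recr// [RHS]mulrDr mulrA -exprS; congr (_ + _).
by rewrite mulrA divff ?mul1r// expf_neq0.
Qed.

Variables (rho rhob a : R) (f g u b : nat -> R) (e v : nat -> nat -> R).
Hypotheses (rho0 : 0 <= rho) (rhob0 : 0 <= rhob).
Hypotheses (rf : ratio_regular rho f) (rg : ratio_regular rhob g).
Hypotheses (ef : row_close f e) (vg : row_close g v).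
Hypothesis e0 : forall n k, (0 < n)%N -> (0 < k)%N -> 0 <= e n k.
Hypothesis v0 : forall n k, (0 < n)%N -> (0 < k)%N -> 0 <= v n k.
Hypothesis b0 : forall n, 0 <= b n.
Hypothesis ua : forall e : R, 0 < e ->
  \forall n \near \oo, `|u n - (1 + a * n%:R^-1)| <= e * n%:R^-1.
Hypothesis bf : forall e : R, 0 < e -> \forall n \near \oo, b n <= e * f n.
Hypothesis gf : forall e : R, 0 < e ->
  \forall n \near \oo, g n <= e * (n%:R * f n ^+ 2).

Let q n k := (u n ^+ k)^-1.

Lemma weight_cvg (S e1 : R) : 0 < e1 -> \forall n \near \oo, forall k : nat,
  k%:R <= S * n%:R -> `|q n k - expR (- (a * (k%:R / n%:R)))| <= e1.
Proof.
move=> e10; have S0 : 0 < Num.max S 1 by rewrite lt_max ltr01 orbT.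
near=> n => k kS.
have : 0 < u n /\ forall k : nat, k%:R <= Num.max S 1 * n%:R ->
    `|u n ^+ k - expR (a * (k%:R / n%:R))| <= e1 /\
    `|(u n ^+ k)^-1 - expR (- (a * (k%:R / n%:R)))| <= e1.
  by near: n; exact: near_critical_powers.
move=> [_ /(_ k)[]//]; apply: (le_trans kS).
by rewrite ler_wpM2r// le_max lexx.
Unshelve. all: by end_near. Qed.

Lemma weight_bound (S : R) : 0 < S -> exists2 Q, 0 < Q &
  \forall n \near \oo, 0 < u n /\ forall k : nat, k%:R <= S * n%:R ->
    [/\ 0 < q n k, q n k <= Q & u n ^+ k <= Q].
Proof.
move=> S0; exists (expR (`|a| * S) + 1); first by rewrite ltr_wpDl// expR_ge0.
near=> n.
have n0 : 0 < n%:R :> R by near: n; exact: nbhs_infty_gtr.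
have [u0 H] : 0 < u n /\ forall k : nat, k%:R <= S * n%:R ->
    `|u n ^+ k - expR (a * (k%:R / n%:R))| <= 1 /\
    `|(u n ^+ k)^-1 - expR (- (a * (k%:R / n%:R)))| <= 1.
  by near: n; exact: near_critical_powers.
split => // k kS; have [h1 h2] := H k kS.
have akS : `|a * (k%:R / n%:R)| <= `|a| * S.
  by rewrite normrM (ger0_norm (divr_ge0 _ _))// ler_wpM2l// ler_pdivrMr.
have hB y : `|y| <= `|a| * S -> expR y <= expR (`|a| * S).
  by move=> yS; rewrite ler_expR (le_trans (ler_norm _)).
have b1 := hB _ akS; have b2 : expR (- (a * (k%:R / n%:R))) <= expR (`|a| * S).
  by apply: hB; rewrite normrN.
split; first by rewrite invr_gt0 exprn_gt0.
  by move: h2; rewrite /q ler_norml => /andP[_]; lra.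
by move: h1; rewrite ler_norml => /andP[_]; lra.
Unshelve. all: by end_near. Qed.

(** The diagonal part is O(n g(n)), which [gf] makes o((n f(n))^2). The mixing part is O(n f(n)^2),
    smaller than the target by a factor of order 1/n. *)
Lemma variance_bound (S Psi e1 : R) : 0 < S -> 0 <= Psi -> 0 < e1 ->
  \forall n \near \oo, forall K : nat, K%:R <= S * n%:R ->
    \sum_(1 <= i < K.+1) q n i ^+ 2 * v n i +
      2 * Psi * \sum_(1 <= i < K.+1) (q n i * e n i) ^+ 2 <= e1 * (n%:R * f n) ^+ 2.
Proof.
move=> S0 Psi0 e10.
have [Q Q0 HQ] := weight_bound S0.
have [C1 C10 HC1] := array_sum_le rhob0 rg vg S0.
have [C2 C20 HC2] := array_sum_sqr_le rho0 rf ef S0.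
have e2 : 0 < e1 / (2 * Q ^+ 2 * C1) by rewrite divr_gt0// !mulr_gt0// exprn_gt0.
near=> n => K KS.
have n0 : (0 < n)%N by near: n; exists 1%N.
have n0R : 0 < n%:R :> R by rewrite ltr0n.
have fn0 : 0 < f n by exact: rf.1.
have [u0 Hq] : 0 < u n /\ forall k : nat, k%:R <= S * n%:R ->
    [/\ 0 < q n k, q n k <= Q & u n ^+ k <= Q] by near: n.
have h1 : \sum_(1 <= k < K.+1) v n k <= C1 * (n%:R * g n).
  by move: (K) KS; near: n.
have h2 : \sum_(1 <= k < K.+1) e n k ^+ 2 <= C2 * (n%:R * f n ^+ 2).
  by move: (K) KS; near: n.
have h3 : g n <= e1 / (2 * Q ^+ 2 * C1) * (n%:R * f n ^+ 2) by near: n; exact: gf.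
have h4 : 4 * Psi * Q ^+ 2 * C2 / e1 <= n%:R by near: n; exact: nbhs_infty_ger.
have Q20 : 0 < Q ^+ 2 by rewrite exprn_gt0.
have qQ k : (k <= K)%N -> 0 <= q n k ^+ 2 <= Q ^+ 2.
  move=> kK; have kS : k%:R <= S * n%:R by rewrite (le_trans _ KS)// ler_nat.
  have [q0 qQ _] := Hq k kS.
  by rewrite sqr_ge0/= ler_sqr ?nnegrE// ltW.
have s1 : \sum_(1 <= i < K.+1) q n i ^+ 2 * v n i <= Q ^+ 2 * (C1 * (n%:R * g n)).
  apply: (@le_trans _ _ (Q ^+ 2 * \sum_(1 <= k < K.+1) v n k)); last by rewrite ler_pM2l.
  rewrite mulr_sumr big_seq [leRHS]big_seq; apply: ler_sum => k.
  rewrite mem_index_iota ltnS => /andP[k0 /qQ/andP[_ qk]].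
  by rewrite ler_wpM2r// v0.
have s2 : \sum_(1 <= i < K.+1) (q n i * e n i) ^+ 2 <= Q ^+ 2 * (C2 * (n%:R * f n ^+ 2)).
  apply: (@le_trans _ _ (Q ^+ 2 * \sum_(1 <= k < K.+1) e n k ^+ 2)); last by rewrite ler_pM2l.
  rewrite mulr_sumr big_seq [leRHS]big_seq; apply: ler_sum => k.
  rewrite mem_index_iota ltnS => /andP[k0 /qQ/andP[_ qk]].
  by rewrite exprMn ler_wpM2r// sqr_ge0.
have s3 : Q ^+ 2 * (C1 * (n%:R * g n)) <= e1 / 2 * (n%:R * f n) ^+ 2.
  apply: (@le_trans _ _ (Q ^+ 2 * (C1 * (n%:R * (e1 / (2 * Q ^+ 2 * C1) * (n%:R * f n ^+ 2)))))).
    by rewrite ler_pM2l// ler_pM2l// ler_pM2l.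
  by rewrite le_eqVlt; apply/orP; left; apply/eqP; field; rewrite !gt_eqF.
have s4 : 2 * Psi * (Q ^+ 2 * (C2 * (n%:R * f n ^+ 2))) <= e1 / 2 * (n%:R * f n) ^+ 2.
  rewrite ler_pdivrMr// in h4.
  rewrite (_ : 2 * Psi * _ = (4 * Psi * Q ^+ 2 * C2) * (n%:R * f n ^+ 2 / 2)); last by field.
  rewrite (_ : e1 / 2 * _ = (n%:R * e1) * (n%:R * f n ^+ 2 / 2)); last by field.
  by rewrite ler_wpM2r// divr_ge0// mulr_ge0// sqr_ge0.
have s5 : 2 * Psi * \sum_(1 <= i < K.+1) (q n i * e n i) ^+ 2 <=
    2 * Psi * (Q ^+ 2 * (C2 * (n%:R * f n ^+ 2))) by rewrite ler_wpM2l// mulr_ge0.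
by move: s1 s3 s4 s5; lra.
Unshelve. all: by end_near. Qed.

(** There are at most S n terms, each O(b(n) n f(n)) because the means are O(n f(n)); [bf] makes the
    total o((n f(n))^2). *)
Lemma offspring_bound (S e1 : R) : 0 < S -> 0 < e1 ->
  \forall n \near \oo, forall K : nat, K%:R <= S * n%:R ->
    \sum_(0 <= k < K) q n k.+1 ^+ 2 * b n * mean_rec (u n) (e n) k <=
      e1 * (n%:R * f n) ^+ 2.
Proof.
move=> S0 e10.
have [Q Q0 HQ] := weight_bound S0.
have [C C0 HC] := array_sum_le rho0 rf ef S0.
(* Two factors [Q] come from the squared weight, one from [u n ^+ k] and one from the weights inside
   [mean_recE]. *)
have e2 : 0 < e1 / (S * Q ^+ 4 * C) by rewrite divr_gt0// !mulr_gt0// exprn_gt0.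
near=> n => K KS.
have n0 : (0 < n)%N by near: n; exists 1%N.
have n0R : 0 < n%:R :> R by rewrite ltr0n.
have fn0 : 0 < f n by exact: rf.1.
have [u0 Hq] : 0 < u n /\ forall k : nat, k%:R <= S * n%:R ->
    [/\ 0 < q n k, q n k <= Q & u n ^+ k <= Q] by near: n.
have HCn : forall k : nat, k%:R <= S * n%:R ->
    \sum_(1 <= k < k.+1) e n k <= C * (n%:R * f n) by near: n.
have hb : b n <= e1 / (S * Q ^+ 4 * C) * f n by near: n; exact: bf.
have m_le k : (k <= K)%N -> 0 <= mean_rec (u n) (e n) k <= Q ^+ 2 * (C * (n%:R * f n)).
  move=> kK; have kS : k%:R <= S * n%:R by rewrite (le_trans _ KS)// ler_nat.
  have [_ _ ukQ] := Hq k kS.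
  rewrite mean_recE ?gt_eqF//; apply/andP; split.
    rewrite mulr_ge0 ?exprn_ge0 ?(ltW u0)// big_seq sumr_ge0// => i.
    rewrite mem_index_iota => /andP[i0 _].
    by rewrite mulr_ge0 ?e0// invr_ge0 exprn_ge0// ltW.
  rewrite expr2 -mulrA; apply: ler_pM => //; first by rewrite exprn_ge0// ltW.
    rewrite big_seq sumr_ge0// => i; rewrite mem_index_iota => /andP[i0 _].
    by rewrite mulr_ge0 ?e0// invr_ge0 exprn_ge0// ltW.
  apply: (@le_trans _ _ (Q * \sum_(1 <= i < k.+1) e n i)); last by rewrite ler_pM2l// HCn.
  rewrite mulr_sumr big_seq [leRHS]big_seq; apply: ler_sum => i.
  rewrite mem_index_iota ltnS => /andP[i0 ik].
  have iS : i%:R <= S * n%:R by rewrite (le_trans _ kS)// ler_nat.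
  have [_ qQ _] := Hq i iS.
  by rewrite ler_wpM2r ?e0.
apply: (@le_trans _ _ (\sum_(0 <= k < K)
   (Q ^+ 2 * (e1 / (S * Q ^+ 4 * C) * f n) * (Q ^+ 2 * (C * (n%:R * f n)))))).
  rewrite big_seq [leRHS]big_seq; apply: ler_sum => k.
  rewrite mem_index_iota => /andP[_ kK]; have /andP[m0 mQ] := m_le k (ltnW kK).
  have kS : k.+1%:R <= S * n%:R by rewrite (le_trans _ KS)// ler_nat.
  have [q0 qQ _] := Hq k.+1 kS.
  apply: ler_pM => //; first by rewrite mulr_ge0 ?sqr_ge0.
  by apply: ler_pM; rewrite ?sqr_ge0// ler_sqr ?nnegrE// ltW.
rewrite sumr_const_nat subn0 -[leLHS]mulr_natl.
rewrite (_ : Q ^+ 2 * _ * _ = e1 / S * (n%:R * f n ^+ 2)); last first.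
  by field; rewrite !gt_eqF.
apply: (@le_trans _ _ (S * n%:R * (e1 / S * (n%:R * f n ^+ 2)))).
  apply: ler_wpM2r => //; apply: mulr_ge0; first by apply/ltW/divr_gt0.
  by rewrite mulr_ge0// sqr_ge0.
by rewrite le_eqVlt; apply/orP; left; apply/eqP; field; rewrite gt_eqF.
Unshelve. all: by end_near. Qed.

End mean_recursion.

(** * The limit profile *)

Section limit_profile.
Context {R : realType}.
Variables (rho a : R).
Hypothesis rho0 : 0 <= rho.
Notation G := (primitive (mean_density rho a)).

Lemma mu_fun_primitive (t : R) : mu_fun rho a t = expR (a * t) * G t.
Proof.
rewrite /primitive -RintegralZl//; last exact: integrable_mean_density.
apply: eq_Rintegral => u _.
by rewrite /mean_density mulrCA -expRD mulrBr.
Qed.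

Lemma primitive_mean_density_lip (S s t : R) : 0 <= s -> s <= t -> t <= S ->
  `|G t - G s| <= S `^ rho * expR (`|a| * S) * (t - s).
Proof.
move=> s0 st tS.
have := @primitive_increment _ (mean_density rho a) s t 0 (S `^ rho * expR (`|a| * S)).
rewrite mul0r subr0; apply => //; first exact: integrable_mean_density.
move=> u /andP[su ut]; rewrite subr0; apply: mean_density_le => //.
by rewrite (le_trans s0)// (le_trans ut).
Qed.

Lemma primitive_mean_density_ge0 (t : R) : 0 <= G t.
Proof. by apply: Rintegral_ge0 => u _; exact: mean_density_ge0. Qed.

(** Makes the division by mu(1) legitimate. On [1/2, 1], away from a possible zero of the density at
    0, its values lie in [lo, hi]; the midpoint and half-width of this range give an increment of at
    least lo/2. *)
Lemma primitive_mean_density_gt0 : 0 < G 1.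
Proof.
pose lo := (1 / 2) `^ rho * expR (- `|a|).
pose hi := 1 `^ rho * expR (`|a| * 1).
have lo0 : 0 < lo by rewrite mulr_gt0 ?expR_gt0// powR_gt0.
have := @primitive_increment _ (mean_density rho a) (1 / 2) 1 ((lo + hi) / 2) ((hi - lo) / 2).
have h u : 1 / 2 <= u <= 1 -> lo <= mean_density rho a u <= hi.
  move=> /andP[u1 u2]; have u0 : 0 <= u by lra.
  apply/andP; split; last first.
    by rewrite (le_trans (ler_norm _))// mean_density_le// u0.
  apply: ler_pM; rewrite ?powR_ge0 ?expR_ge0//.
    by apply: powR_le_bound => //; apply/andP; split => //; lra.
  rewrite ler_expR lerN2 (le_trans (ler_norm _))// normrM (ger0_norm u0).
  by rewrite ler_piMr.
move=> /(_ (integrable_mean_density _ rho0 _)) H.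
have {}H : `|G 1 - G (1 / 2) - (lo + hi) / 2 * (1 - 1 / 2)| <= (hi - lo) / 2 * (1 - 1 / 2).
  apply: H => [||u /h /andP[h1 h2]]; [lra|lra|].
  by rewrite ler_norml; apply/andP; split; lra.
have := primitive_mean_density_ge0 (1 / 2).
move: H; rewrite ler_norml => /andP[]; lra.
Qed.

End limit_profile.

(** * Exceptional sets and deterministic comparison of paths *)

Section union_bound.
Context {d : measure_display} {T : measurableType d} {R : realType}.
Variable P : probability T R.

Lemma finite_union_bound (B : nat -> set T) (h : R) (L : nat) :
  (forall j, (j < L)%N -> measurable (B j) /\ (P (B j) <= h%:E)%E) ->
  exists E, [/\ measurable E, (P E <= (L%:R * h)%:E)%E &
    forall j, (j < L)%N -> B j `<=` E].
Proof.
elim: L => [_|L IH BL].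
  by exists set0; split => //; rewrite measure0 mul0r.
have [j jL|E [mE PE BE]] := IH; first by apply: BL; exact: ltnW.
have [mB PB] := BL L (ltnSn L).
exists (E `|` B L); split; first exact: measurableU.
  apply: (le_trans (measureU2 _ mE mB)).
  by rewrite -natr1 mulrDl mul1r EFinD leeD.
by move=> j; rewrite ltnS leq_eqVlt => /predU1P[->|/BE BjE] w Bw; [right|left; exact: BjE].
Qed.

Lemma prob_le_of_sqr (B : set T) (lam V h : R) : measurable B -> 0 < lam ->
  ((lam ^+ 2)%:E * P B <= V%:E)%E -> V <= h * lam ^+ 2 -> (P B <= h%:E)%E.
Proof.
move=> mB lam0 PB Vh; have PE : P B = (fine (P B))%:E by rewrite fineK// fin_num_measure.
move: PB; rewrite PE -EFinM !lee_fin => PB.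
have l2 : 0 < lam ^+ 2 by rewrite exprn_gt0.
by rewrite -(ler_pM2l l2) (le_trans PB)// mulrC.
Qed.

End union_bound.

Lemma littleo_le {R : realType} (f g : nat -> R) : f =o_\oo g ->
  forall e : R, 0 < e -> \forall n \near \oo, `|f n| <= e * `|g n|.
Proof. by move=> /eqoP H e e0; exact: H. Qed.

(** Exchanges the normalisation s_n for A(n): [y] is X/s_n, [D] is A(n)/s_n and [m1] is mu(1). The
    condition on [e] keeps [D] at least m1/2. *)
Lemma ratio_close {R : realType} (y D z m1 e C Z : R) : 0 < m1 -> e <= m1 / 2 ->
  `|D - m1| <= e -> `|y - z| <= C * e -> `|z| <= Z ->
  `|y / D - z / m1| <= (2 * C / m1 + 2 * Z / m1 ^+ 2) * e.
Proof.
move=> m0 em hD hy hz.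
have e0 : 0 <= e by exact: le_trans hD.
have D2 : m1 / 2 <= D by move: hD; rewrite ler_norml => /andP[]; lra.
have D0 : 0 < D by lra.
have DV : D^-1 <= 2 / m1.
  by rewrite -[leRHS]invrK lef_pV2 ?posrE ?invr_gt0 ?divr_gt0// invf_div.
have -> : y / D - z / m1 = (y - z) / D + z * (m1 - D) / m1 / D.
  by field; rewrite !gt_eqF.
have V0 : 0 <= D^-1 by rewrite invr_ge0 ltW.
rewrite [leRHS]mulrDl; apply: (le_trans (ler_normD _ _)); apply: lerD.
  rewrite normrM (ger0_norm V0) (_ : 2 * C / m1 * e = C * e * (2 / m1)); last by ring.
  by apply: ler_pM.
rewrite !normrM (ger0_norm V0) normfV (gtr0_norm m0) distrC.
rewrite (_ : 2 * Z / m1 ^+ 2 * e = Z * e / m1 * (2 / m1)); last by field; rewrite gt_eqF.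
apply: ler_pM => //; first by rewrite divr_ge0// ?(ltW m0)// mulr_ge0.
by rewrite ler_pM2r ?invr_gt0// ler_pM.
Qed.

Lemma truncn_scale_close {R : realType} (n : nat) (t : R) : (0 < n)%N -> 0 <= t ->
  `|(Num.truncn (n%:R * t))%:R / n%:R - t| <= n%:R^-1.
Proof.
move=> n0 t0; have n0R : 0 < n%:R :> R by rewrite ltr0n.
have /andP[kt tk] := truncn_itv (mulr_ge0 (ler0n R n) t0).
set k := Num.truncn _ in kt tk *.
have x1 : k%:R / n%:R <= t by rewrite ler_pdivrMr// mulrC.
have x2 : t <= k%:R / n%:R + n%:R^-1.
  by rewrite -{2}[n%:R^-1]mul1r -mulrDl ler_pdivlMr// mulrC natr1 ltW.
by rewrite ler_norml; apply/andP; split; lra.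
Qed.

(* The last grid point (L + 1) S / L lies beyond S, whence the range 2 S. *)
Lemma monotone_grid_close {R : realType} (n L : nat) (s S delta B : R)
    (N Z M : nat -> R) (G : R -> R) :
  0 < s -> 0 < S -> (0 < L)%N ->
  (forall k : nat, k%:R <= 2 * S * n%:R -> `|N k| <= delta * s) ->
  (forall i j, (i <= j)%N -> Z i <= Z j) ->
  (forall j, (j < L.+2)%N ->
    `|Z (Num.truncn (n%:R * (j%:R * (S / L%:R)))) - M j| <= delta * s) ->
  (forall j, (j < L.+2)%N -> `|M j / s - G (j%:R * (S / L%:R))| <= delta) ->
  (forall x y, 0 <= x -> x <= y -> y <= 2 * S -> `|G y - G x| <= B * (y - x)) ->
  0 <= B -> B * (S / L%:R) <= delta ->
  forall t, 0 <= t <= S ->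
  `|(N (Num.truncn (n%:R * t)) + Z (Num.truncn (n%:R * t))) / s - G t| <= 4 * delta.
Proof.
move=> s0 S0 L0 hN Zmono hZ hM hG B0 hL t /andP[t0 tS].
have L0R : 0 < L%:R :> R by rewrite ltr0n.
have L1R : 1 <= L%:R :> R by rewrite ler1n.
pose w := S / L%:R; have w0 : 0 < w by exact: divr_gt0.
have wS : w <= S by rewrite ler_pdivrMr// ler_peMr// ltW.
have Lw : L%:R * w = S by rewrite /w mulrC divfK// gt_eqF.
have [j [jL jt tj]] : exists j : nat,
    [/\ (j <= L)%N, j%:R * w <= t & t < j.+1%:R * w].
  exists (Num.truncn (t / w)).
  have /andP[jt tj] : (Num.truncn (t / w))%:R <= t / w < (Num.truncn (t / w)).+1%:R.
    by rewrite truncn_itv// divr_ge0// ltW.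
  rewrite ler_pdivlMr// in jt; rewrite ltr_pdivrMr// in tj; split => //.
  by rewrite -(ler_nat R) -(ler_pM2r w0) Lw (le_trans jt).
pose k := Num.truncn (n%:R * t).
have kn : k%:R <= n%:R * t by have /andP[] := truncn_itv (mulr_ge0 (ler0n R n) t0).
have hNk : `|N k| <= delta * s.
  apply: hN; apply: (le_trans kn); rewrite mulrC ler_wpM2r//; lra.
have trunc_mono (x y : R) : x <= y -> Z (Num.truncn (n%:R * x)) <= Z (Num.truncn (n%:R * y)).
  by move=> xy; apply: Zmono; apply: le_truncn; rewrite ler_wpM2l.
(* [Z] at [t] lies between its values at the two neighbouring grid points. The four errors [delta]
   come from [N], from [Z] against [M], from [M / s] against [G], and from the oscillation of [G]
   over one cell. *)
have Z1 := trunc_mono _ _ jt; have Z2 := trunc_mono _ _ (ltW tj).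
have jL2 : (j.+1 < L.+2)%N by rewrite !ltnS.
have jL1 : (j < L.+2)%N by exact: ltnW.
have dw : j.+1%:R * w = j%:R * w + w by rewrite -natr1 mulrDl mul1r.
have jw0 : 0 <= j%:R * w by rewrite mulr_ge0// ltW.
have g1 : `|G t - G (j%:R * w)| <= delta.
  apply: (le_trans (hG _ _ jw0 jt _)); first lra.
  apply: le_trans hL; rewrite ler_wpM2l// -/w; lra.
have g2 : `|G (j.+1%:R * w) - G t| <= delta.
  apply: (le_trans (hG _ _ t0 (ltW tj) _)); first lra.
  apply: le_trans hL; rewrite ler_wpM2l// -/w; lra.
have := hM _ jL1; have := hM _ jL2; have := hZ _ jL1; have := hZ _ jL2.
rewrite -/w => z2 z1 m2 m1.
have div_le (x y c : R) : `|x - y| <= c * s -> `|x / s - y / s| <= c.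
  by move=> h; rewrite -mulrBl normrM normfV (gtr0_norm s0) ler_pdivrMr.
have {}z1 := div_le _ _ _ z1; have {}z2 := div_le _ _ _ z2.
have {}hNk : `|N k / s - 0 / s| <= delta by apply: div_le; rewrite subr0.
have {}Z1 : Z (Num.truncn (n%:R * (j%:R * w))) / s <= Z k / s by rewrite ler_pM2r// invr_gt0.
have {}Z2 : Z k / s <= Z (Num.truncn (n%:R * (j.+1%:R * w))) / s by rewrite ler_pM2r// invr_gt0.
rewrite mul0r in hNk; rewrite mulrDl -/k.
move: g1 g2 m1 m2 z1 z2 hNk; rewrite !ler_norml.
move=> /andP[? ?] /andP[? ?] /andP[? ?] /andP[? ?] /andP[? ?] /andP[? ?] /andP[? ?].
by apply/andP; split; lra.
Qed.

Lemma near_finite_forall (Q : nat -> nat -> Prop) (m : nat) :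
  (forall j, (j < m)%N -> \forall n \near \oo, Q j n) ->
  \forall n \near \oo, forall j, (j < m)%N -> Q j n.
Proof.
elim: m => [_|m IH H]; first by near=> n.
have Hm := H m (ltnSn m).
have {}IH : \forall n \near \oo, forall j, (j < m)%N -> Q j n.
  by apply: IH => j jm; apply: H; exact: ltnW.
near=> n => j; rewrite ltnS leq_eqVlt => /predU1P[->|]; first by near: n.
by move: j; near: n.
Unshelve. all: by end_near. Qed.

(** * The functional limit theorem *)

Section functional_limit.
Context {d : measure_display} {T : measurableType d} {R : realType}.
Variable P : probability T R.
Variables (xi : nat -> nat -> nat -> {RV P >-> nat}) (eps : nat -> nat -> {RV P >-> nat}).
Variables (alpha beta : nat -> R) (ralpha rbeta a : R).
Hypothesis xi_indep : forall n, (0 < n)%N ->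
  mutually_independent P [set p : nat * nat | (0 < p.1)%N /\ (0 < p.2)%N]
    (fun p => xi n p.1 p.2).
Hypothesis xi_id : forall n, (0 < n)%N ->
  identically_distributed P [set p : nat * nat | (0 < p.1)%N /\ (0 < p.2)%N]
    (fun p => xi n p.1 p.2).
Hypothesis xi_eps_indep : forall n, (0 < n)%N ->
  independent_sigma P
    (sigma_generated [set p : nat * nat | (0 < p.1)%N /\ (0 < p.2)%N]
      (fun p => xi n p.1 p.2))
    (sigma_generated [set k : nat | (0 < k)%N] (fun k => eps n k)).
Hypothesis xi_moments : forall n, (0 < n)%N ->
  mean P (xi n 1%N 1%N) \is a fin_num /\ var P (xi n 1%N 1%N) \is a fin_num.
Hypothesis eps_moments : forall n k, (0 < n)%N -> (0 < k)%N ->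
  mean P (eps n k) \is a fin_num /\ var P (eps n k) \is a fin_num.
Hypothesis eps_mixing_sum :
  (ereal_sup [set \sum_(1 <= k <oo) mixing_coef P (fun i => eps n i) k
             | n in [set n : nat | (0 < n)%N]] < +oo)%E.
Hypotheses (ralpha_ge0 : 0 <= ralpha) (rbeta_ge0 : 0 <= rbeta).
Hypotheses (alpha_rv : regularly_varying ralpha alpha)
  (beta_rv : regularly_varying rbeta beta).
Hypothesis C1_alpha : forall s : R, 0 <= s ->
  (fun n : nat => \big[Num.max/0]_(1 <= k < (Num.truncn (n%:R * s)).+1)
     `|fine (mean P (eps n k)) - alpha k|) =o_\oo alpha.
Hypothesis C1_beta : forall s : R, 0 <= s ->
  (fun n : nat => \big[Num.max/0]_(1 <= k < (Num.truncn (n%:R * s)).+1)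
     `|fine (var P (eps n k)) - beta k|) =o_\oo beta.
Hypothesis C2 : (fun n : nat => fine (mean P (xi n 1%N 1%N)) - (1 + a * n%:R^-1))
  =o_\oo (fun n : nat => n%:R^-1 : R).
Hypothesis C3 : (fun n : nat => fine (var P (xi n 1%N 1%N))) =o_\oo alpha.
Hypothesis C4_beta : beta =o_\oo (fun n : nat => n%:R * alpha n ^+ 2).

Let xin n k j : T -> nat := xi n k j.
Let epsn n k : T -> nat := eps n k.
Let X n k w := branching (xin n) (epsn n) k w.
Let u n := fine (mean P (xi n 1%N 1%N)).
Let b n := fine (var P (xi n 1%N 1%N)).
Let e n k := fine (mean P (eps n k)).
Let v n k := fine (var P (eps n k)).
Let q n k := (u n ^+ k)^-1.
Let psi n r := fine (mixing_coef P (epsn n) r).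
Let Psi := fine (ereal_sup [set \sum_(1 <= k <oo) mixing_coef P (fun i => eps n i) k
             | n in [set n : nat | (0 < n)%N]])%E.
Let Z n k w : R := \sum_(1 <= i < k.+1) q n i * (epsn n i w)%:R.
Let s n := n%:R * alpha n.

Let mxi n k j : measurable_fun setT (xin n k j).
Proof. exact: measurable_funPT. Qed.

Let meps n k : measurable_fun setT (epsn n k).
Proof. exact: measurable_funPT. Qed.

Let mean_ge0 (Y : T -> nat) : 0 <= fine (mean P Y).
Proof. by apply: fine_ge0; rewrite /mean expectation_ge0. Qed.

Let var_ge0 (Y : T -> nat) : 0 <= fine (var P Y).
Proof. by apply: fine_ge0; rewrite /var variance_ge0. Qed.

Let xi_mean n : (0 < n)%N -> (\int[P]_w (xin n 1 1 w)%:R%:E = (u n)%:E)%E.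
Proof. by move=> n0; apply: integral_mean; have [] := xi_moments n0. Qed.

Let xi_sqr n : (0 < n)%N ->
  (\int[P]_w ((xin n 1 1 w)%:R ^+ 2)%:E = (b n + u n ^+ 2)%:E)%E.
Proof.
move=> n0; have [m_fin v_fin] := xi_moments n0.
by apply: integral_sqr => //; apply: measurable_fun_levels; exact: mxi.
Qed.

Let eps_mean n k : (0 < n)%N -> (0 < k)%N ->
  (\int[P]_w (epsn n k w)%:R%:E = (e n k)%:E)%E.
Proof. by move=> n0 k0; apply: integral_mean; have [] := eps_moments n0 k0. Qed.

Let eps_sqr n k : (0 < n)%N -> (0 < k)%N ->
  (\int[P]_w ((epsn n k w)%:R ^+ 2)%:E = (v n k + e n k ^+ 2)%:E)%E.
Proof.
move=> n0 k0; have [m_fin v_fin] := eps_moments n0 k0.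
by apply: integral_sqr => //; apply: measurable_fun_levels; exact: meps.
Qed.

Let X_mean n k : (0 < n)%N ->
  (\int[P]_w (X n k w)%:R%:E = (mean_rec (u n) (e n) k)%:E)%E.
Proof.
move=> n0; elim: k => [|k IH]; first by rewrite /X /= integral0.
have := branching_mean_step (@mxi n) (@meps n) (xi_indep n0) (xi_id n0)
  (xi_eps_indep n0) (xi_mean n0) (mean_ge0 _) k.
by rewrite -/(X n k) IH eps_mean// -EFinM -EFinD.
Qed.

Let A_mean n : (0 < n)%N -> fine (mean P (X n n)) = mean_rec (u n) (e n) n.
Proof. by move=> n0; rewrite /mean unlock X_mean. Qed.

Let mixing_series n : (0 < n)%N ->
  (\sum_(1 <= k <oo) mixing_coef P (epsn n) k <= Psi%:E)%E.
Proof.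
move=> n0; rewrite /Psi fineK.
  by apply: ereal_sup_ubound; exists n.
rewrite ge0_fin_numE//.
apply: (@le_trans _ _ (\sum_(1 <= k <oo) mixing_coef P (epsn n) k)%E).
  by apply: nneseries_ge0 => r _ _; apply: mixing_coef_ge0; exact: meps.
by apply: ereal_sup_ubound; exists n.
Qed.

Let mixing_partial n N : (0 < n)%N ->
  (\sum_(1 <= k < N) mixing_coef P (epsn n) k <= Psi%:E)%E.
Proof.
move=> n0; apply: (le_trans _ (mixing_series n0)); apply: nneseries_lim_ge => r _ _.
by apply: mixing_coef_ge0; exact: meps.
Qed.

Let mixing_psi n r : (0 < n)%N -> (0 < r)%N ->
  mixing_coef P (epsn n) r = (psi n r)%:E.
Proof.
move=> n0 r0; rewrite /psi fineK//.
have m0 k : (0 <= mixing_coef P (epsn n) k)%E by apply: mixing_coef_ge0; exact: meps.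
rewrite ge0_fin_numE//; apply: (@le_lt_trans _ _ Psi%:E); last exact: ltry.
apply: (le_trans _ (mixing_partial r.+1 n0)).
by rewrite big_nat_recr//= leeDr// sume_ge0.
Qed.

Let psi_ge0 n r : 0 <= psi n r.
Proof. by apply: fine_ge0; apply: mixing_coef_ge0; exact: meps. Qed.

Let psi_sum n N : (0 < n)%N -> \sum_(1 <= r < N) psi n r <= Psi.
Proof.
move=> n0; rewrite -lee_fin -sumEFin; apply: (le_trans _ (mixing_partial N n0)).
rewrite big_seq [leRHS]big_seq; apply: lee_sum => r; rewrite mem_index_iota => /andP[r0 _].
by rewrite mixing_psi.
Qed.

Let Psi_ge0 : 0 <= Psi.
Proof. by have := psi_sum 0 (ltn0Sn 0); rewrite big_nil. Qed.

Let close_row (f : nat -> R) (c : nat -> nat -> R) :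
  (forall n, (0 < n)%N -> 0 < f n) ->
  (forall s : R, 0 <= s ->
    (fun n : nat => \big[Num.max/0]_(1 <= k < (Num.truncn (n%:R * s)).+1)
       `|c n k - f k|) =o_\oo f) -> row_close f c.
Proof.
move=> f0 H S e1 e10.
have S0 : 0 <= Num.max S 0 by rewrite le_max lexx orbT.
have H' := littleo_le (H _ S0) e10.
near=> n => k k0 kS.
have n0 : (0 < n)%N by near: n; exists 1%N.
have : `|\big[Num.max/0]_(1 <= k < (Num.truncn (n%:R * Num.max S 0)).+1)
    `|c n k - f k| | <= e1 * `|f n| by near: n.
rewrite (gtr0_norm (f0 _ n0)); apply: le_trans.
apply: (le_trans _ (ler_norm _)).
apply: (@le_bigmax_seq _ _ _ _ _ k xpredT (fun k => `|c n k - f k|)) => //.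
rewrite mem_index_iota k0/= ltnS truncn_ge_nat ?mulr_ge0//.
by rewrite (le_trans kS)// mulrC ler_wpM2l// le_max lexx.
Unshelve. all: by end_near. Qed.

Let alpha_reg := regularly_varying_ratio ralpha_ge0 alpha_rv.
Let beta_reg := regularly_varying_ratio rbeta_ge0 beta_rv.
Let alpha_gt0 n : (0 < n)%N -> 0 < alpha n.
Proof. exact: alpha_rv.1. Qed.
Let beta_gt0 n : (0 < n)%N -> 0 < beta n.
Proof. exact: beta_rv.1. Qed.
Let alpha_close : row_close alpha e.
Proof. exact: close_row. Qed.
Let beta_close : row_close beta v.
Proof. exact: close_row. Qed.

Let u_near e1 : 0 < e1 ->
  \forall n \near \oo, `|u n - (1 + a * n%:R^-1)| <= e1 * n%:R^-1.
Proof.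
move=> e10; have H := littleo_le C2 e10; near=> n.
rewrite -[X in _ <= _ * X]ger0_norm ?invr_ge0//.
by near: n.
Unshelve. all: by end_near. Qed.

Let b_near e1 : 0 < e1 -> \forall n \near \oo, b n <= e1 * alpha n.
Proof.
move=> e10; have H := littleo_le C3 e10; near=> n.
have n0 : (0 < n)%N by near: n; exists 1%N.
rewrite -[X in _ <= _ * X]gtr0_norm ?alpha_gt0//; apply: (le_trans (ler_norm _)).
by near: n.
Unshelve. all: by end_near. Qed.

Let beta_near e1 : 0 < e1 ->
  \forall n \near \oo, beta n <= e1 * (n%:R * alpha n ^+ 2).
Proof.
move=> e10; have H := littleo_le C4_beta e10; near=> n.
have x0 : 0 <= n%:R * alpha n ^+ 2 by rewrite mulr_ge0// sqr_ge0.
have : `|beta n| <= e1 * `|n%:R * alpha n ^+ 2| by near: n.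
by rewrite (ger0_norm x0); apply: le_trans; exact: ler_norm.
Unshelve. all: by end_near. Qed.

Notation N n k w := (martingale (xin n) (epsn n) (u n) (q n) k w).

(** One bad event comes from Kolmogorov's inequality and one from Chebyshev's inequality at each
    grid point. Their number is fixed before [n], so single-time bounds tending to 0 suffice. *)
Let exceptional (S delta h : R) (L : nat) : 0 < S -> 0 < delta -> 0 < h -> (0 < L)%N ->
  \forall n \near \oo, exists E, [/\ measurable E, (P E <= h%:E)%E &
    forall w, ~ E w ->
      (forall k : nat, k%:R <= 2 * S * n%:R -> `|N n k w| <= delta * s n) /\
      (forall j, (j < L.+2)%N ->
        `|Z n (Num.truncn (n%:R * (j%:R * (S / L%:R)))) w -
          \sum_(1 <= i < (Num.truncn (n%:R * (j%:R * (S / L%:R)))).+1) q n i * e n i|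
        <= delta * s n)].
Proof.
move=> S0 delta0 h0 L0.
have L0R : 0 < L%:R :> R by rewrite ltr0n.
have L1R : 1 <= L%:R :> R by rewrite ler1n.
(* An equal share for the martingale event and the L + 2 grid points j = 0, ..., L + 1. *)
pose h1 := h / L.+3%:R; have h10 : 0 < h1 by rewrite divr_gt0// ltr0n.
have S20 : 0 < 2 * S by rewrite mulr_gt0.
have hd0 : 0 < h1 * delta ^+ 2 by rewrite mulr_gt0// exprn_gt0.
near=> n.
have n0 : (0 < n)%N by near: n; exists 1%N.
have n0R : 0 < n%:R :> R by rewrite ltr0n.
have s0 : 0 < s n by rewrite mulr_gt0// alpha_gt0.
have lam0 : 0 < delta * s n by rewrite mulr_gt0.
have u0 : 0 < u n by near: n; exact: (cvgr_gt _ (near_critical_cvg1 u_near)).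
have q0 i : 0 <= q n i by rewrite invr_ge0 exprn_ge0// ltW.
have Hv : forall K : nat, K%:R <= 2 * S * n%:R ->
    \sum_(1 <= i < K.+1) q n i ^+ 2 * v n i +
      2 * Psi * \sum_(1 <= i < K.+1) (q n i * e n i) ^+ 2 <= h1 * delta ^+ 2 * s n ^+ 2.
  near: n; apply: (variance_bound ralpha_ge0 rbeta_ge0 alpha_reg beta_reg
    alpha_close beta_close _ u_near beta_near) => // n k _ _; exact: var_ge0.
have Ho : forall K : nat, K%:R <= 2 * S * n%:R ->
    \sum_(0 <= k < K) q n k.+1 ^+ 2 * b n * mean_rec (u n) (e n) k <=
    h1 * delta ^+ 2 * s n ^+ 2.
  near: n; apply: (offspring_bound ralpha_ge0 alpha_reg alpha_close _ _ u_near b_near) => //.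
  - by move=> n k _ _; exact: mean_ge0.
  - by move=> n; exact: var_ge0.
pose K := Num.truncn (2 * S * n%:R).
have /andP[KS SK] : K%:R <= 2 * S * n%:R < K.+1%:R by rewrite truncn_itv// mulr_ge0// ltW.
pose k j := Num.truncn (n%:R * (j%:R * (S / L%:R))).
have kS j : (j < L.+2)%N -> (k j)%:R <= 2 * S * n%:R.
  move=> jL; have t0 : 0 <= n%:R * (j%:R * (S / L%:R)).
    by rewrite mulr_ge0// mulr_ge0// divr_ge0// ltW.
  have /andP[kt _] := truncn_itv t0; apply: (le_trans kt).
  rewrite mulrC ler_wpM2r// mulrA ler_pdivrMr// [2 * S]mulrC -mulrA mulrC ler_pM2l//.
  have : j%:R <= L.+1%:R :> R by rewrite ler_nat -ltnS.
  rewrite -natr1; lra.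
pose stay := [set w | forall i, (i <= K)%N -> `|N n i w| < delta * s n].
pose far j := [set w | delta * s n <= `|Z n (k j) w -
  \sum_(1 <= i < (k j).+1) q n i * e n i|].
pose B j := if j is j'.+1 then far j' else ~` stay.
have mstay : measurable stay.
  rewrite (_ : stay = \bigcap_(i in `I_K.+1) [set w | `|N n i w| < delta * s n]).
    apply: bigcap_measurable; first by exists 0%N.
    move=> i _; have : measurable_fun setT (fun w => `|N n i w|).
      by apply: measurableT_comp => //; apply: measurable_martingale; [exact: mxi|exact: meps].
    move=> /(_ measurableT _ (measurable_itv `]-oo, delta * s n[)); rewrite setTI.
    by congr measurable; apply/seteqP; split => w /=; rewrite in_itv.
  by apply/seteqP; split => w wk i /=; [rewrite ltnS|rewrite -ltnS] => /wk.
have mZ j : measurable_fun setT (Z n j).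
  apply: measurable_sum => i; apply: measurable_funM => //.
  by apply: (measurable_levels_fun (measurable_fun_levels (@meps n i))) => w w' ->.
have mfar j : measurable (far j).
  have : measurable_fun setT (fun w => `|Z n (k j) w -
      \sum_(1 <= i < (k j).+1) q n i * e n i|).
    by apply: measurableT_comp => //; exact: measurable_funB.
  move=> /(_ measurableT _ (measurable_itv `[delta * s n, +oo[)); rewrite setTI.
  by congr measurable; apply/seteqP; split => w /=; rewrite in_itv/= andbT.
have lamE : h1 * (delta * s n) ^+ 2 = h1 * delta ^+ 2 * s n ^+ 2.
  by rewrite exprMn mulrA.
have [j jL|E [mE PE BE]] := @finite_union_bound _ _ _ P B h1 L.+3.
  case: j jL => [_|j jL] /=.
    split; first exact: measurableC.
    apply: (prob_le_of_sqr (V := \sum_(0 <= k < K) q n k.+1 ^+ 2 * b n *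
      mean_rec (u n) (e n) k) _ lam0); [exact: measurableC| |by rewrite lamE; exact: Ho].
    have := kolmogorov_inequality (@mxi n) (@meps n) (xi_indep n0) (xi_id n0)
      (xi_eps_indep n0) (xi_mean n0) (xi_sqr n0) (var_ge0 _) (q n)
      (fun k => X_mean k n0) K lam0.
    apply: le_trans; rewrite leeDl//; apply: integral_ge0 => w _.
    by rewrite lee_fin sqr_ge0.
  split; first exact: mfar.
  apply: (prob_le_of_sqr (V := \sum_(1 <= i < (k j).+1) q n i ^+ 2 * v n i +
      2 * Psi * \sum_(1 <= i < (k j).+1) (q n i * e n i) ^+ 2) _ lam0).
  - exact: mfar.
  - apply: (mixing_chebyshev (@meps n) (psi := psi n)) => //.
    + by move=> r r0; rewrite mixing_psi.
    + by move=> m; exact: psi_sum.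
    + by move=> i i0; exact: eps_mean.
    + by move=> i i0; exact: eps_sqr.
  - by rewrite lamE; apply: Hv; exact: kS.
exists E; split => //.
  by apply: (le_trans PE); rewrite lee_fin /h1 mulrC divfK// gt_eqF// ltr0n.
move=> w nEw; split.
  move=> i iS; apply: ltW; have wstay : stay w.
    by apply: contrapT => nstay; apply: nEw; apply: (BE 0%N).
  by apply: wstay; rewrite truncn_ge_nat// mulr_ge0// ltW.
move=> j jL; apply/ltW; rewrite ltNge; apply/negP => wfar.
by apply: nEw; apply: (BE j.+1).
Unshelve. all: by end_near. Qed.

(** Since q_(k+1) u_n = q_k, the subtracted term u_n X_k in the increment of N telescopes. *)
Let X_decomp n k w : u n != 0 ->
  q n k * (X n k w)%:R = N n k w + Z n k w.
Proof.
move=> u0; elim: k => [|k IH]; first by rewrite /martingale /Z !big_nil mulr0 addr0.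
have -> : N n k.+1 w = N n k w +
    q n k.+1 * ((X n k.+1 w)%:R - (epsn n k.+1 w)%:R - u n * (X n k w)%:R).
  by rewrite /martingale big_nat_recr.
have -> : Z n k.+1 w = Z n k w + q n k.+1 * (epsn n k.+1 w)%:R.
  by rewrite /Z big_nat_recr.
rewrite addrACA -IH /q exprS.
have uk0 : u n ^+ k != 0 by rewrite expf_neq0.
by field; rewrite ?uk0 ?u0.
Qed.

Notation G := (primitive (mean_density ralpha a)).

Let grid_mean (t : R) : 0 <= t ->
  (\sum_(1 <= i < (Num.truncn (n%:R * t)).+1) q n i * e n i) / s n
    @[n --> \oo] --> G t.
Proof.
move=> t0.
have H := weighted_mean_limit ralpha_ge0 alpha_reg alpha_close
  (weight_cvg u_near) t0.
apply: cvg_trans H; apply: near_eq_cvg; near=> n.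
rewrite mulr_suml mulr_sumr; apply: eq_bigr => i _.
by rewrite /s [(n%:R * _)^-1]invfM; set z := (n%:R)^-1; set y := (alpha n)^-1; rewrite -/(q n i); ring.
Unshelve. all: by end_near. Qed.

(** By [mean_recE] this is the grid mean at t = 1 multiplied by [u n ^+ n], which tends to e^a. *)
Let total_mean : mean_rec (u n) (e n) n / s n @[n --> \oo] --> mu_fun ralpha a 1.
Proof.
have un : u n ^+ n @[n --> \oo] --> expR (a * 1).
  apply/cvgrPdist_le => e1 e10; near=> n.
  have n0 : n%:R != 0 :> R by rewrite gt_eqF//; near: n; exact: nbhs_infty_gtr.
  have [_ /(_ n)[]] : 0 < u n /\ forall k : nat, k%:R <= 1 * n%:R :> R ->
      `|u n ^+ k - expR (a * (k%:R / n%:R))| <= e1 /\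
      `|(u n ^+ k)^-1 - expR (- (a * (k%:R / n%:R)))| <= e1.
    by near: n; exact: (near_critical_powers u_near ltr01).
  - by rewrite mul1r.
  - by rewrite divff// distrC.
rewrite mu_fun_primitive//; have H : u n ^+ n * ((\sum_(1 <= i < (Num.truncn (n%:R * 1 : R)).+1) q n i * e n i) / s n)
    @[n --> \oo] --> expR (a * 1) * G 1 by exact: (cvgM un (grid_mean ler01)).
apply: cvg_trans H; apply: near_eq_cvg; near=> n.
rewrite mean_recE; last first.
  by rewrite gt_eqF//; near: n; exact: (cvgr_gt _ (near_critical_cvg1 u_near)).
by rewrite mulr1 natrK mulrA.
Unshelve. all: by end_near. Qed.

Lemma uniform_in_probability (S eta h : R) : 0 < S -> 0 < eta -> 0 < h ->
  \forall n \near \oo, exists E, [/\ measurable E, (P E <= h%:E)%E &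
    forall w, ~ E w -> forall t, 0 <= t <= S ->
      `|(X n (Num.truncn (n%:R * t)) w)%:R / fine (mean P (X n n))
        - pi_fun ralpha a t| <= eta].
Proof.
move=> S0 eta0 h0.
have S20 : 0 < 2 * S by rewrite mulr_gt0.
have S2 : S <= 2 * S by lra.
pose B := (2 * S) `^ ralpha * expR (`|a| * (2 * S)).
have B0 : 0 <= B by rewrite mulr_ge0 ?powR_ge0 ?expR_ge0.
pose BE := expR (`|a| * S); have BE0 : 0 < BE by exact: expR_gt0.
pose m1 := mu_fun ralpha a 1.
have m10 : 0 < m1.
  by rewrite /m1 mu_fun_primitive// mulr_gt0 ?expR_gt0// primitive_mean_density_gt0.
(* Undoing the weight costs 2 delta (B S + 4), from the error of u_n^k times a bound on the weighted
   process, plus BE times the error 4 delta of that process. [K] then comes from [ratio_close]. *)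
pose C := 2 * (B * S + 4) + BE * 4.
pose K := 2 * C / m1 + 2 * (BE * (B * S)) / m1 ^+ 2.
have BS0 : 0 <= B * S by rewrite mulr_ge0// ltW.
have C0 : 0 <= C by have := BS0; have := BE0; rewrite /C; lra.
have K0 : 0 <= K.
  apply: addr_ge0; apply: divr_ge0; rewrite ?exprn_ge0 ?(ltW m10)//.
    by rewrite mulr_ge0.
  by rewrite mulr_ge0// mulr_ge0// ltW.
(* The bound 1 keeps the weighted process below B S + 4, [m1 / 2] is the condition of [ratio_close],
   and the last term makes the final error at most [eta]. *)
pose delta := Num.min (Num.min 1 (m1 / 2)) (eta / (K + 1)).
have K1 : 0 < K + 1 by rewrite ltr_wpDl.
have delta0 : 0 < delta by rewrite !lt_min ltr01 !divr_gt0.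
have delta1 : delta <= 1 by rewrite !ge_min lexx.
have deltam : delta <= m1 / 2 by rewrite !ge_min lexx orbT.
have deltaK : K * delta <= eta.
  have : delta * (K + 1) <= eta by rewrite -ler_pdivlMr// ge_min lexx orbT.
  by lra.
(* A mesh fine enough for [G], with Lipschitz constant [B], to vary by at most [delta] over one
   cell. *)
pose L := (Num.truncn (B * S / delta)).+1.
have L0 : (0 < L)%N by [].
have L0R : 0 < L%:R :> R by rewrite ltr0n.
have BL : B * (S / L%:R) <= delta.
  rewrite mulrA ler_pdivrMr// -ler_pdivrMl// mulrC.
  by apply/ltW; have /andP[] := truncn_itv (divr_ge0 BS0 (ltW delta0)).
have SL0 : 0 <= S / L%:R by rewrite divr_ge0// ltW.
(* The exponents a k/n and a t differ by at most |a|/n; below this threshold their exponentials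
   differ by at most [delta]. *)
have eta1 : 0 < ln (1 + delta / BE) by rewrite ln_gt0// ltrDl divr_gt0.
near=> n.
have n0 : (0 < n)%N by near: n; exists 1%N.
have n0R : 0 < n%:R :> R by rewrite ltr0n.
have s0 : 0 < s n by rewrite mulr_gt0// alpha_gt0.
have [E [mE PE HE]] : exists E, [/\ measurable E, (P E <= h%:E)%E &
    forall w, ~ E w ->
      (forall k : nat, k%:R <= 2 * S * n%:R -> `|N n k w| <= delta * s n) /\
      (forall j, (j < L.+2)%N ->
        `|Z n (Num.truncn (n%:R * (j%:R * (S / L%:R)))) w -
          \sum_(1 <= i < (Num.truncn (n%:R * (j%:R * (S / L%:R)))).+1) q n i * e n i|
        <= delta * s n)] by near: n; exact: exceptional.
have HM : forall j, (j < L.+2)%N ->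
    `|(\sum_(1 <= i < (Num.truncn (n%:R * (j%:R * (S / L%:R)))).+1) q n i * e n i) / s n
      - G (j%:R * (S / L%:R))| <= delta.
  near: n; apply: near_finite_forall => j _.
  have t0 : 0 <= j%:R * (S / L%:R) by rewrite mulr_ge0.
  have /cvgrPdist_le /(_ _ delta0) := grid_mean t0.
  by apply: filterS => n; rewrite distrC.
have [u0 Hu] : 0 < u n /\ forall k : nat, k%:R <= S * n%:R ->
    `|u n ^+ k - expR (a * (k%:R / n%:R))| <= delta /\
    `|(u n ^+ k)^-1 - expR (- (a * (k%:R / n%:R)))| <= delta.
  by near: n; exact: (near_critical_powers u_near S0 delta0).
have an : `|a| / ln (1 + delta / BE) <= n%:R by near: n; exact: nbhs_infty_ger.
have HA : `|mean_rec (u n) (e n) n / s n - m1| <= delta.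
  rewrite distrC; near: n.
  by have /cvgrPdist_le := total_mean; exact.
exists E; split => // w /HE[HN HZ] t /andP[t0 tS].
pose k := Num.truncn (n%:R * t); rewrite -/k.
have /andP[kt tk] : k%:R <= n%:R * t < k.+1%:R by rewrite truncn_itv// mulr_ge0.
have kS : k%:R <= S * n%:R by rewrite (le_trans kt)// mulrC ler_wpM2r.
have q0 i : 0 <= q n i by rewrite invr_ge0 exprn_ge0// ltW.
have HY : `|q n k * (X n k w)%:R / s n - G t| <= 4 * delta.
  rewrite X_decomp ?gt_eqF//.
  apply: (@monotone_grid_close R n L (s n) S delta B (fun i => N n i w)
    (fun i => Z n i w) (fun j => \sum_(1 <= i < (Num.truncn (n%:R * (j%:R * (S / L%:R)))).+1)
    q n i * e n i)) => //.
  - move=> i j ij; rewrite /Z (@big_cat_nat _ _ _ i.+1 1 j.+1)//= lerDl.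
    by apply: sumr_ge0 => l _; rewrite mulr_ge0.
  - by move=> x y x0 xy yS; exact: primitive_mean_density_lip.
  - by rewrite t0.
have Gt : 0 <= G t <= B * S.
  rewrite primitive_mean_density_ge0/=.
  have := primitive_mean_density_lip a ralpha_ge0 (lexx 0) t0 (le_trans tS S2).
  rewrite primitive0 !subr0 => H; apply: (le_trans (ler_norm _)).
  by apply: (le_trans H); rewrite ler_wpM2l.
have atS : expR (a * t) <= BE.
  rewrite ler_expR (le_trans (ler_norm _))// normrM (ger0_norm t0).
  by rewrite ler_wpM2l.
have Hexp : `|expR (a * (k%:R / n%:R)) - expR (a * t)| <= delta.
  pose th := a * (k%:R / n%:R - t).
  have -> : a * (k%:R / n%:R) = a * t + th by rewrite /th; ring.
  rewrite expRD -{2}[expR (a * t)]mulr1 -mulrBr normrM ger0_norm ?expR_ge0//.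
  apply: (@le_trans _ _ (BE * (delta / BE))); last by rewrite mulrC divfK ?gt_eqF.
  apply: ler_pM; rewrite ?expR_ge0//; apply: abs_expRB1.
    by rewrite divr_ge0// ltW.
  rewrite ler_pdivrMr// in an.
  have h1 : `|k%:R / n%:R - t| <= n%:R^-1 by exact: truncn_scale_close.
  rewrite /th normrM; apply: (@le_trans _ _ (`|a| * n%:R^-1)); first by rewrite ler_wpM2l.
  by rewrite ler_pdivrMr// mulrC.
have [Huk _] := Hu k kS.
have HX : `|(X n k w)%:R / s n - expR (a * t) * G t| <= C * delta.
  have -> : (X n k w)%:R / s n = u n ^+ k * (q n k * (X n k w)%:R / s n).
    by rewrite /q !mulrA divff ?mul1r// expf_neq0// gt_eqF.
  set Y := q n k * _ / s n in HY *.
  have -> : u n ^+ k * Y - expR (a * t) * G t =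
    (u n ^+ k - expR (a * t)) * Y + expR (a * t) * (Y - G t) by ring.
  have h1 : `|u n ^+ k - expR (a * t)| <= 2 * delta.
    rewrite (le_trans (ler_distD (expR (a * (k%:R / n%:R))) _ _))//.
    by rewrite mulr2n mulrDl mul1r lerD.
  have h2 : `|Y| <= B * S + 4.
    have /andP[g0 gB] := Gt; rewrite -[Y](subrK (G t)) addrC.
    rewrite (le_trans (ler_normD _ _))// ger0_norm// lerD// (le_trans HY)//.
    by rewrite -[leRHS]mulr1 ler_wpM2l.
  apply: (le_trans (ler_normD _ _)); rewrite /C [leRHS]mulrDl; apply: lerD.
    rewrite normrM.
    by rewrite (_ : 2 * _ * delta = 2 * delta * (B * S + 4)); [exact: ler_pM|ring].
  by rewrite normrM -[leRHS]mulrA (ger0_norm (expR_ge0 _)) ler_pM ?expR_ge0.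
rewrite A_mean// /pi_fun mu_fun_primitive//.
rewrite (_ : _ / mean_rec _ _ _ = (X n k w)%:R / s n / (mean_rec (u n) (e n) n / s n)).
  apply: le_trans deltaK; apply: ratio_close => //.
  move/andP: Gt => [g0 gB]; rewrite normrM !ger0_norm ?expR_ge0//.
  by rewrite ler_pM ?expR_ge0.
rewrite invf_div mulrA divfK// gt_eqF//.
Unshelve. all: by end_near. Qed.

End functional_limit.

Theorem theorem2p2 (d : measure_display) (T : measurableType d) (R : realType)
    (P : probability T R)
    (xi : nat -> nat -> nat -> {RV P >-> nat})
    (eps : nat -> nat -> {RV P >-> nat})
    (alpha beta : nat -> R) (ralpha rbeta a : R)
    (* i.i.d. offspring variables, independent of the immigration *)
    (xi_indep : forall n, (0 < n)%N ->
      mutually_independent P [set p : nat * nat | (0 < p.1)%N /\ (0 < p.2)%N]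
        (fun p => xi n p.1 p.2))
    (xi_id : forall n, (0 < n)%N ->
      identically_distributed P
        [set p : nat * nat | (0 < p.1)%N /\ (0 < p.2)%N]
        (fun p => xi n p.1 p.2))
    (xi_eps_indep : forall n, (0 < n)%N ->
      independent_sigma P
        (sigma_generated
          [set p : nat * nat | (0 < p.1)%N /\ (0 < p.2)%N]
          (fun p => xi n p.1 p.2))
        (sigma_generated [set k : nat | (0 < k)%N] (fun k => eps n k)))
    (* finite means and variances *)
    (xi_moments : forall n, (0 < n)%N ->
      mean P (xi n 1%N 1%N) \is a fin_num /\ var P (xi n 1%N 1%N) \is a fin_num)
    (eps_moments : forall n k, (0 < n)%N -> (0 < k)%N ->
      mean P (eps n k) \is a fin_num /\ var P (eps n k) \is a fin_num)
    (* mixing of the immigration *)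
    (eps_mixing : forall n, (0 < n)%N -> psi_mixing P (fun k => eps n k))
    (eps_mixing_sum :
      (ereal_sup [set \sum_(1 <= k <oo) mixing_coef P (fun i => eps n i) k
                 | n in [set n : nat | (0 < n)%N]] < +oo)%E)
    (* (C1) *)
    (ralpha_ge0 : 0 <= ralpha) (rbeta_ge0 : 0 <= rbeta)
    (alpha_rv : regularly_varying ralpha alpha)
    (beta_rv : regularly_varying rbeta beta)
    (C1_alpha : forall s : R, 0 <= s ->
      (fun n : nat =>
         \big[Num.max/0]_(1 <= k < (Num.truncn (n%:R * s)).+1)
           `|fine (mean P (eps n k)) - alpha k|) =o_\oo alpha)
    (C1_beta : forall s : R, 0 <= s ->
      (fun n : nat =>
         \big[Num.max/0]_(1 <= k < (Num.truncn (n%:R * s)).+1)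
           `|fine (var P (eps n k)) - beta k|) =o_\oo beta)
    (C2 : (fun n : nat => fine (mean P (xi n 1%N 1%N)) - (1 + a * n%:R^-1))
            =o_\oo (fun n : nat => n%:R^-1 : R))
    (C3 : (fun n : nat => fine (var P (xi n 1%N 1%N))) =o_\oo alpha)
    (C4_alpha : alpha n @[n --> \oo] --> +oo)
    (C4_beta : beta =o_\oo (fun n : nat => n%:R * alpha n ^+ 2)) :
  let X n k w := branching (fun k j => xi n k j) (fun k => eps n k) k w in
  let A n := fine (mean P (X n n)) in
  weakly_converges P
    (fun n w => step_path (fun k => (X n k w)%:R / A n) n)
    (fun=> pi_path a ralpha_ge0).
Proof.
move=> X A; apply: weakly_converges_cst => [n|e h e0 h0].
  apply: random_element_step_path => k.
  apply: (measurable_levels_branching (K := k)) => // [l j _ _|l _];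
    exact/measurable_fun_levels/measurable_funPT.
(* The horizon beyond which the Skorokhod distance has weight below [e / 2]; a uniform error [e / 4]
   on [[0, S]] then keeps the distance below [e]. *)
pose S : R := Num.max 1 (- ln (e / 2) + 1).
have e20 : 0 < e / 2 by rewrite divr_gt0.
have e40 : 0 < e / 4 by rewrite divr_gt0.
have S0 : 0 < S by rewrite lt_max ltr01.
have Se : expR (- S) < e / 2.
  rewrite -[ltRHS](lnK e20) ltr_expR ltrNl lt_max; apply/orP; right.
  by rewrite ltrDl.
have H := uniform_in_probability xi_indep xi_id xi_eps_indep xi_moments eps_moments
  eps_mixing_sum ralpha_ge0 rbeta_ge0 alpha_rv beta_rv C1_alpha C1_beta C2 C3 C4_beta
  S0 e40 h0.
near=> n.
have [E [mE PE HE]] : exists E, [/\ measurable E, (P E <= h%:E)%E &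
    forall w, ~ E w -> forall t, 0 <= t <= S ->
      `|(X n (Num.truncn (n%:R * t)) w)%:R / fine (mean P (X n n))
        - pi_fun ralpha a t| <= e / 4] by near: n; exact: H.
exists E; split => // w nEw.
apply: (@le_lt_trans _ _ (e / 4 + expR (- S))%:E); last by rewrite lte_fin; lra.
apply: skorokhod_dist_le; [exact: ltW|exact: ltW|move=> t tS].
by rewrite distrC; exact: HE.
Unshelve. all: by end_near. Qed.
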